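(* Let $p=(p_k)_{k\ge0}$ be a probability distribution on $\mathbb{N}_0$ with $p_0=0$, $p_1<1$, $m_{\mathtt{BGW}}=\sum_k kp_k<\infty$, let $\omega$ have law $\mathtt{BGW}$ (Bienaymé–Galton–Watson tree with offspring law $p$), and let $d_{\min}:=\min\{k:p_k>0\}$. Let $\lambda>0$ and let $(X(u),u\in\mathbb{T})$ be the $\lambda$-biased branching random walk on $\omega$ with reproduction law $\mu$, where $\mu_0=0$, $\mu_1<1$, $m=\sum_k k\mu_k\in(1,\infty)$. For a vertex $x$ of $\omega$ let $$\alpha_x:=\mathbf{P}_\omega\big(\forall n\in\mathbb{N}\ \exists u\in\mathbb{T}: |u|\ge n,\ X(u)=x \,\big|\, X(\varnothing)=x\big).$$ Then for $\mathtt{BGW}$-a.e. $\omega$: the branching random walk is transient in the sense that $\alpha_x=0$ for all $x\in\omega$ if and only if $$\lambda<d_{\min}\quad\text{and}\quad m\le\frac{d_{\min}+\lambda}{2\sqrt{\lambda d_{\min}}}.$$ Otherwise, i.e. if $\lambda\ge d_{\min}$ or $m>\frac{d_{\min}+\lambda}{2\sqrt{\lambda d_{\min}}}$, the branching random walk is strongly recurrent: $\alpha_x=1$ for all $x\in\omega$.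
   Context: $\varrho$ is the root of $\omega$; $|x|$ is the distance of $x$ to $\varrho$, $x_-$ the parent and $\kappa_x$ the number of children of $x$. The $\lambda$-biased random walk on $\omega$ jumps from $\varrho$ to each child of $\varrho$ with probability $1/\kappa_\varrho$, and from $x\ne\varrho$ to $x_-$ with probability $\lambda/(\lambda+\kappa_x)$ and to each child of $x$ with probability $1/(\lambda+\kappa_x)$. The $\lambda$-biased branching random walk: the genealogy $\mathbb{T}$ is a Bienaymé–Galton–Watson tree with offspring law $\mu$ (root $\varnothing$, $|u|$ the generation of $u$) independent of $\omega$; given $\omega$, each child of a particle at $x$ is placed independently at a position chosen by one step of the $\lambda$-biased random walk from $x$. $\mathbf{P}_\omega$ is the quenched law given $\omega$. *)

(* Defs.v *)
From HB Require Import structures.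
From mathcomp Require Import all_boot all_order all_algebra.
From mathcomp Require Import all_classical all_reals all_analysis.
Set Implicit Arguments. Unset Strict Implicit. Unset Printing Implicit Defensive.
Import Order.TTheory GRing.Theory Num.Theory.
Import numFieldNormedType.Exports.
Local Open Scope classical_set_scope.
Local Open Scope ring_scope.

(* Ulam--Harris words: the vertex [i :: x] is the i-th child (0-based) of
   the vertex [x]; the root is [::]; the parent of [x] is [behead x] and the
   depth |x| is [size x].  A (rooted, locally finite) tree is encoded by its
   numbers of children [kappa : seq nat -> nat]; its vertex set is
   [in_tree kappa]. *)
Fixpoint in_tree (kappa : seq nat -> nat) (x : seq nat) : bool :=
  match x with
  | [::] => true
  | i :: x' => in_tree kappa x' && (i < kappa x')%N
  end.

Definition bstep {R : realType} (kappa : seq nat -> nat) (lam : R)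
    (x y : seq nat) : R :=
  match x with
  | [::] => match y with
            | [:: i] => if (i < kappa [::])%N then ((kappa [::])%:R)^-1 else 0
            | _ => 0
            end
  | _ :: x' =>
      if y == x' then lam / (lam + (kappa x)%:R)
      else match y with
           | i :: y' => if (y' == x) && (i < kappa x)%N
                        then (lam + (kappa x)%:R)^-1 else 0
           | [::] => 0
           end
  end.

Definition iid_family {R : realType} {d : measure_display} {T : measurableType d}
    (P : probability T R) (Z : T -> seq nat -> nat) (p : nat -> R) : Prop :=
  (forall v k, measurable [set w | Z w v = k]) /\
  (forall (S : seq (seq nat)) (k : seq nat -> nat), uniq S ->
     P [set w | forall v, v \in S -> Z w v = k v]
     = (\prod_(v <- S) p (k v))%:E).

(* [(Q, nu, X)] realizes the lambda-biased branching random walk on the fixed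
   tree [kappa] (quenched law P_omega), started from [X(root) = x], with
   reproduction law [mu]: the genealogy is the BGW(mu) tree [in_tree (nu w)]
   (i.i.d. offspring numbers [nu u] ~ mu), independent of the positions, and
   each child [i :: u] is placed by one independent step of the biased walk
   from [X u].  Characterized by its finite-dimensional distributions on
   finite prefix-closed sets of words containing the root. *)
Definition brw_law {R : realType} (kappa : seq nat -> nat) (lam : R)
    (mu : nat -> R) (x : seq nat)
    {d : measure_display} {T : measurableType d} (Q : probability T R)
    (nu : T -> seq nat -> nat) (X : T -> seq nat -> seq nat) : Prop :=
  (forall u k, measurable [set w | nu w u = k]) /\
  (forall u y, measurable [set w | X w u = y]) /\
  (forall (S : seq (seq nat)) (k : seq nat -> nat) (y : seq nat -> seq nat),
     uniq S -> [::] \in S -> (forall u, u \in S -> behead u \in S) ->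
     Q [set w | forall u, u \in S -> nu w u = k u /\ X w u = y u]
     = ((y [::] == x)%:R * \prod_(u <- S) mu (k u)
        * \prod_(u <- S | u != [::]) bstep kappa lam (y (behead u)) (y u))%:E).

Definition visits_io {T : Type} (nu : T -> seq nat -> nat)
    (X : T -> seq nat -> seq nat) (x : seq nat) : set T :=
  [set w | forall n : nat, exists u, in_tree (nu w) u /\ (n <= size u)%N
                                     /\ X w u = x].

(* alpha_x = a, where alpha_x is the P_omega-probability of [visits_io]
   started from x (the value does not depend on the chosen realization). *)
Definition alpha_eq {R : realType} (kappa : seq nat -> nat) (lam : R)
    (mu : nat -> R) (x : seq nat) (a : R) : Prop :=
  forall (d : measure_display) (T : measurableType d) (Q : probability T R)
         (nu : T -> seq nat -> nat) (X : T -> seq nat -> seq nat),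
    brw_law kappa lam mu x Q nu X -> Q (visits_io nu X x) = a%:E.

Definition brw_transient {R : realType} (kappa : seq nat -> nat) (lam : R)
    (mu : nat -> R) : Prop :=
  forall x, in_tree kappa x -> alpha_eq kappa lam mu x 0.

Definition brw_strongly_recurrent {R : realType} (kappa : seq nat -> nat)
    (lam : R) (mu : nat -> R) : Prop :=
  forall x, in_tree kappa x -> alpha_eq kappa lam mu x 1.

(* Main.v *)
Require Import Defs.
From HB Require Import structures.
From mathcomp Require Import all_boot all_order all_algebra.
From mathcomp Require Import all_classical all_reals all_analysis.
From mathcomp Require Import ring lra zify.
Import Order.TTheory GRing.Theory Num.Theory.
Import numFieldNormedType.Exports.
Set Implicit Arguments.
Unset Strict Implicit.
Unset Printing Implicit Defensive.
Local Open Scope classical_set_scope.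
Local Open Scope ring_scope.

(* Transience.  For r = sqrt(lam / dmin) the function f x = r ^ |x| satisfies m P f <= f, where P is
   the step operator of the biased walk, with a strict inequality at the root.  Hence the Green
   function of m P is finite, and so is the mean number of visits to any vertex.

   Recurrence.  Let r x be the probability that the walk started at x never visits a target o, for the
   offspring law cut at a large D with generating function G.  Then r <= G (P r) and r o = 0, and since
   G s <= c s with c < 1 away from s = 1, r vanishes as soon as sup r < 1.
   - If all degrees are bounded by some K < lam, a Lyapunov function b ^ |x| with 1 < b < lam / K gives
     r <= r root < 1.
   - Otherwise some finite spherically symmetric tree, made of vertices of degree dmin, possibly below
     vertices of a degree K >= lam, has positive probability and carries a positive f with M P f >= f
     for some M < m; comparing 1 - r with multiples of f gives r <= 1 - e at the top of each of its
     copies.  Call a step from v to a child bad if the first-child line through a fixed sibling of that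
     child does not reach such a copy soon through vertices of bounded degree.  The mean number of bad
     children is close to p 1 < 1, so all components of bad steps are finite, and the maximum principle
     bounds r by 1 - e' everywhere.

   In the recurrent case, transience is refuted by exhibiting one realization of the walk, built from
   independent discrete variables obtained by nested subdivisions of [0, 1[. *)

(** * Events determined by finitely many discrete coordinates *)

(** Both directions rest on one expression. If [f] is a function of [|x|] whose successive values
    have ratio [t], then [(lam + k) * P f / f] at a vertex of degree [k] other than the root is
    [lam / t + k * t], with minimum [2 * sqrt (lam * k)] at [t = sqrt (lam / k)]. For transience
    that ratio is kept; for recurrence the same lower bound forces the ratios of a solution down to
    a nonpositive value after finitely many levels, so a finite tree suffices.

    The obstacle in the recurrent case is unbounded degree: survival passes from a child to its
    parent with a factor of order [1 / (lam + kappa)], so a copy of the tree nearby gives no uniform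
    bound unless degrees on the way are bounded. The route is sought below a sibling so that the
    subtree of the child itself stays unexplored, hence independent of the step. An only child has
    no sibling, which is where [p 1] comes from.

    The cut at [D] makes events of finitely many generations depend on finitely many coordinates,
    and it bounds the second-order error of [G] at 1. Conditioning is done throughout by summing
    over cylinders. *)

Section real_probability.
Context {R : realType} {d : measure_display} {T : measurableType d}.
Variable Q : probability T R.

Definition prob (A : set T) : R := fine (Q A).

Lemma probE A : measurable A -> Q A = (prob A)%:E.
Proof. by move=> mA; rewrite /prob fineK// fin_num_measure. Qed.

Lemma prob_ge0 A : 0 <= prob A.
Proof. exact/fine_ge0/measure_ge0. Qed.

Lemma prob_le1 A : measurable A -> prob A <= 1.
Proof. by move=> mA; rewrite -lee_fin -probE// probability_le1. Qed.

Lemma prob_setT : prob setT = 1.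
Proof. by rewrite /prob probability_setT. Qed.

Lemma prob_set0 : prob set0 = 0.
Proof. by rewrite /prob measure0. Qed.

Lemma prob_mono A B : measurable A -> measurable B -> A `<=` B ->
  prob A <= prob B.
Proof.
by move=> mA mB AB; rewrite -lee_fin -!probE// le_measure// inE.
Qed.

Lemma prob_setU_le A B : measurable A -> measurable B ->
  prob (A `|` B) <= prob A + prob B.
Proof.
move=> mA mB; rewrite -lee_fin EFinD -!probE//; last exact: measurableU.
exact: measureU2.
Qed.

Lemma prob_setU A B : measurable A -> measurable B -> A `&` B = set0 ->
  prob (A `|` B) = prob A + prob B.
Proof.
move=> mA mB AB0; apply: EFin_inj; rewrite EFinD -!probE//; last exact: measurableU.
exact: measureU.
Qed.

Lemma prob_setIDC A B : measurable A -> measurable B ->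
  prob (A `&` ~` B) = prob A - prob (A `&` B).
Proof.
move=> mA mB.
have -> : prob A = prob (A `&` B) + prob (A `&` ~` B).
  rewrite -prob_setU -?setIUr ?setUv ?setIT//.
  - exact: measurableI.
  - by apply: measurableI => //; exact: measurableC.
  - by rewrite setIACA setICr setI0.
by rewrite addrAC subrr add0r.
Qed.

Lemma prob_has_le (J : eqType) (s : seq J) (A : J -> set T) (B : set T) :
  measurable B -> (forall j, measurable (A j)) ->
  (B `<=` [set w | exists2 j, j \in s & A j w]) ->
  prob B <= \sum_(j <- s) prob (A j).
Proof.
elim: s B => [|j s IH] B mB mA sB.
  rewrite big_nil (_ : B = set0) ?prob_set0//.
  by rewrite -subset0 => w /sB[].
rewrite big_cons.
have -> : B = (B `&` A j) `|` (B `&` ~` A j) by rewrite -setIUr setUv setIT.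
have mBA : measurable (B `&` A j) by exact: measurableI.
have mBC : measurable (B `&` ~` A j) by apply: measurableI => //; exact: measurableC.
apply: (le_trans (prob_setU_le mBA mBC)); apply: lerD.
  by apply: prob_mono => // w [].
apply: IH => // w [/sB[i]]; rewrite inE => /predU1P[->//|si Ai nAj].
by exists i.
Qed.

Lemma prob_bigcup_null (A : nat -> set T) (B : set T) :
  measurable B -> (forall n, measurable (A n)) -> (forall n, prob (A n) = 0) ->
  B `<=` \bigcup_n A n -> prob B = 0.
Proof.
move=> mB mA A0 BA; apply/EFin_inj; rewrite -probE//; apply/eqP.
rewrite -measure_le0 (le_trans (measure_sigma_subadditive Q mA mB BA))//.
rewrite eseries0// => n _ _; by have /= := probE (mA n); rewrite A0.
Qed.

Lemma prob_countable_null (C : countType) (A : C -> set T) (B : set T) :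
  measurable B -> (forall c, measurable (A c)) -> (forall c, prob (A c) = 0) ->
  (forall w, B w -> exists c, A c w) -> prob B = 0.
Proof.
move=> mB mA A0 BA.
apply: (@prob_bigcup_null (fun n => if unpickle n is Some c then A c else set0)) => //.
- by move=> n; case: unpickle.
- by move=> n; case: unpickle => [c|]; rewrite ?prob_set0.
- by move=> w /BA[c Ac]; exists (pickle c) => //; rewrite pickleK.
Qed.

Lemma prob_bigcup_ndecr_le (A : nat -> set T) (c : R) :
  (forall n, measurable (A n)) -> {homo A : n m / (n <= m)%N >-> n `<=` m} ->
  (forall n, prob (A n) <= c) -> prob (\bigcup_n A n) <= c.
Proof.
move=> mA hA Ac; have mU : measurable (\bigcup_n A n) by exact: bigcup_measurable.
rewrite -lee_fin -probE//.
have h : {homo A : n m / (n <= m)%N >-> (n <= m)%O}.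
  by move=> n m nm; apply/subsetPset/hA.
have cv := @nondecreasing_cvg_mu _ _ _ Q A mA mU h.
rewrite -(cvg_lim _ cv)//; apply: lime_le; first by apply/cvg_ex; exists (Q (\bigcup_n A n)).
by near=> n; rewrite /= probE// lee_fin.
Unshelve. all: by end_near. Qed.

End real_probability.

Section determined_events.
Context {R : realType} {d : measure_display} {T : measurableType d}.
Variable Q : probability T R.
Context {I : eqType} {C : countType}.
Variable Z : T -> I -> C.
Hypothesis mZ : forall u c, measurable [set w | Z w u = c].

Definition cylinder (S : seq I) (w : T) : set T :=
  [set w' | forall u, u \in S -> Z w' u = Z w u].

Definition determined (S : seq I) (E : set T) : Prop :=
  forall w w', E w -> cylinder S w w' -> E w'.

Lemma measurable_cylinder S w : measurable (cylinder S w).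
Proof.
elim: S => [|u S IH].
  by rewrite (_ : cylinder _ _ = setT)//; apply/seteqP; split.
rewrite (_ : cylinder _ _ = [set w' | Z w' u = Z w u] `&` cylinder S w).
  exact: measurableI.
apply/seteqP; split=> w' /=.
  by move=> h; split=> [|v vS]; apply: h; rewrite inE ?eqxx ?vS ?orbT.
by move=> [h1 h2] v; rewrite inE => /predU1P[->|/h2].
Qed.

(** Coordinates take countably many values, so the values on [S] fit in one natural number. Its
    level sets cut a [determined] event into countably many cylinders, which gives both
    measurability and additivity. *)
Let trace (S : seq I) (w : T) : nat := pickle [seq Z w u | u <- S].

Let trace_cylinder S w w' : trace S w' = trace S w <-> cylinder S w w'.
Proof.
split.
  by move=> /(pcan_inj pickleK)/eq_in_map.
by move=> h; rewrite /trace; congr pickle; apply/eq_in_map.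
Qed.

Let fiber S E n : determined S E ->
  E `&` [set w | trace S w = n] = set0 \/
  exists2 w, E w & E `&` [set w | trace S w = n] = cylinder S w.
Proof.
move=> dE; have [->|/set0P[w [Ew wn]]] := eqVneq (E `&` [set w | trace S w = n]) set0.
  by left.
right; exists w => //; apply/seteqP; split => w' /=.
  by move=> [_ w'n]; apply/trace_cylinder; rewrite w'n.
by move=> cw; split; [exact: dE cw|rewrite -wn; exact/trace_cylinder].
Qed.

Let mfiber S E n : determined S E -> measurable (E `&` [set w | trace S w = n]).
Proof.
by move=> /fiber-/(_ n)[->|[w _ ->]] //; exact: measurable_cylinder.
Qed.

Let fiberU S (E : set T) : E = \bigcup_n (E `&` [set w | trace S w = n]).
Proof.
by apply/seteqP; split=> [w Ew|w [n _ []]//]; exists (trace S w).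
Qed.

Lemma measurable_determined S E : determined S E -> measurable E.
Proof.
by move=> dE; rewrite (fiberU S E); apply: bigcup_measurable => n _; exact: mfiber.
Qed.

Let fiber_sum S (E : set T) : (forall n, measurable (E `&` [set w | trace S w = n])) ->
  Q E = (\sum_(0 <= n <oo) Q (E `&` [set w | trace S w = n]))%E.
Proof.
move=> mE; rewrite {1}(fiberU S E) measure_bigcup//.
  by apply: eq_eseriesl => n; rewrite in_setT.
apply/trivIsetP => n m _ _ /eqP nm; rewrite -subset0 => w [[_ /= wn] [_ /= wm]].
by apply: nm; rewrite -wn -wm.
Qed.

(** Replaces conditioning on the coordinates in [S]: a bound with the same factor [a] on each
    cylinder meeting [E] is summed over these cylinders. *)
Lemma prob_determinedI_le S E F (a : R) : determined S E -> measurable F -> 0 <= a ->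
  (forall w, E w -> prob Q (cylinder S w `&` F) <= a * prob Q (cylinder S w)) ->
  prob Q (E `&` F) <= a * prob Q E.
Proof.
move=> dE mF a0 H; have mE := measurable_determined dE.
rewrite -lee_fin EFinM -!probE//; last exact: measurableI.
have mf n : measurable (E `&` F `&` [set w | trace S w = n]).
  by rewrite setIAC; apply: measurableI => //; exact: mfiber.
rewrite (fiber_sum mf) (@fiber_sum S E) -?nneseriesZl//; last first.
  by move=> n; exact: mfiber.
apply: lee_nneseries => // n _.
have mEn := mfiber n dE; rewrite setIAC.
have [->|[w Ew ->]] := fiber n dE; first by rewrite set0I measure0 mule0.
have mc := measurable_cylinder S w.
rewrite !probE -?EFinM ?lee_fin//; first exact: H.
exact: measurableI.
Qed.

Lemma prob_determinedI S E F (a : R) : determined S E -> measurable F -> 0 <= a ->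
  (forall w, E w -> prob Q (cylinder S w `&` F) = a * prob Q (cylinder S w)) ->
  prob Q (E `&` F) = a * prob Q E.
Proof.
move=> dE mF a0 H; have mE := measurable_determined dE.
apply: EFin_inj; rewrite EFinM -!probE//; last exact: measurableI.
have mf n : measurable (E `&` F `&` [set w | trace S w = n]).
  by rewrite setIAC; apply: measurableI => //; exact: mfiber.
rewrite (fiber_sum mf) (@fiber_sum S E) -?nneseriesZl//; last first.
  by move=> n; exact: mfiber.
apply: eq_eseriesr => n _.
have mEn := mfiber n dE; rewrite setIAC.
have [->|[w Ew ->]] := fiber n dE; first by rewrite set0I measure0 mule0.
have mc := measurable_cylinder S w.
rewrite !probE -?EFinM ?H//.
exact: measurableI.
Qed.

Lemma determinedT S : determined S setT. Proof. by []. Qed.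

Lemma determined_cylinder S w : determined S (cylinder S w).
Proof. by move=> w1 w2 h1 h2 u uS; rewrite h2// h1. Qed.

Lemma determinedI S E F : determined S E -> determined S F -> determined S (E `&` F).
Proof. by move=> dE dF w w' [Ew Fw] cw; split; [exact: dE cw|exact: dF cw]. Qed.

Lemma sub_determined S S' E : {subset S <= S'} -> determined S E -> determined S' E.
Proof. by move=> sS dE w w' Ew cw; apply: dE Ew _ => u /sS; exact: cw. Qed.

Lemma determinedC S E : determined S E -> determined S (~` E).
Proof.
move=> dE w w' nE cw E'; apply: nE; apply: dE E' _ => u uS; exact/esym/cw.
Qed.

End determined_events.

(** * The step operator and the one-step estimate *)

Section step_operator.
Context {R : realType}.
Variables (kappa : seq nat -> nat) (lam : R).
Hypothesis lam_gt0 : 0 < lam.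
Implicit Types (g h : seq nat -> R) (y z : seq nat).

Definition nbrs z : seq (seq nat) :=
  (if z is _ :: z' then [:: z'] else [::]) ++
  [seq i :: z | i <- iota 0 (kappa z)].

Definition step_op g z : R := \sum_(y <- nbrs z) bstep kappa lam z y * g y.

Lemma mem_nbrs_child i z : (i < kappa z)%N -> i :: z \in nbrs z.
Proof.
move=> iz; rewrite mem_cat; apply/orP; right.
by apply/mapP; exists i => //; rewrite mem_iota.
Qed.

Lemma nbrsP y z : reflect ((exists i, z = i :: y) \/
  (exists2 i, (i < kappa z)%N & y = i :: z)) (y \in nbrs z).
Proof.
rewrite mem_cat; apply: (iffP orP) => -[].
- by case: z => // a z'; rewrite inE => /eqP ->; left; exists a.
- by move=> /mapP[i]; rewrite mem_iota => iz ->; right; exists i.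
- by move=> [i ->]; left; rewrite inE.
- by move=> [i iz ->]; right; apply/mapP; exists i => //; rewrite mem_iota.
Qed.

Lemma nbrs_uniq z : uniq (nbrs z).
Proof.
rewrite cat_uniq map_inj_uniq ?iota_uniq ?andbT; last by move=> ? ? [].
case: z => [|a z] /=; first by apply/hasPn.
apply/hasPn => y /mapP[i _ ->]; rewrite inE; apply/eqP => /(congr1 size) /=; lia.
Qed.

Lemma denom_gt0 z : 0 < lam + (kappa z)%:R.
Proof. by rewrite ltr_wpDr// ler0n. Qed.

Lemma bstep_ge0 z y : 0 <= bstep kappa lam z y.
Proof.
have h k : 0 <= lam + k%:R :> R by rewrite addr_ge0// ltW.
case: z => [|a z] /=.
  by case: y => // i [|//]; case: ifP => // _; rewrite invr_ge0 ler0n.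
case: ifP => _; first by rewrite divr_ge0// ltW.
by case: y => // i y; case: ifP => // _; rewrite invr_ge0.
Qed.

Lemma bstep_out z y : y \notin nbrs z -> bstep kappa lam z y = 0.
Proof.
move=> /nbrsP yz; case: z yz => [|a z] yz /=.
  case: y yz => // i [|//] yz; case: ifP => // ik; exfalso; apply: yz.
  by right; exists i.
case: eqP => [e|_]; first by exfalso; apply: yz; left; exists a; rewrite e.
case: y yz => // i y yz; case: ifP => // /andP[/eqP e ik]; exfalso; apply: yz.
by right; exists i; rewrite ?e.
Qed.

(** At the root the probability is [1 / kappa], which is larger; the common bound avoids a case
    distinction when survival is compared along an edge. *)
Lemma bstep_child i z : (i < kappa z)%N ->
  (lam + (kappa z)%:R)^-1 <= bstep kappa lam z (i :: z).
Proof.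
case: z => [|a z] /= iz; rewrite ?iz ?eqxx /=.
  rewrite lef_pV2 ?posrE ?ltr0n ?denom_gt0//; last by lia.
  by rewrite lerDr ltW.
by case: eqP => [/(congr1 size) /=|//]; lia.
Qed.

Lemma bstep_parent a z : bstep kappa lam (a :: z) z = lam / (lam + (kappa (a :: z))%:R).
Proof. by rewrite /= eqxx. Qed.

Lemma step_op_nil g :
  step_op g [::] = (\sum_(i <- iota 0 (kappa [::])) g [:: i]) / (kappa [::])%:R.
Proof.
rewrite /step_op /nbrs /= big_map mulr_suml; apply: eq_big_seq => i.
by rewrite mem_iota /= => ->; rewrite mulrC.
Qed.

Lemma step_op_cons g a z :
  step_op g (a :: z) = (lam * g z + \sum_(i <- iota 0 (kappa (a :: z))) g (i :: a :: z)) /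
                       (lam + (kappa (a :: z))%:R).
Proof.
rewrite /step_op /nbrs big_cat/= big_seq1 eqxx big_map mulrDl mulrAC; congr (_ + _).
rewrite mulr_suml; apply: eq_big_seq => i.
rewrite mem_iota /= => ->; rewrite eqxx /= mulrC.
by case: eqP => // /(congr1 size) /=; lia.
Qed.

Lemma step_op_cst c z : (0 < kappa z)%N -> step_op (fun=> c) z = c.
Proof.
move=> kz; case: z kz => [|a z] kz; rewrite ?step_op_nil ?step_op_cons.
  rewrite big_const_seq count_predT size_iota iter_addr_0 -[c *+ _]mulr_natr mulfK//.
  by rewrite pnatr_eq0; lia.
rewrite big_const_seq count_predT size_iota iter_addr_0 -[c *+ _]mulr_natr (mulrC lam) -mulrDr.
by rewrite mulfK// gt_eqF// denom_gt0.
Qed.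

Lemma step_op_le g h z : (forall y, y \in nbrs z -> g y <= h y) ->
  step_op g z <= step_op h z.
Proof.
move=> gh; rewrite /step_op big_seq [leRHS]big_seq; apply: ler_sum => y yz.
by rewrite ler_wpM2l ?bstep_ge0// gh.
Qed.

Lemma eq_step_op g h z : g =1 h -> step_op g z = step_op h z.
Proof. by move=> gh; apply: eq_bigr => y _; rewrite gh. Qed.

Lemma step_opZ c g z : step_op (fun y => c * g y) z = c * step_op g z.
Proof. by rewrite /step_op mulr_sumr; apply: eq_bigr => y _; rewrite mulrCA. Qed.

Lemma step_opD g h z : step_op (fun y => g y + h y) z = step_op g z + step_op h z.
Proof. by rewrite /step_op -big_split; apply: eq_bigr => y _; rewrite /= mulrDr. Qed.

Lemma step_op_ge0 g z : (forall y, 0 <= g y) -> 0 <= step_op g z.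
Proof. by move=> g0; apply: sumr_ge0 => y _; rewrite mulr_ge0 ?bstep_ge0. Qed.

Lemma step_op_le_cst g z c : (0 < kappa z)%N -> (forall y, y \in nbrs z -> g y <= c) ->
  step_op g z <= c.
Proof. by move=> kz gc; rewrite -[leRHS](step_op_cst c kz); exact: step_op_le. Qed.

Lemma step_op_ge1 g z y : (forall y, 0 <= g y) -> y \in nbrs z ->
  bstep kappa lam z y * g y <= step_op g z.
Proof.
move=> g0 yz; rewrite /step_op (big_rem y)//= lerDl.
by apply: sumr_ge0 => ? _; rewrite mulr_ge0 ?bstep_ge0.
Qed.

End step_operator.

Section truncated_law.
Context {R : realType}.
Variables (mu : nat -> R) (D : nat).
Hypothesis mu_ge0 : forall k, 0 <= mu k.
Hypothesis mu_sum : (fun n => \sum_(0 <= k < n) mu k) @ \oo --> (1 : R).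

(* The law of [minn nu D] for [nu] of law [mu]. *)
Definition trunc_law (j : nat) : R :=
  if (j < D)%N then mu j else 1 - \sum_(0 <= k < D) mu k.

Lemma psum_le (f : nat -> R) (l : R) : (forall k, 0 <= f k) ->
  (fun n => \sum_(0 <= k < n) f k) @ \oo --> l ->
  forall n, \sum_(0 <= k < n) f k <= l.
Proof.
move=> f0 fl n; rewrite -(cvg_lim _ fl)//; apply: limr_ge.
  by apply/cvg_ex; exists l.
near=> N; have nN : (n <= N)%N by near: N; exact: nbhs_infty_ge.
by rewrite (big_cat_nat (leq0n n) nN)/= lerDl sumr_ge0.
Unshelve. all: by end_near. Qed.

Lemma trunc_law_ge0 j : 0 <= trunc_law j.
Proof. by rewrite /trunc_law; case: ifP => // _; rewrite subr_ge0 psum_le. Qed.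

Lemma trunc_law_sum : \sum_(0 <= j < D.+1) trunc_law j = 1.
Proof.
rewrite big_nat_recr//= {2}/trunc_law ltnn (eq_big_nat _ _ (F2 := mu));
  first by rewrite addrC subrK.
by move=> j /andP[_ jD]; rewrite /trunc_law jD.
Qed.

End truncated_law.

Section brw_step.
Context {R : realType}.
Variables (kappa : seq nat -> nat) (lam : R) (mu : nat -> R) (x : seq nat).
Context {d : measure_display} {T : measurableType d}.
Variables (Q : probability T R) (nu : T -> seq nat -> nat) (X : T -> seq nat -> seq nat).
Hypothesis lam_gt0 : 0 < lam.
Hypothesis mu_ge0 : forall k, 0 <= mu k.
Hypothesis mu_sum : (fun n => \sum_(0 <= k < n) mu k) @ \oo --> (1 : R).
Hypothesis law : brw_law kappa lam mu x Q nu X.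

Definition state (w : T) (u : seq nat) : nat * seq nat := (nu w u, X w u).

Definition prefix_closed (S : seq (seq nat)) : Prop :=
  [::] \in S /\ forall u, u \in S -> behead u \in S.

Lemma measurable_nu u (A : pred nat) : measurable [set w | A (nu w u)].
Proof.
rewrite (_ : [set w | _] = \bigcup_(k in [set k | A k]) [set w | nu w u = k]).
  by apply: bigcup_measurable => k _; exact: law.1.
by apply/seteqP; split=> [w Aw|w [k Ak /= ->]//]; exists (nu w u).
Qed.

Lemma measurable_nuX u k y : measurable [set w | nu w u = k /\ X w u = y].
Proof.
rewrite (_ : [set w | _] = [set w | nu w u = k] `&` [set w | X w u = y])//.
by apply: measurableI; [exact: law.1|exact: law.2.1].
Qed.

Lemma measurable_state u c : measurable [set w | state w u = c].
Proof.
case: c => k y.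
rewrite (_ : [set w | _] = [set w | nu w u = k /\ X w u = y]); first exact: measurable_nuX.
by apply/seteqP; split=> w /=; rewrite /state; [case|case=> -> ->].
Qed.

Lemma measurable_X u (A : pred (seq nat)) : measurable [set w | A (X w u)].
Proof.
by apply: (@measurable_determined _ _ _ _ _ measurable_state [:: u]);
  move=> w w' /= Aw /(_ u (mem_head _ _)) [_ ->].
Qed.

Lemma prob_brw S (k : seq nat -> nat) (y : seq nat -> seq nat) :
  uniq S -> prefix_closed S ->
  prob Q [set w | forall u, u \in S -> nu w u = k u /\ X w u = y u]
  = (y [::] == x)%:R * \prod_(u <- S) mu (k u)
    * \prod_(u <- S | u != [::]) bstep kappa lam (y (behead u)) (y u).
Proof. by move=> uS [S0 Sb]; rewrite /prob law.2.2. Qed.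

Lemma prob_cylinder S w : prefix_closed S ->
  prob Q (cylinder state S w)
  = (X w [::] == x)%:R * \prod_(u <- undup S) mu (nu w u)
    * \prod_(u <- undup S | u != [::]) bstep kappa lam (X w (behead u)) (X w u).
Proof.
move=> [S0 Sb]; rewrite -prob_brw ?undup_uniq//; last first.
  by split; [rewrite mem_undup|move=> u; rewrite !mem_undup; exact: Sb].
congr prob; apply/seteqP; split => w' /= h u.
  by rewrite mem_undup => /h [-> ->].
by move=> uS; have := h u; rewrite mem_undup => /(_ uS)[]; rewrite /state => -> ->.
Qed.

(** The branching Markov property: adding the fresh word [i :: b] to a prefix-closed set multiplies
    the finite-dimensional product by exactly two factors, the offspring weight and the step from
    the position of [b]. *)
Lemma prob_cylinder_step S w b i k y : prefix_closed S -> b \in S -> i :: b \notin S ->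
  prob Q (cylinder state S w `&` [set w' | nu w' (i :: b) = k /\ X w' (i :: b) = y])
  = mu k * bstep kappa lam (X w b) y * prob Q (cylinder state S w).
Proof.
move=> cS bS uS; set u := i :: b.
pose k' v := if v == u then k else nu w v.
pose y' v := if v == u then y else X w v.
have Su v : v \in S -> (v == u) = false by move=> vS; apply: contraNF uS => /eqP e;
  rewrite -[i :: b]/u -e.
rewrite (_ : _ `&` _ = [set w' | forall v, v \in u :: undup S -> nu w' v = k' v /\ X w' v = y' v]); last first.
  apply/seteqP; split => w' /=.
    move=> [cw [nk Xy]] v; rewrite inE mem_undup /k' /y' => /orP[/eqP -> |vS].
      by rewrite eqxx.
    by rewrite Su//; have [] := cw _ vS.
  move=> h; split; last by have := h u; rewrite mem_head /k' /y' eqxx; exact.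
  move=> v vS; have := h v; rewrite inE mem_undup vS orbT /k' /y' Su// => /(_ isT).
  by rewrite /state => -[-> ->].
rewrite prob_brw; last 2 first.
- by rewrite /= mem_undup uS undup_uniq.
- case: cS => S0 Sb; split; first by rewrite inE mem_undup S0 orbT.
  move=> v; rewrite !inE !mem_undup => /orP[/eqP ->|/Sb ->]; last by rewrite orbT.
  by rewrite /= bS orbT.
rewrite prob_cylinder// !big_cons /=.
have y'0 : y' [::] = X w [::] by [].
rewrite y'0 [k' u]/k' [y' u]/y' eqxx.
have -> : y' b = X w b by rewrite /y' Su.
have -> : \prod_(j <- undup S) mu (k' j) = \prod_(j <- undup S) mu (nu w j).
  by apply: eq_big_seq => v; rewrite mem_undup /k' => /Su ->.
have -> : \prod_(j <- undup S | j != [::]) bstep kappa lam (y' (behead j)) (y' j) =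
  \prod_(j <- undup S | j != [::]) bstep kappa lam (X w (behead j)) (X w j).
  rewrite big_seq_cond [RHS]big_seq_cond; apply: eq_bigr => v /andP[]; rewrite mem_undup => vS _.
  by rewrite /y' !Su//; exact: cS.2.
ring.
Qed.

Variable D : nat.

Lemma prob_trunc_le (B : set T) u c j : measurable B -> 0 <= c ->
  (forall k, prob Q (B `&` [set w | nu w u = k]) <= mu k * c) -> (j <= D)%N ->
  prob Q (B `&` [set w | minn (nu w u) D = j]) <= trunc_law mu D j * c.
Proof.
move=> mB c0 H jD; rewrite /trunc_law; case: ltnP => [jD'|Dj].
  rewrite (_ : [set w | _] = [set w | nu w u = j]) ?H//.
  by apply/seteqP; split => w /=; lia.
have {jD Dj} -> : j = D by lia.
pose A k : set T := B `&` [set w | nu w u = k].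
have mA k : measurable (A k) by apply: measurableI => //; apply: law.1.
(* The value [D] collects every offspring number [>= D]. These are exhausted by the windows from [D]
   to [D + n], on each of which a partial sum of [mu] gives the bound. *)
have -> : B `&` [set w | minn (nu w u) D = D] =
    \bigcup_n (\bigcup_(k in [set k | (D <= k < D + n)%N]) A k).
  apply/seteqP; split => w.
    move=> [Bw /= e1]; exists (nu w u).+1 => //; exists (nu w u) => //=; lia.
  move=> [n _ [k /= kn [Bw /= e1]]]; split => //=; lia.
apply: prob_bigcup_ndecr_le.
- by move=> n; apply: bigcup_measurable => k _.
- move=> n m nm w [k /= kn Ak]; exists k => //=; lia.
- move=> n; apply: (@le_trans _ _ (\sum_(k <- index_iota D (D + n)) prob Q (A k))).
    apply: prob_has_le => //; first by apply: bigcup_measurable => k _.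
    by move=> w [k /= kn Ak]; exists k => //; rewrite mem_index_iota.
  apply: (@le_trans _ _ (\sum_(D <= k < D + n) mu k * c)); first by apply: ler_sum => k _; exact: H.
  rewrite -mulr_suml ler_wpM2r// lerBrDl.
  rewrite -big_cat_nat//=; last by rewrite leq_addr.
  exact: psum_le.
Qed.

Section one_step.
Variables (S : seq (seq nat)) (E : set T) (b : seq nat) (i : nat) (z : seq nat).
Hypothesis cS : prefix_closed S.
Hypothesis bS : b \in S.
Hypothesis uS : i :: b \notin S.
Hypothesis dE : determined state S E.
Hypothesis EX : E `<=` [set w | X w b = z].
Let u := i :: b.

Let event j y : set T := [set w | minn (nu w u) D = j /\ X w u = y].

Let mevent j y : measurable (event j y).
Proof.
have -> : event j y = [set w | minn (nu w u) D == j] `&` [set w | X w u == y].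
  by apply/seteqP; split => w /= -[/eqP ? /eqP].
apply: measurableI; first exact: (@measurable_nu u (fun k => minn k D == j)).
exact: (@measurable_X u (fun x => x == y)).
Qed.

Let mE : measurable E := measurable_determined measurable_state dE.

Lemma prob_step_le j y : (j <= D)%N ->
  prob Q (E `&` event j y) <= trunc_law mu D j * bstep kappa lam z y * prob Q E.
Proof.
move=> jD; apply: (prob_determinedI_le measurable_state dE) => //.
  by rewrite mulr_ge0 ?trunc_law_ge0 ?bstep_ge0.
move=> w Ew; have <- := EX Ew; have mc := measurable_cylinder measurable_state S w.
have mX : measurable [set w' | X w' u = y].
  by rewrite (_ : [set w | _] = [set w | X w u == y]); [exact: (@measurable_X u (fun x => x == y))|
    apply/seteqP; split => w' /= /eqP].
rewrite (_ : _ `&` event j y = cylinder state S w `&` [set w' | X w' u = y] `&`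
    [set w | minn (nu w u) D = j]); last first.
  by apply/seteqP; split => w' /=; rewrite /event/=; tauto.
rewrite -mulrA; apply: prob_trunc_le => //; first exact: measurableI.
  by rewrite mulr_ge0 ?bstep_ge0 ?prob_ge0.
move=> k; rewrite mulrA -(prob_cylinder_step _ _ _ cS bS uS) le_eqVlt; apply/predU1P; left.
by congr prob; apply/seteqP; split => w' /=; tauto.
Qed.

(** Allows a sum over the finite list [nbrs] although positions range over all words: the excluded
    event is a countable union of pairs (offspring number, position), each null because the step has
    probability 0. *)
Lemma prob_step_out : prob Q (E `&` [set w | X w u \notin nbrs kappa z]) = 0.
Proof.
have mo : measurable [set w | X w u \notin nbrs kappa z].
  exact: (@measurable_X u (fun y => y \notin nbrs kappa z)).
apply/eqP; rewrite eq_le prob_ge0 andbT.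
rewrite -[leRHS](mul0r (prob Q E)).
apply: (prob_determinedI_le measurable_state dE) => // w Ew; rewrite mul0r.
have mc := measurable_cylinder measurable_state S w.
have me c : measurable [set w' | nu w' u = c.1 /\ X w' u = c.2].
  by case: c => k y; exact: measurable_nuX.
rewrite le_eqVlt; apply/predU1P; left.
apply: (@prob_countable_null _ _ _ Q _ (fun c : nat * seq nat => if c.2 \in nbrs kappa z then set0 else
  cylinder state S w `&` [set w' | nu w' u = c.1 /\ X w' u = c.2])).
- exact: measurableI.
- by move=> c; case: ifP => // _; apply: measurableI.
- move=> [k y] /=; case: ifPn => [_|yz]; first exact: prob_set0.
  by rewrite (prob_cylinder_step _ _ _ cS bS uS) (EX Ew) bstep_out// mulr0 mul0r.
- by move=> w' [cw /= nX]; exists (state w' u); rewrite /= (negbTE nX).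
Qed.

(** Disintegration over the state of the fresh child [i :: b]: [a y j] bounds the conditional
    probability of [F] when the child sits at [y] with truncated offspring number [j]. *)
Lemma prob_one_step_le (F : set T) (a : seq nat -> nat -> R) : measurable F ->
  (forall y j, (j <= D)%N -> 0 <= a y j) ->
  (forall y j, (j <= D)%N ->
     prob Q (E `&` event j y `&` F) <= a y j * prob Q (E `&` event j y)) ->
  prob Q (E `&` F) <=
  step_op kappa lam (fun y => \sum_(0 <= j < D.+1) trunc_law mu D j * a y j) z * prob Q E.
Proof.
move=> mF a0 H.
have mo : measurable [set w | X w u \notin nbrs kappa z].
  exact: (@measurable_X u (fun y => y \notin nbrs kappa z)).
pose A y := E `&` F `&` [set w | X w u = y].
have mA y : measurable (A y).
  apply: measurableI; first exact: measurableI.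
  by rewrite (_ : [set w | _] = [set w | X w u == y]); [exact: (@measurable_X u (fun x => x == y))|
    apply/seteqP; split => w /= /eqP].
have -> : E `&` F = (E `&` F `&` [set w | X w u \notin nbrs kappa z]) `|`
   (E `&` F `&` [set w | X w u \in nbrs kappa z]).
  rewrite -setIUr (_ : _ `|` _ = setT) ?setIT//; apply/seteqP; split => // w _ /=.
  by case: (boolP (X w u \in nbrs kappa z)); [right|left].
have mEF := measurableI _ _ mE mF.
have mi : measurable [set w | X w u \in nbrs kappa z].
  exact: (@measurable_X u (fun y => y \in nbrs kappa z)).
apply: le_trans (prob_setU_le _ (measurableI _ _ mEF mo) (measurableI _ _ mEF mi)) _.
have -> : prob Q (E `&` F `&` [set w | X w u \notin nbrs kappa z]) = 0.
  apply/eqP; rewrite eq_le prob_ge0 andbT -prob_step_out.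
  apply: prob_mono; [exact: measurableI|exact: measurableI|].
  by move=> w [[Ew _] ?].
rewrite add0r; apply: (@le_trans _ _ (\sum_(y <- nbrs kappa z) prob Q (A y))).
  apply: prob_has_le => //; first exact: measurableI.
  by move=> w [EFw /= Xw]; exists (X w u).
rewrite /step_op mulr_suml; apply: ler_sum => y _.
rewrite -mulrA mulr_suml mulr_sumr.
apply: (@le_trans _ _ (\sum_(j <- index_iota 0 D.+1) prob Q (E `&` event j y `&` F))).
  apply: prob_has_le => //.
    by move=> j; apply: measurableI => //; exact: measurableI.
  move=> w [[Ew Fw] /= Xw]; exists (minn (nu w u) D) => //.
  by rewrite mem_index_iota /= ltnS geq_minr.
rewrite big_nat [leRHS]big_nat; apply: ler_sum => j /andP[_ jD].
rewrite (le_trans (H _ _ _))//.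
rewrite (_ : bstep _ _ _ _ * _ = a y j * (trunc_law mu D j * bstep kappa lam z y * prob Q E));
  last by ring.
by rewrite ler_wpM2l ?a0// prob_step_le.
Qed.

End one_step.

(** The counterpart at the root word, whose position is [x] almost surely, so that only its
    offspring number is averaged. *)
Lemma prob_start_le (F : set T) (a : nat -> R) : measurable F ->
  (forall j, (j <= D)%N -> 0 <= a j) ->
  (forall E j, (j <= D)%N -> determined state [:: [::]] E ->
     E `<=` [set w | minn (nu w [::]) D = j /\ X w [::] = x] ->
     prob Q (E `&` F) <= a j * prob Q E) ->
  prob Q F <= \sum_(0 <= j < D.+1) trunc_law mu D j * a j.
Proof.
move=> mF a0 H; have c0 : prefix_closed [:: [::]].
  by split=> // u; rewrite !inE => /eqP ->.
have mX : measurable [set w | X w [::] = x].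
  by rewrite (_ : [set w | _] = [set w | X w [::] == x]);
    [exact: (@measurable_X [::] (fun y => y == x))|
    apply/seteqP; split => w' /= /eqP].
have mXC := measurableC mX.
have X0 : prob Q (~` [set w | X w [::] = x]) = 0.
  apply: (@prob_countable_null _ _ _ Q _ (fun c : nat * seq nat => if c.2 == x then set0 else
    [set w | forall u, u \in [:: [::]] -> nu w u = c.1 /\ X w u = c.2])) => //.
  - move=> [k y]; case: ifP => // _ /=; rewrite (_ : [set w | _] = [set w | state w [::] = (k, y)]).
      exact: measurable_state.
    apply/seteqP; split => w /=.
      by move=> /(_ [::] (mem_head _ _))[<- <-].
    by move=> [<- <-] u; rewrite inE => /eqP ->.
  - move=> [k y] /=; case: eqP => [_|xy]; first exact: prob_set0.
    by rewrite (@prob_brw [:: [::]] (fun=> k) (fun=> y))//; move/eqP: xy => /negbTE ->;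
      rewrite !mul0r.
  - move=> w /= Xw; exists (state w [::]) => /=; move/eqP: Xw => /negbTE -> u.
    by rewrite inE => /eqP ->.
pose Ej j := [set w | X w [::] = x] `&` [set w | minn (nu w [::]) D = j].
have dEj j : determined state [:: [::]] (Ej j).
  by move=> w w' [/= e1 e2] /(_ [::] (mem_head _ _))[e3 e4]; split; rewrite /= ?e3 ?e4.
have mEj j : measurable (Ej j) by exact: (measurable_determined measurable_state (dEj j)).
have -> : F = (F `&` ~` [set w | X w [::] = x]) `|` (F `&` [set w | X w [::] = x]).
  by rewrite -setIUr setUC setUv setIT.
apply: le_trans (prob_setU_le _ (measurableI _ _ mF mXC) (measurableI _ _ mF mX)) _.
have -> : prob Q (F `&` ~` [set w | X w [::] = x]) = 0.
  apply/eqP; rewrite eq_le prob_ge0 andbT -X0.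
  by apply: prob_mono => //; exact: measurableI.
rewrite add0r; apply: (@le_trans _ _ (\sum_(j <- index_iota 0 D.+1) prob Q (Ej j `&` F))).
  apply: prob_has_le => //; first exact: measurableI.
    by move=> j; apply: measurableI.
  move=> w [Fw /= Xw]; exists (minn (nu w [::]) D) => //.
  by rewrite mem_index_iota /= ltnS geq_minr.
rewrite big_nat [leRHS]big_nat; apply: ler_sum => j /andP[_ jD].
apply: (@le_trans _ _ (a j * prob Q (Ej j))); first by apply: H => // w [].
rewrite mulrC ler_wpM2r ?a0// -[leRHS]mulr1; apply: prob_trunc_le => // k.
rewrite mulr1 (_ : _ `&` _ = [set w | forall u, u \in [:: [::]] -> nu w u = k /\ X w u = x]).
  rewrite (@prob_brw [:: [::]] (fun=> k) (fun=> x))// eqxx mul1r big_seq1.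
  by rewrite big_cons big_nil/= mulr1.
apply/seteqP; split => w /=.
  by move=> [e1 e2] u; rewrite inE => /eqP ->.
by move=> /(_ [::] (mem_head _ _))[].
Qed.

End brw_step.

(** * Visits to a target *)

Section brw_target.
Context {R : realType}.
Variables (kappa : seq nat -> nat) (lam : R) (mu : nat -> R) (D : nat) (o : seq nat).
Hypothesis lam_gt0 : 0 < lam.
Hypothesis mu_ge0 : forall k, 0 <= mu k.
Hypothesis mu_sum : (fun n => \sum_(0 <= k < n) mu k) @ \oo --> (1 : R).

Definition trunc_mean : R := \sum_(0 <= j < D.+1) trunc_law mu D j * j%:R.

Definition trunc_gf (s : R) : R := \sum_(0 <= j < D.+1) trunc_law mu D j * s ^+ j.

(* [(c P)^n 1_o], the mean number of particles at [o] in generation [n] when [c] is the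
   mean offspring number. *)
Fixpoint mean_visits (c : R) (n : nat) (z : seq nat) : R :=
  if n is n'.+1 then c * step_op kappa lam (mean_visits c n') z else (z == o)%:R.

(** The same quantity when the offspring number [j] of the starting particle is already revealed.
    Inductions over generations carry this form, and averaging over [j] gives [mean_visits] back;
    [avoid_prob_from] plays the same part for [avoid_prob]. *)
Definition mean_visits_from (c : R) (n : nat) (z : seq nat) (j : nat) : R :=
  if n is n'.+1 then j%:R * step_op kappa lam (mean_visits c n') z else (z == o)%:R.

(* Bound for the probability that no particle of the first [n] generations, in the
   genealogy cut to at most [D] children per particle, sits at [o]. *)
Fixpoint avoid_prob (n : nat) (z : seq nat) : R :=
  (z != o)%:R * (if n is n'.+1 then trunc_gf (step_op kappa lam (avoid_prob n') z) else 1).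

Definition avoid_prob_from (n : nat) (z : seq nat) (j : nat) : R :=
  (z != o)%:R * (if n is n'.+1 then step_op kappa lam (avoid_prob n') z ^+ j else 1).

Lemma trunc_mean_ge0 : 0 <= trunc_mean.
Proof. by apply: sumr_ge0 => j _; rewrite mulr_ge0 ?trunc_law_ge0. Qed.

Lemma mean_visits_ge0 c n z : 0 <= c -> 0 <= mean_visits c n z.
Proof.
by move=> c0; elim: n z => [|n IH] z /=; rewrite ?ler0n// mulr_ge0// step_op_ge0.
Qed.

Lemma mean_visits_from_ge0 c n z j : 0 <= c -> 0 <= mean_visits_from c n z j.
Proof.
move=> c0; case: n => [|n] /=; rewrite ?ler0n// mulr_ge0// step_op_ge0// => y.
exact: mean_visits_ge0.
Qed.

Lemma le_mean_visits c c' n z : 0 <= c <= c' -> mean_visits c n z <= mean_visits c' n z.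
Proof.
move=> /andP[c0 cc']; elim: n z => [//|n IH] z /=.
apply: ler_pM => //; first by apply: step_op_ge0 => // y; exact: mean_visits_ge0.
by apply: step_op_le.
Qed.

Lemma mean_visits_sum n z :
  \sum_(0 <= j < D.+1) trunc_law mu D j * mean_visits_from trunc_mean n z j
  = mean_visits trunc_mean n z.
Proof.
case: n => [|n] /=; first by rewrite -mulr_suml trunc_law_sum mul1r.
by rewrite /trunc_mean mulr_suml; apply: eq_bigr => j _; rewrite mulrA.
Qed.

Lemma trunc_gf_ge0 s : 0 <= s -> 0 <= trunc_gf s.
Proof. by move=> s0; apply: sumr_ge0 => j _; rewrite mulr_ge0 ?trunc_law_ge0 ?exprn_ge0. Qed.

Lemma avoid_prob_ge0 n z : 0 <= avoid_prob n z.
Proof.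
elim: n z => [|n IH] z /=; rewrite mulr_ge0 ?ler0n//.
by apply: trunc_gf_ge0; apply: step_op_ge0.
Qed.

Lemma avoid_prob_from_ge0 n z j : 0 <= avoid_prob_from n z j.
Proof.
case: n => [|n] /=; rewrite mulr_ge0 ?ler0n// exprn_ge0//.
by apply: step_op_ge0 => // y; exact: avoid_prob_ge0.
Qed.

Lemma avoid_prob_sum n z :
  \sum_(0 <= j < D.+1) trunc_law mu D j * avoid_prob_from n z j = avoid_prob n z.
Proof.
rewrite /avoid_prob_from; case: n => [|n] /=; first by rewrite -mulr_suml trunc_law_sum// mul1r.
by rewrite /trunc_gf mulr_sumr; apply: eq_bigr => j _; rewrite mulrCA.
Qed.

Variable x : seq nat.
Context {d : measure_display} {T : measurableType d}.
Variables (Q : probability T R) (nu : T -> seq nat -> nat) (X : T -> seq nat -> seq nat).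
Hypothesis law : brw_law kappa lam mu x Q nu X.

Fixpoint hits (n : nat) (b : seq nat) (w : T) : bool :=
  if n is n'.+1 then has (fun i => hits n' (i :: b) w) (iota 0 (minn (nu w b) D))
  else X w b == o.

Fixpoint avoids (n : nat) (b : seq nat) (w : T) : bool :=
  (X w b != o) && (if n is n'.+1
    then all (fun i => avoids n' (i :: b) w) (iota 0 (minn (nu w b) D)) else true).

(** A deterministic finite set of coordinates that decides [hits n b] and [avoids n b], whatever the
    actual offspring numbers, since at most [D] children are examined. *)
Fixpoint subtree (n : nat) (b : seq nat) : seq (seq nat) :=
  b :: (if n is n'.+1 then flatten [seq subtree n' (i :: b) | i <- iota 0 D] else [::]).

Notation st := (state nu X).

Lemma subtree_child n b i v : (i < D)%N -> v \in subtree n (i :: b) -> v \in subtree n.+1 b.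
Proof.
move=> iD vi; rewrite inE; apply/orP; right; apply/flattenP.
by exists (subtree n (i :: b)) => //; apply/mapP; exists i => //; rewrite mem_iota.
Qed.

Lemma subtree_suffix n b v : v \in subtree n b -> exists s, v = s ++ b.
Proof.
elim: n b => [|n IH] b; first by rewrite inE => /eqP ->; exists [::].
rewrite inE => /predU1P[->|]; first by exists [::].
move=> /flattenP[s /mapP[i _ ->] /IH[s' ->]].
by exists (rcons s' i); rewrite cat_rcons.
Qed.

Lemma subtree_behead n b v : v \in subtree n b -> v != b -> behead v \in subtree n b.
Proof.
elim: n b => [|n IH] b; first by rewrite inE => /eqP ->; rewrite eqxx.
rewrite inE => /predU1P[->|]; first by rewrite eqxx.
move=> /flattenP[s /mapP[i]]; rewrite mem_iota => iD -> vi _.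
have [->|vb] := eqVneq v (i :: b); first by rewrite /= mem_head.
by apply: subtree_child (IH _ vi vb).
Qed.

Lemma determined_hits n b : determined st (subtree n b) [set w | hits n b w].
Proof.
elim: n b => [|n IH] b w w' /= hw cw.
  by have [_ ->] := cw b (mem_head _ _).
have [-> _] := cw b (mem_head _ _).
move: hw => /hasP[i]; rewrite mem_iota => iD hi; apply/hasP; exists i; rewrite ?mem_iota//.
apply: (IH _ _ _ hi) => v vi; apply: cw; apply: subtree_child vi; lia.
Qed.

Lemma determined_avoids n b : determined st (subtree n b) [set w | avoids n b w].
Proof.
elim: n b => [|n IH] b w w' /= /andP[hw1 hw2] cw; have [e1 e2] := cw b (mem_head _ _).
  by rewrite e2 hw1.
rewrite e1 e2 hw1 /=; apply/allP => i; rewrite mem_iota => iD.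
move/allP: hw2 => /(_ i); rewrite mem_iota => /(_ iD) hi.
apply: (IH _ _ _ hi) => v vi; apply: cw; apply: subtree_child vi; lia.
Qed.

Let mst := measurable_state law.

Lemma measurable_hits n b : measurable [set w | hits n b w].
Proof. exact: (measurable_determined mst (@determined_hits n b)). Qed.

Lemma measurable_avoids n b : measurable [set w | avoids n b w].
Proof. exact: (measurable_determined mst (@determined_avoids n b)). Qed.

Lemma prefix_closed_cons S i b : prefix_closed S -> b \in S -> prefix_closed ((i :: b) :: S).
Proof.
move=> [S0 Sb] bS; split; first by rewrite inE S0 orbT.
by move=> u; rewrite !inE => /predU1P[->|/Sb ->]; rewrite ?bS orbT.
Qed.

Lemma fresh_child S i b : prefix_closed S -> i :: b \notin S ->
  forall k, k :: i :: b \notin (i :: b) :: S.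
Proof.
move=> [S0 Sb] iS k; rewrite inE negb_or; apply/andP; split.
  by apply/eqP => /(congr1 size) /=; lia.
by apply: contra iS => /Sb.
Qed.

Lemma determined_event S u (E : set T) j y : determined st S E ->
  determined st (u :: S) (E `&` [set w | minn (nu w u) D = j /\ X w u = y]).
Proof.
move=> dE w w' [Ew [/= e1 e2]] cw; split.
  by apply: (dE w) => // v vS; apply: cw; rewrite inE vS orbT.
by have [-> ->] := cw u (mem_head _ _).
Qed.

(** Union bound over the [j] children, then one step for each. [S] is the part already explored; the
    induction keeps the children of [b] outside it, so the past enters only through [E]. *)
Lemma prob_hits_le n S b E z j :
  prefix_closed S -> b \in S -> (forall i, i :: b \notin S) -> determined st S E ->
  E `<=` [set w | minn (nu w b) D = j /\ X w b = z] ->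
  prob Q (E `&` [set w | hits n b w]) <= mean_visits_from trunc_mean n z j * prob Q E.
Proof.
elim: n S b E z j => [|n IH] S b E z j cS bS fb dE Ejz;
    have mE := measurable_determined mst dE.
  rewrite /=; case: eqP => [_|zo].
    by rewrite mul1r; apply: prob_mono => //; apply: measurableI => //; exact: (measurable_hits 0).
  rewrite mul0r (_ : _ `&` _ = set0) ?prob_set0//.
  by rewrite -subset0 => w [/Ejz[_ e] /= /eqP]; rewrite e.
apply: (@le_trans _ _ (\sum_(i <- iota 0 j) prob Q (E `&` [set w | hits n (i :: b) w]))).
  apply: prob_has_le.
  - by apply: measurableI => //; exact: (measurable_hits n.+1).
  - by move=> i; apply: measurableI => //; exact: measurable_hits.
  - move=> w [Ew /= /hasP[i]]; have [-> _] := Ejz _ Ew; move=> ij hi.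
    by exists i.
rewrite /= -mulrA -[X in X%:R](size_iota 0 j) -sum1_size natr_sum mulr_suml.
apply: ler_sum => i _; rewrite mul1r.
under eq_step_op do rewrite -mean_visits_sum.
apply: (prob_one_step_le lam_gt0 mu_ge0 mu_sum law cS bS (fb i) dE) => //.
- by move=> w /Ejz[].
- exact: measurable_hits.
- by move=> y k _; apply: mean_visits_from_ge0; exact: trunc_mean_ge0.
- move=> y k kD; apply: (IH ((i :: b) :: S)).
  + exact: prefix_closed_cons.
  + exact: mem_head.
  + exact: fresh_child.
  + exact: determined_event.
  + by move=> w [].
Qed.

Lemma prob_hits_root_le n :
  prob Q [set w | hits n [::] w] <= mean_visits trunc_mean n x.
Proof.
rewrite -mean_visits_sum; apply: (prob_start_le lam_gt0 mu_ge0 mu_sum law).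
- exact: measurable_hits.
- by move=> j _; apply: mean_visits_from_ge0; exact: trunc_mean_ge0.
- move=> E j jD dE Ejx; apply: (prob_hits_le _ _ _ _ dE) => //.
  by split => // u; rewrite !inE => /eqP ->.
Qed.

(** A product over children is wanted here, so their subtrees are explored one after the other:
    [part i] says that the first [i] of them avoid the target, and [S' i] is what has then been
    revealed. *)
Lemma prob_avoids_le n S b E z j :
  prefix_closed S -> b \in S -> (forall i, i :: b \notin S) -> determined st S E ->
  E `<=` [set w | minn (nu w b) D = j /\ X w b = z] ->
  prob Q (E `&` [set w | avoids n b w]) <= avoid_prob_from n z j * prob Q E.
Proof.
elim: n S b E z j => [|n IH] S b E z j cS bS fb dE Ejz;
    have mE := measurable_determined mst dE;
    rewrite /avoid_prob_from; have [zo|zo] := eqVneq z o.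
- rewrite /= !mul0r (_ : _ `&` _ = set0) ?prob_set0//.
  by rewrite -subset0 => w [/Ejz[_ e] /=]; rewrite e zo eqxx.
- rewrite /= !mul1r; apply: prob_mono => //; apply: measurableI => //; exact: (measurable_avoids 0).
- rewrite /= !mul0r (_ : _ `&` _ = set0) ?prob_set0//.
  by rewrite -subset0 => w [/Ejz[_ e] /=]; rewrite e zo eqxx.
rewrite mul1r.
pose part i := [set w | all (fun k => avoids n (k :: b) w) (iota 0 i)].
pose S' i := S ++ flatten [seq subtree n (k :: b) | k <- iota 0 i].
have dp i : determined st (S' i) (E `&` part i).
  apply: determinedI.
    by apply: sub_determined dE => u uS; rewrite mem_cat uS.
  move=> w w' /allP hw cw; apply/allP => k ki.
  apply: (determined_avoids (hw _ ki)) => v vk; apply: cw.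
  rewrite mem_cat; apply/orP; right; apply/flattenP; exists (subtree n (k :: b)) => //.
  by apply/mapP; exists k.
have cS' i : prefix_closed (S' i).
  split; first by rewrite mem_cat cS.1.
  move=> u; rewrite !mem_cat => /orP[/(cS.2) ->//|/flattenP[s /mapP[k ki ->] uk]].
  have [->|ub] := eqVneq u (k :: b); first by rewrite bS.
  apply/orP; right; apply/flattenP; exists (subtree n (k :: b)); first by apply/mapP; exists k.
  exact: subtree_behead.
have bS' i : b \in S' i by rewrite mem_cat bS.
have fS' i : i :: b \notin S' i.
  rewrite mem_cat negb_or fb /=; apply/flattenP => -[s /mapP[k ki ->] /subtree_suffix[v e]].
  have : size v = 0%N by move/(congr1 size): e; rewrite size_cat /=; lia.
  move=> /size0nil v0; move: e; rewrite v0 /= => -[e]; move: ki; rewrite mem_iota e; lia.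
(* The next child is fresh for [S' i], so each child contributes one more factor
   [step_op (avoid_prob n) z]. *)
suff H i : prob Q (E `&` part i) <= step_op kappa lam (avoid_prob n) z ^+ i * prob Q E.
  rewrite (_ : _ `&` _ = E `&` part j) ?H//.
  apply/seteqP; split => w [Ew]; have [e1 e2] := Ejz _ Ew; rewrite /part /= e1 e2 zo /= => h;
    split => //.
have mp k : measurable (E `&` part k) by exact: (measurable_determined mst (dp k)).
elim: i => [|i IHi].
  by rewrite expr0 mul1r; apply: prob_mono => // w [].
have -> : E `&` part i.+1 = E `&` part i `&` [set w | avoids n (i :: b) w].
  rewrite -setIA; congr (_ `&` _); rewrite /part -addn1 iotaD add0n.
  apply/seteqP; split => w /=; rewrite all_cat /= andbT; first by move=> /andP[].
  by move=> [-> ->].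
rewrite exprS -mulrA.
apply: (@le_trans _ _ (step_op kappa lam (avoid_prob n) z * prob Q (E `&` part i))); last first.
  by apply: ler_wpM2l => //; apply: step_op_ge0 => // y; exact: avoid_prob_ge0.
under eq_step_op do rewrite -avoid_prob_sum.
apply: (prob_one_step_le lam_gt0 mu_ge0 mu_sum law (cS' i) (bS' i) (fS' i) (dp i)) => //.
- by move=> w [/Ejz[]].
- exact: measurable_avoids.
- by move=> y k _; exact: avoid_prob_from_ge0.
- move=> y k kD; apply: (IH ((i :: b) :: S' i)).
  + exact: prefix_closed_cons.
  + exact: mem_head.
  + exact: fresh_child.
  + exact: determined_event.
  + by move=> w [].
Qed.

Lemma hits_in_tree n b w : in_tree (nu w) b -> ~~ avoids n b w ->
  exists u, in_tree (nu w) u /\ (size b <= size u)%N /\ X w u = o.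
Proof.
elim: n b => [|n IH] b tb /=; rewrite negb_and negbK.
  by rewrite orbF => /eqP Xo; exists b.
move=> /orP[/eqP Xo|/allPn[i]]; first by exists b.
rewrite mem_iota => ij /IH[].
  by rewrite /= tb /=; lia.
by move=> u [tu [/= su Xu]]; exists u; split => //; split=> //; lia.
Qed.

Lemma measurable_in_tree u : measurable [set w | in_tree (nu w) u].
Proof.
elim: u => [|i u IH] /=.
  by rewrite (_ : [set w | _] = setT)//; apply/seteqP.
rewrite (_ : [set w | _] = [set w | in_tree (nu w) u] `&` [set w | (i < nu w u)%N]).
  by apply: measurableI => //; exact: (measurable_nu law u (fun k => (i < k)%N)).
by apply/seteqP; split => w /= /andP.
Qed.

Lemma measurable_visits_io : measurable (visits_io nu X o).
Proof.
pose F n (ou : option (seq nat)) := if ou is Some u then if (n <= size u)%N then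
    [set w | in_tree (nu w) u] `&` [set w | X w u == o] else set0 else set0.
have mF n ou : measurable (F n ou).
  rewrite /F; case: ou => [u|//]; case: (n <= size u)%N => //.
  apply: measurableI; first exact: measurable_in_tree.
  exact: (measurable_X law u (fun y => y == o)).
have -> : visits_io nu X o = \bigcap_n \bigcup_k F n (unpickle k); last first.
  by apply: bigcap_measurable => [|n _]; [exists 0%N|apply: bigcup_measurable => k _; exact: mF].
apply/seteqP; split => w.
  move=> h n _; have [u [tu [nu' Xu]]] := h n; exists (pickle u) => //.
  by rewrite pickleK /F nu'; split => //=; apply/eqP.
move=> h n; have [k _] := h n I; move: (unpickle k) => -[u|//]; rewrite /F;
  case: ifP => // nu' [tu /eqP Xu].
by exists u.
Qed.

(** Follow the first-child line, which never dies because [mu 0 = 0]. Given the states along the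
    line up to generation [N], the cut tree below its last particle avoids [o] forever with
    probability 0. Hence almost surely, for every [N], some particle of generation at least [N] is
    at [o]. *)
Lemma visits_io_as1 : (0 < D)%N -> mu 0%N = 0 ->
  (forall z (e : R), 0 < e -> exists n, step_op kappa lam (avoid_prob n) z <= e) ->
  Q (visits_io nu X o) = 1%E.
Proof.
move=> D0 mu0 Hr.
pose line N := nseq N 0%N.
pose V N := \bigcap_n [set w | avoids n (line N) w].
have mV N : measurable (V N).
  by apply: bigcap_measurable => // n _; exact: measurable_avoids.
have PV N : prob Q (V N) = 0.
  pose S := [seq line k | k <- iota 0 N.+1].
  have memS k : (k <= N)%N -> line k \in S.
    by move=> kN; apply/mapP; exists k => //; rewrite mem_iota; lia.
  have cS : prefix_closed S.
    split; first exact: (memS 0%N).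
    move=> u /mapP[[|k]]; rewrite mem_iota => kN ->; first exact: (memS 0%N).
    by apply: memS; lia.
  have fS i : i :: line N \notin S.
    apply/mapP => -[k]; rewrite mem_iota => kN /(congr1 size); rewrite /= !size_nseq; lia.
  apply/eqP; rewrite eq_le prob_ge0 andbT -(setTI (V N)) -[leRHS](mul0r (prob Q setT)).
  apply: (prob_determinedI_le mst (@determinedT _ _ _ _ st S)) => // w _.
  rewrite mul0r.
  have mc := measurable_cylinder mst S w.
  have [n0|n0] := posnP (nu w (line N)).
    apply: (@le_trans _ _ (prob Q (cylinder st S w))).
      by apply: prob_mono => //; exact: measurableI.
    rewrite (prob_cylinder law)// (bigD1_seq (line N)) ?undup_uniq ?mem_undup ?memS//=.
    by rewrite n0 mu0 mul0r mulr0 mul0r.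
  apply/ler_addgt0Pr => e e0; rewrite add0r.
  (* The bound by 1 ensures [q ^ j <= q], where [j >= 1] is the truncated offspring number. *)
  have e1 : 0 < Num.min e 1 by rewrite lt_min e0 ltr01.
  have [n Hn] := Hr (X w (line N)) _ e1; set q := step_op _ _ _ _ in Hn.
  have q0 : 0 <= q by apply: step_op_ge0 => // y; exact: avoid_prob_ge0.
  apply: (@le_trans _ _ (prob Q (cylinder st S w `&` [set w | avoids n.+1 (line N) w]))).
    apply: prob_mono; [exact: measurableI| |].
      by apply: measurableI => //; exact: measurable_avoids.
    by move=> w' [cw Vw]; split=> //; exact: Vw.
  apply: le_trans (@prob_avoids_le n.+1 S (line N) _ (X w (line N))
      (minn (nu w (line N)) D) cS (memS N (leqnn N)) fS _ _) _.
  - exact: determined_cylinder.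
  - by move=> w' /(_ _ (memS N (leqnn N)))[e2 e3] /=; rewrite e2 e3.
  rewrite -[leRHS]mulr1; apply: ler_pM.
  - exact: avoid_prob_from_ge0.
  - exact: prob_ge0.
  - rewrite /avoid_prob_from -/q; apply: (@le_trans _ _ q);
    last by rewrite (le_trans Hn)// ge_min lexx.
    apply: (@le_trans _ _ (q ^+ minn (nu w (line N)) D)).
      by rewrite -[leRHS]mul1r ler_wpM2r ?exprn_ge0//; case: eqP.
    rewrite -[leRHS]expr1; apply: ler_wiXn2l => //.
      by rewrite (le_trans Hn)// ge_min lexx orbT.
    lia.
  - exact: prob_le1.
(* Off these null events every word [line N] belongs to the genealogy, so that a visit below it
   counts for [visits_io]. The coordinates [S] are the ancestors of [u]. *)
have nu0 u : prob Q [set w | nu w u = 0%N] = 0.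
  pose S := [seq drop k u | k <- iota 0 (size u).+1].
  have uS : u \in S by apply/mapP; exists 0%N; rewrite ?mem_iota// drop0.
  have cS : prefix_closed S.
    split; first by apply/mapP; exists (size u); rewrite ?mem_iota ?drop_size//; lia.
    move=> v /mapP[k]; rewrite mem_iota => ku ->; rewrite -drop1 drop_drop.
    apply/mapP; have [kk|kk] := ltnP k (size u).
      by exists (1 + k)%N => //; rewrite mem_iota; lia.
    exists (size u); first by rewrite mem_iota; lia.
    by rewrite drop_size; apply: drop_oversize; rewrite add1n leqW.
  have m0 : measurable [set w | nu w u = 0%N] by exact: law.1.
  apply/eqP; rewrite eq_le prob_ge0 andbT -(setTI [set w | _]) -[leRHS](mul0r (prob Q setT)).
  apply: (prob_determinedI_le mst (@determinedT _ _ _ _ st S)) => // w _.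
  have mc := measurable_cylinder mst S w.
  rewrite mul0r; have [n0|n0] := eqVneq (nu w u) 0%N.
    apply: (@le_trans _ _ (prob Q (cylinder st S w))).
      by apply: prob_mono => //; exact: measurableI.
    rewrite (prob_cylinder law)// (bigD1_seq u) ?undup_uniq ?mem_undup//=.
    by rewrite n0 mu0 mul0r mulr0 mul0r.
  rewrite (_ : _ `&` _ = set0) ?prob_set0// -subset0 => w' [/(_ _ uS) [e _] /= e0].
  by rewrite -e e0 in n0.
have mvis := measurable_visits_io.
have P0 : prob Q (~` visits_io nu X o) = 0.
  apply: (@prob_countable_null _ _ _ Q (nat + seq nat)%type
    (fun c => match c with inl N => V N | inr u => [set w | nu w u = 0%N] end)).
  - exact: measurableC.
  - by case=> [N|u]; [exact: mV|exact: law.1].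
  - by case=> [N|u].
  - move=> w nv; apply: contrapT => H.
    apply: nv => N; have tl : in_tree (nu w) (line N).
      elim: N => //= N IH; rewrite IH lt0n; apply/eqP => n0; apply: H.
      by exists (inr (line N)).
    have : ~ V N w by move=> Vw; apply: H; exists (inl N).
    move=> /existsNP[n /not_implyP[_ /negP]] /(hits_in_tree tl)[u [tu [su Xu]]].
    by exists u; split => //; split => //; move: su; rewrite size_nseq.
rewrite (probE Q mvis); congr EFin.
have := prob_setIDC Q measurableT mvis; rewrite !setTI P0 prob_setT; lra.
Qed.

End brw_target.

(** * Transience *)

Section hits_monotone.
Context {d : measure_display} {T : measurableType d}.
Variables (o : seq nat) (nu : T -> seq nat -> nat) (X : T -> seq nat -> seq nat).

Lemma leq_hits D D' n b w : (D <= D')%N -> hits D o nu X n b w -> hits D' o nu X n b w.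
Proof.
move=> DD'; elim: n b => [//|n IH] b /= /hasP[i]; rewrite mem_iota => iD /IH hi.
by apply/hasP; exists i => //; rewrite mem_iota; lia.
Qed.

Lemma in_tree_catr (k : seq nat -> nat) v b : in_tree k (v ++ b) -> in_tree k b.
Proof. by elim: v => //= i v IH /andP[/IH]. Qed.

Lemma hits_cat D v b w : in_tree (nu w) (v ++ b) -> all (fun i => i < D)%N v ->
  X w (v ++ b) = o -> hits D o nu X (size v) b w.
Proof.
elim/last_ind: v b => [|v i IH] b; first by move=> _ _ /= ->.
rewrite cat_rcons all_rcons size_rcons => tv /andP[iD vD] Xo /=.
apply/hasP; exists i; last exact: IH.
rewrite mem_iota; move: (in_tree_catr tv) => /= /andP[_]; lia.
Qed.

Lemma hits_root w u : in_tree (nu w) u -> X w u = o ->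
  exists D, hits D o nu X (size u) [::] w.
Proof.
move=> tu Xu; exists (\max_(i <- u) i).+1; apply: hits_cat; rewrite ?cats0//.
by apply/allP => i iu; rewrite ltnS; apply: leq_bigmax_seq.
Qed.

End hits_monotone.

(** Borel--Cantelli for the events [F n] that generation [n] has a particle at [o]. The uncut
    genealogy is the increasing union over [D] of the cut ones, whose truncated means all stay below
    [m]. *)
Lemma visits_io_as0 {R : realType} (kappa : seq nat -> nat) (lam : R) (mu : nat -> R)
    (m C : R) (o x : seq nat) {d : measure_display} {T : measurableType d}
    (Q : probability T R) (nu : T -> seq nat -> nat) (X : T -> seq nat -> seq nat) :
  0 < lam -> (forall k, 0 <= mu k) ->
  (fun n => \sum_(0 <= k < n) mu k) @ \oo --> (1 : R) ->
  brw_law kappa lam mu x Q nu X ->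
  (forall D, trunc_mean mu D <= m) ->
  (forall N, \sum_(0 <= n < N) mean_visits kappa lam o m n x <= C) ->
  Q (visits_io nu X o) = 0%E.
Proof.
move=> lam0 mu0 mu1 law mD HC.
pose F n := \bigcup_D [set w | hits D o nu X n [::] w].
have mF n : measurable (F n).
  by apply: bigcup_measurable => D _; exact: (measurable_hits D o lam0 law).
have m0 : 0 <= m by apply: le_trans (mD 0%N); exact: trunc_mean_ge0.
have PF n : prob Q (F n) <= mean_visits kappa lam o m n x.
  apply: prob_bigcup_ndecr_le.
  - by move=> D; exact: (measurable_hits D o lam0 law).
  - by move=> D D' DD' w /=; exact: leq_hits.
  - move=> D; apply: le_trans (prob_hits_root_le D o lam0 mu0 mu1 law n) _.
    by apply: le_mean_visits => //; rewrite mD trunc_mean_ge0.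
have Fs : (\sum_(0 <= n <oo) Q (F n) < +oo)%E.
  apply: (@le_lt_trans _ _ C%:E); last exact: ltry.
  apply: lime_le.
    by apply: is_cvg_nneseries => n _ _; exact: measure_ge0.
  near=> N; rewrite (eq_bigr (fun n => (prob Q (F n))%:E)); last first.
    by move=> n _; rewrite probE.
  rewrite sumEFin lee_fin (le_trans _ (HC N))//; exact: ler_sum.
have L0 := lim_sup_set_cvg0 mF Fs.
have mL : measurable (lim_sup_set F).
  by apply: bigcap_measurable => [|n _]; [exists 0%N|apply: bigcup_measurable].
apply/eqP; rewrite -measure_le0 -L0; apply: le_measure; rewrite ?inE//.
  exact: (measurable_visits_io o law).
move=> w vw n _; have [u [tu [nu' Xu]]] := vw n.
exists (size u) => //; have [D hD] := hits_root tu Xu.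
by exists D.
Unshelve. all: by end_near. Qed.

(** * Finiteness of the Green function of [m P] *)

Section green_function.
Context {R : realType}.
Variables (kappa : seq nat -> nat) (lam m : R).
Hypothesis lam_gt0 : 0 < lam.
Hypothesis m_gt0 : 0 < m.
Let P := step_op kappa lam.

Lemma step_op_sum (J : Type) (s : seq J) (g : J -> seq nat -> R) z :
  P (fun y => \sum_(j <- s) g j y) z = \sum_(j <- s) P (g j) z.
Proof.
rewrite /P /step_op; under eq_bigr do rewrite mulr_sumr.
exact: exchange_big.
Qed.

Lemma green_recl o N z :
  \sum_(0 <= n < N.+1) mean_visits kappa lam o m n z =
  (z == o)%:R + m * P (fun y => \sum_(0 <= n < N) mean_visits kappa lam o m n y) z.
Proof. by rewrite big_nat_recl//= step_op_sum mulr_sumr. Qed.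

(** For the root as target, [K * f] dominates the Green recursion because the defect of [f] at the
    root, times [K], is at least 1. The other targets follow by induction along the path from the
    root, comparing visits to [a :: o] with visits to [o] one generation later. *)
Lemma green_bound (f : seq nat -> R) (K : R) : (forall z, 0 <= f z) -> 0 <= K ->
  (forall z, m * P f z <= f z) -> 1 <= K * (f [::] - m * P f [::]) ->
  forall o, exists2 C : R, 0 <= C &
    forall N z, \sum_(0 <= n < N) mean_visits kappa lam o m n z <= C * f z.
Proof.
move=> f0 K0 mPf mPf0; elim=> [|a o [C C0 IH]].
  exists K => // N; elim: N => [|N IH] z; first by rewrite big_nil mulr_ge0.
  rewrite green_recl; apply: (@le_trans _ _ ((z == [::])%:R + m * (K * P f z))).
    rewrite lerD2l ler_pM2l// -step_opZ; apply: step_op_le => // y _; exact: IH.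
  have [->|_] := eqVneq z [::]; first by rewrite mulrCA -[true%:R]/(1 : R); move: mPf0;
    rewrite mulrBr; lra.
  by rewrite add0r mulrCA ler_wpM2l.
(* The inverse of [m] times the probability of the step from [a :: o] to [o]. *)
pose C' := (lam + (kappa (a :: o))%:R) / (lam * m).
have C'0 : 0 <= C' by rewrite divr_ge0 ?mulr_ge0// ?ltW ?denom_gt0.
have mv0 o' n z : 0 <= mean_visits kappa lam o' m n z by apply: mean_visits_ge0 => //; exact: ltW.
have H n z : mean_visits kappa lam (a :: o) m n z <= C' * mean_visits kappa lam o m n.+1 z.
  elim: n z => [|n IHn] z.
    have [->|] := eqVneq z (a :: o); last first.
      by move=> /negbTE e; rewrite [leLHS]/= e; apply: mulr_ge0 => //; exact: mv0.
    rewrite /= eqxx.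
    have := step_op_ge1 lam_gt0 (g := fun y => (y == o)%:R) (z := a :: o) (y := o).
    move=> /(_ kappa) H0; have {H0} := H0 (fun y => ler0n _ _).
    rewrite mem_cat mem_head => /(_ isT); rewrite bstep_parent eqxx mulr1 => H1.
    apply: (@le_trans _ _ (C' * (m * (lam / (lam + (kappa (a :: o))%:R))))); last first.
      by rewrite ler_wpM2l// ler_pM2l.
    rewrite /C' (_ : _ * _ = 1)//; field.
    by rewrite !gt_eqF ?denom_gt0.
  rewrite [leRHS]/= mulrCA ler_pM2l// -step_opZ; apply: step_op_le => // y _; exact: IHn.
exists (C' * C); first exact: mulr_ge0.
move=> N z; rewrite -mulrA;
  apply: (@le_trans _ _ (C' * \sum_(0 <= n < N) mean_visits kappa lam o m n.+1 z)).
  by rewrite mulr_sumr; apply: ler_sum.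
rewrite ler_wpM2l// (le_trans _ (IH N.+1 z))// big_nat_recl// lerDr.
exact: mv0.
Qed.

(** With ratio [s / D = sqrt (lam / D)], degree [D] is the worst case: the ratio is below 1, so
    additional children only lower [P f / f]. At the root [m * P f] is at most
    [(D + lam) / (2 * D)], and [lam < D] makes this strictly less than 1. *)
Lemma geometric_green_bound (dm : nat) :
  (forall z, (dm <= kappa z)%N) -> lam < dm%:R ->
  m <= (dm%:R + lam) / (2 * Num.sqrt (lam * dm%:R)) ->
  forall o z, exists C : R, forall N, \sum_(0 <= n < N) mean_visits kappa lam o m n z <= C.
Proof.
move=> kd lamd; set s := Num.sqrt _; set D : R := dm%:R in lamd *.
have D0 : 0 < D by exact: lt_trans lamd.
have s0 : 0 < s by rewrite sqrtr_gt0 mulr_gt0.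
have s2 : s * s = lam * D by rewrite -expr2 sqr_sqrtr// mulr_ge0// ltW.
rewrite ler_pdivlMr ?mulr_gt0// => hm.
pose f (z : seq nat) := (s / D) ^+ size z.
have r0 : 0 < s / D by rewrite divr_gt0.
have f0 z : 0 <= f z by rewrite exprn_ge0// ltW.
have kD z : D <= (kappa z)%:R by rewrite ler_nat.
have Pf0 : P f [::] = s / D.
  rewrite /P step_op_nil.
  rewrite (eq_bigr (fun=> s / D)); last by move=> i _; rewrite /f /= expr1.
  rewrite big_const_seq count_predT size_iota iter_addr_0 -[s / D *+ _]mulr_natr mulfK//.
  by rewrite gt_eqF// (lt_le_trans D0).
have c1 : (D + lam) / (2 * D) < 1 by rewrite ltr_pdivrMr ?mulr_gt0//; lra.
have mPf0 : m * P f [::] <= (D + lam) / (2 * D).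
  rewrite Pf0 mulrA ler_pdivlMr ?mulr_gt0//.
  rewrite (_ : m * s / D * (2 * D) = m * (2 * s)) ?hm//; field.
  by rewrite gt_eqF.
have mPf z : m * P f z <= f z.
  case: z => [|a z]; first by rewrite (le_trans mPf0)// /f /= expr0 ltW.
  rewrite /P step_op_cons//; set k := (X in lam + X); have kk : D <= k := kD _.
  rewrite (eq_bigr (fun=> f z * (s / D) ^+ 2)); last first.
    by move=> i _; rewrite /f /= exprS exprS mulrA -expr2 mulrC.
  rewrite big_const_seq count_predT size_iota iter_addr_0 -[_ *+ _]mulr_natr -/k.
  have lk : 0 < lam + k by rewrite addr_gt0// (lt_le_trans D0).
  rewrite mulrA ler_pdivrMr//.
  have -> : f (a :: z) = f z * (s / D) by rewrite /f /= exprSr.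
  rewrite (_ : m * _ = f z * (m * (lam + k * (s / D) ^+ 2))); last by ring.
  rewrite -mulrA ler_wpM2l//.
  have -> : (s / D) ^+ 2 = lam / D.
    by rewrite expr2 mulf_div s2 -mulrA; congr (_ * _); rewrite invfM mulrA divff ?mul1r// gt_eqF.
  rewrite -(ler_pM2r s0) -(ler_pM2r D0).
  rewrite (_ : s / D * (lam + k) * s * D = (s * s) * (lam + k)); last by field; rewrite gt_eqF.
  rewrite s2 (_ : m * (lam + k * (lam / D)) * s * D = (m * (2 * s)) * (lam * (D + k) / 2));
    last first.
    by field; rewrite gt_eqF.
  apply: (@le_trans _ _ ((D + lam) * (lam * (D + k) / 2))).
    by rewrite ler_wpM2r// divr_ge0// mulr_ge0 ?addr_ge0 ?ltW// (lt_le_trans D0).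
  (* This factorization is where both [k >= D] and [lam < D] enter. *)
  rewrite -subr_ge0 (_ : _ - _ = lam * ((k - D) * (D - lam)) / 2); last by field.
  by rewrite divr_ge0// !mulr_ge0 ?subr_ge0// ltW.
have [K K0 HK] : exists2 K : R, 0 <= K & 1 <= K * (f [::] - m * P f [::]).
  have c2 : 0 < 1 - (D + lam) / (2 * D) by rewrite subr_gt0.
  exists (1 - (D + lam) / (2 * D))^-1; first by rewrite invr_ge0 ltW.
  rewrite -(ler_pM2l c2) mulr1 mulrA mulfV ?gt_eqF// mul1r /f /= expr0; lra.
move=> o z; have [C C0 HC] := green_bound f0 K0 mPf HK o.
by exists (C * f z) => N; exact: HC.
Qed.

End green_function.

(** * Subsolutions of the avoidance equation *)

Section generating_function.
Context {R : realType}.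
Variables (mu : nat -> R) (D : nat).
Hypothesis mu_ge0 : forall k, 0 <= mu k.
Hypothesis mu_sum : (fun n => \sum_(0 <= k < n) mu k) @ \oo --> (1 : R).
Let G := trunc_gf mu D.

Lemma le_trunc_gf (s t : R) : 0 <= s <= t -> G s <= G t.
Proof.
move=> /andP[s0 st]; apply: ler_sum => j _; rewrite ler_wpM2l ?trunc_law_ge0//.
by apply: lerXn2r; rewrite ?nnegrE// (le_trans s0).
Qed.

(** The values [j >= 2] have total mass [1 - mu 1] and contribute at most [s ^ 2] each. The point is
    the factor [mu 1 + (1 - mu 1) * s], which stays below 1 when [s] stays away from 1. *)
Lemma trunc_gf_le (s : R) : (1 < D)%N -> mu 0%N = 0 -> 0 <= s <= 1 ->
  G s <= s * (mu 1%N + (1 - mu 1%N) * s).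
Proof.
move=> D1 mu0 /andP[s0 s1]; rewrite /G /trunc_gf; case: (D) D1 => [|[|n]]// _.
have := trunc_law_sum mu n.+2;
  rewrite big_nat_recl// big_nat_recl// {1 2}/trunc_law /= mu0 add0r => e1.
rewrite big_nat_recl// big_nat_recl// {1 2}/trunc_law /= mu0 mul0r add0r expr1.
rewrite mulrDr mulrC lerD2l mulrCA -expr2.
have <- : \sum_(0 <= i < n.+1) trunc_law mu n.+2 i.+2 = 1 - mu 1%N by apply/eqP;
  rewrite eq_sym subr_eq addrC e1.
rewrite mulr_suml; apply: ler_sum => j _; rewrite ler_wpM2l ?trunc_law_ge0//.
exact: ler_wiXn2l.
Qed.

Lemma trunc_gf_le_id (s : R) : (1 < D)%N -> mu 0%N = 0 -> mu 1%N <= 1 -> 0 <= s <= 1 -> G s <= s.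
Proof.
move=> D1 mu0 mu1 s01; apply: le_trans (trunc_gf_le D1 mu0 s01) _.
case/andP: s01 => s0 s1; rewrite -[leRHS]mulr1 ler_wpM2l//.
have : (1 - mu 1%N) * s <= 1 - mu 1%N by rewrite ler_piMr// subr_ge0.
lra.
Qed.

(** A Bonferroni-type bound for the probability that one of [j] independent events of probability
    [t] occurs; its induction uses Bernoulli's inequality [B]. *)
Lemma onem_exp_lower (t : R) j : 0 <= t <= 1 ->
  j%:R * t - j%:R ^+ 2 * t ^+ 2 <= 1 - (1 - t) ^+ j.
Proof.
move=> /andP[t0 t1]; have B n : 1 - (1 - t) ^+ n <= n%:R * t.
  elim: n => [|n IH]; first by rewrite expr0 subrr mul0r.
  rewrite exprS -natr1; set q := (1 - t) ^+ n in IH *.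
  have q1 : t * q <= t by rewrite ler_piMr// exprn_ile1//; lra.
  have -> : 1 - (1 - t) * q = (1 - q) + t * q by ring.
  rewrite mulrDl; lra.
elim: j => [|j IH]; first by rewrite expr0 subrr !mul0r expr0n /= mul0r subrr.
have := B j; rewrite [(1 - t) ^+ _.+1]exprS; set q := (1 - t) ^+ j in IH *.
rewrite -natr1; set n : R := j%:R in IH * => Bj; have n0 : 0 <= n by rewrite ler0n.
have h1 : t * (1 - q) <= t * (n * t) by rewrite ler_wpM2l.
have h2 : 0 <= n * t ^+ 2 by rewrite mulr_ge0 ?sqr_ge0.
have h3 : 0 <= t ^+ 2 by rewrite sqr_ge0.
have -> : 1 - (1 - t) * q = (1 - q) + t - t * (1 - q) by ring.
have -> : (n + 1) * t - (n + 1) ^+ 2 * t ^+ 2 =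
  (n * t - n ^+ 2 * t ^+ 2) + t - t * (n * t) - n * t ^+ 2 - t ^+ 2 by ring.
lra.
Qed.

(** Survival grows near 0 with slope [trunc_mean], with a quadratic error whose constant is finite
    because of the cut at [D]. *)
Lemma trunc_gf_lower (t : R) : 0 <= t <= 1 ->
  trunc_mean mu D * t - D%:R ^+ 2 * t ^+ 2 <= 1 - G (1 - t).
Proof.
move=> t01; rewrite /trunc_mean /G /trunc_gf -[X in _ <= X - _](trunc_law_sum mu D).
apply: (@le_trans _ _ (\sum_(0 <= j < D.+1) trunc_law mu D j * (j%:R * t - j%:R ^+ 2 * t ^+ 2))).
  under [leRHS]eq_bigr do rewrite mulrBr.
  rewrite sumrB mulr_suml; under [X in _ <= X - _]eq_bigr do rewrite mulrA.
  rewrite lerD2l lerN2.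
  apply: (@le_trans _ _ (\sum_(0 <= j < D.+1) trunc_law mu D j * (D%:R ^+ 2 * t ^+ 2))); last first.
    by rewrite -mulr_suml trunc_law_sum mul1r.
  rewrite big_nat [leRHS]big_nat; apply: ler_sum => j /andP[_ jD].
  rewrite ler_wpM2l ?trunc_law_ge0// ler_wpM2r ?sqr_ge0//.
  by rewrite lerXn2r ?nnegrE ?ler0n// ler_nat.
rewrite -sumrB; apply: ler_sum => j _.
by rewrite -{2}[trunc_law _ _ _]mulr1 -mulrBr ler_wpM2l ?trunc_law_ge0// onem_exp_lower.
Qed.

End generating_function.

Lemma expr_small {R : realType} (t e : R) : 0 <= t < 1 -> 0 < e -> exists n, t ^+ n <= e.
Proof.
move=> /andP[t0 t1] e0; have : (t ^+ n) @[n --> \oo] --> (0 : R).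
  by apply: cvg_expr; rewrite ger0_norm.
move=> /cvgrPdist_le /(_ e e0)[n _ /(_ n (leqnn n))] /=.
by rewrite sub0r normrN ger0_norm ?exprn_ge0// => ?; exists n.
Qed.

(** * Copies of a finite tree, and bad steps away from them *)

Section patterns.
Variables (deg : nat -> nat) (H L M : nat).

(* Words of the spherically symmetric tree whose vertices at depth [k] have [deg k] children. *)
Fixpoint pat_level (k : nat) : seq (seq nat) :=
  if k is k'.+1 then [seq i :: y | y <- pat_level k', i <- iota 0 (deg k')] else [:: [::]].

Definition pat_words : seq (seq nat) := flatten [seq pat_level k | k <- iota 0 H.+1].

Lemma size_pat_level k y : y \in pat_level k -> size y = k.
Proof.
elim: k y => [|k IH] y; first by rewrite inE => /eqP ->.
by move=> /allpairsP[[y' i] /= [/IH <- _ ->]].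
Qed.

Lemma mem_pat_words y : (y \in pat_words) = (size y <= H)%N && (y \in pat_level (size y)).
Proof.
apply/flattenP/andP => [[l /mapP[k]]|[yH yl]].
  by rewrite mem_iota => kH -> yk; rewrite (size_pat_level yk) yk; split => //; lia.
by exists (pat_level (size y)) => //; apply/mapP; exists (size y) => //; rewrite mem_iota; lia.
Qed.

Lemma pat_words_cons i y : (i :: y \in pat_words) =
  [&& (size y < H)%N, y \in pat_words & (i < deg (size y))%N].
Proof.
rewrite !mem_pat_words /=; case: (ltnP (size y) H) => yH //=; rewrite (ltnW yH) /=.
apply/allpairsP/andP => [[[y' j] /= [yl]]|[yl iy]].
  by rewrite mem_iota => /andP[_ jd] [ij yy']; subst y' j.
by exists (y, i); rewrite mem_iota.
Qed.

Lemma pat_words_uniq : uniq pat_words.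
Proof.
have lu k : uniq (pat_level k).
  elim: k => // k IH; apply: allpairs_uniq; rewrite ?iota_uniq//.
  by move=> [y i] [y' i'] _ _ /= [-> ->].
rewrite /pat_words; elim: (iota 0 H.+1) (iota_uniq 0 H.+1) => //= k s IH /andP[ks us].
rewrite cat_uniq lu IH// andbT /=; apply/hasPn => y /flattenP[l /mapP[k' k's ->] yk'].
by apply: contra ks => yk; rewrite -(size_pat_level yk) (size_pat_level yk').
Qed.

Definition good_top (kappa : seq nat -> nat) (z : seq nat) : bool :=
  all (fun y => kappa (y ++ z) == deg (size y)) pat_words.

Definition aided (kappa : seq nat -> nat) (b : seq nat) : bool :=
  has (fun l => good_top kappa (nseq l 0%N ++ b)) (iota 0 L) &&
  all (fun l => kappa (nseq l 0%N ++ b) <= M)%N (iota 0 L).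

(* The sibling of [i :: v] that is examined is [1 :: v] if [i = 0], and [0 :: v] otherwise. *)
Definition bad_step (kappa : seq nat -> nat) (v : seq nat) (i : nat) : bool :=
  ~~ [&& (1 < kappa v)%N, (kappa v <= M)%N & aided kappa (nat_of_bool (i == 0%N) :: v)].

(** Only children of index below [N] are tried, so that the event is determined by finitely many
    degrees; the limit in [N] is monotone by [leq_bad_path]. *)
Fixpoint bad_path (kappa : seq nat -> nat) (N n : nat) (v : seq nat) : bool :=
  if n is n'.+1 then
    has (fun i => bad_step kappa v i && bad_path kappa N n' (i :: v)) (iota 0 (minn (kappa v) N))
  else true.

Lemma leq_bad_path kappa N N' n v : (N <= N')%N ->
  bad_path kappa N n v -> bad_path kappa N' n v.
Proof.
move=> NN'; elim: n v => // n IH v /= /hasP[i]; rewrite mem_iota => iN /andP[bi /IH bp].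
by apply/hasP; exists i; rewrite ?bi ?bp// mem_iota; lia.
Qed.

Inductive bad_reach (kappa : seq nat -> nat) : seq nat -> seq nat -> Prop :=
| bad_reach0 z : bad_reach kappa z z
| bad_reachS z i u : (i < kappa z)%N -> bad_step kappa z i ->
    bad_reach kappa (i :: z) u -> bad_reach kappa z u.

Lemma bad_reach_child kappa z u i : bad_reach kappa z u -> (i < kappa u)%N ->
  bad_step kappa u i -> bad_reach kappa z (i :: u).
Proof.
elim=> {z u} [z|z j u jz bj _ IH] iz bi; first by apply: (bad_reachS iz bi); exact: bad_reach0.
by apply: (bad_reachS jz bj); exact: IH.
Qed.

Lemma bad_reach_parent kappa z a u : bad_reach kappa z (a :: u) ->
  z = a :: u \/ bad_reach kappa z u.
Proof.
move e : (a :: u) => v zv; elim: zv e => {z v} [z|z j v jz bj _ IH] e; first by left.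
right; have [zv|zu] := IH e; first by move: e; rewrite -zv => -[_ ->]; exact: bad_reach0.
exact: (bad_reachS jz bj).
Qed.

(** The words reached by bad steps from [x] or from one of its ancestors. Starting from all
    ancestors makes the set closed under parents, so it can be left only through a child that is not
    bad. *)
Fixpoint bad_comp (kappa : seq nat -> nat) (x u : seq nat) : Prop :=
  bad_reach kappa x u \/ (if x is _ :: x' then bad_comp kappa x' u else False).

Lemma bad_comp_child kappa x u i : bad_comp kappa x u -> (i < kappa u)%N ->
  bad_step kappa u i -> bad_comp kappa x (i :: u).
Proof.
move=> + iu bi; elim: x => [|a x IH] /=.
  by case=> // xu; left; exact: bad_reach_child.
by case=> [xu|/IH]; [left; exact: bad_reach_child|right].
Qed.

Lemma bad_comp_refl kappa x : bad_comp kappa x x.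
Proof. by case: x => [|a x]; left; exact: bad_reach0. Qed.

Lemma bad_comp_parent kappa x a u : bad_comp kappa x (a :: u) -> bad_comp kappa x u.
Proof.
elim: x => [|b x IH] /=; first by case=> // /bad_reach_parent[//|]; left.
case=> [/bad_reach_parent[[_ ->]|xu]|/IH xu]; [right|by left|by right].
exact: bad_comp_refl.
Qed.

End patterns.

(** * Vanishing of bounded subsolutions [r <= G (P r)] *)

Section subsolution.
Context {R : realType}.
Variables (kappa : seq nat -> nat) (lam : R) (mu : nat -> R) (D : nat).
Variables (o : seq nat) (r : seq nat -> R).
Hypothesis lam_gt0 : 0 < lam.
Hypothesis kappa_gt0 : forall x, (0 < kappa x)%N.
Hypothesis mu_ge0 : forall k, 0 <= mu k.
Hypothesis mu_sum : (fun n => \sum_(0 <= k < n) mu k) @ \oo --> (1 : R).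
Hypothesis mu0 : mu 0%N = 0.
Hypothesis mu1 : mu 1%N < 1.
Hypothesis D_gt1 : (1 < D)%N.
Hypothesis o_tree : in_tree kappa o.
Hypothesis r_o : r o = 0.
Hypothesis r_ge0 : forall x, 0 <= r x.
Hypothesis r_le1 : forall x, r x <= 1.
Let P := step_op kappa lam.
Let G := trunc_gf mu D.
Hypothesis r_sub : forall x, r x <= G (P r x).

Let s x := 1 - r x.

Let s_ge0 x : 0 <= s x. Proof. by rewrite subr_ge0. Qed.

Let Pr_bounds x : 0 <= P r x <= 1.
Proof. by rewrite step_op_ge0//= step_op_le_cst. Qed.

Let Ps x : P s x = 1 - P r x.
Proof.
rewrite -[X in X - _](step_op_cst lam_gt0 1 (kappa_gt0 x)) /s -mulN1r -step_opZ -step_opD.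
by apply: eq_step_op => y; rewrite mulN1r.
Qed.

(** A maximum principle: where [r <= c < 1] on all neighbours, [G (P r) <= t * P r] with
    [t = mu 1 + (1 - mu 1) * c < 1]. Iterating inside [V] gives [r <= max e (t ^ n)] for every
    [n]. *)
Lemma contract (V : seq nat -> Prop) (e c : R) : 0 <= e -> c < 1 ->
  (forall v, V v -> r v <= c) ->
  (forall v, V v -> r v <= e \/ forall y, y \in nbrs kappa v -> V y) ->
  forall v, V v -> r v <= e.
Proof.
move=> e0 c1 Vc Vn v Vv.
have c0 : 0 <= c := le_trans (r_ge0 v) (Vc _ Vv).
pose t := mu 1%N + (1 - mu 1%N) * c.
have h1 : 0 <= (1 - mu 1%N) * c by rewrite mulr_ge0// subr_ge0 ltW.
have h2 : (1 - mu 1%N) * c < 1 - mu 1%N by rewrite -[ltRHS]mulr1 ltr_pM2l ?subr_gt0.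
have t01 : 0 <= t < 1 by rewrite /t addr_ge0//=; lra.
have H n : forall v, V v -> r v <= Num.max e (t ^+ n).
  elim: n => [|n IH] u Vu; first by rewrite expr0 le_max r_le1 orbT.
  have [re|nV] := Vn _ Vu; first by rewrite le_max re.
  have P1 : P r u <= c by apply: step_op_le_cst => // y /nV; exact: Vc.
  have P2 : P r u <= Num.max e (t ^+ n) by apply: step_op_le_cst => // y /nV; exact: IH.
  have /andP[P0 P11] := Pr_bounds u.
  apply: le_trans (r_sub u) _;
    apply: le_trans (trunc_gf_le mu_ge0 mu_sum D_gt1 mu0 (Pr_bounds u)) _.
  apply: (@le_trans _ _ (Num.max e (t ^+ n) * t)).
    apply: ler_pM => //; last by rewrite /t lerD2l ler_wpM2l// subr_ge0 ltW.
    by rewrite addr_ge0 ?mulr_ge0// subr_ge0 ltW.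
  have [t0 /ltW t1] := andP t01.
  rewrite maxr_pMl// exprSr ge_max !le_max lexx orbT andbT; apply/orP; left.
  by rewrite ler_piMr.
have [//|re] := leP (r v) e.
have rv : 0 < r v by apply: le_lt_trans re.
(* Half of [r v] makes both alternatives of the maximum contradict [e < r v]. *)
have [n tn] := expr_small t01 (e := r v / 2) (divr_gt0 rv (ltr0n _ 2)).
have := H n _ Vv; rewrite le_max => /orP[|]; lra.
Qed.

Lemma subsolution_zero (c : R) : c < 1 -> (forall x, r x <= c) -> forall x, r x = 0.
Proof.
move=> c1 rc x; apply/eqP; rewrite eq_le r_ge0 andbT.
by apply: (@contract (fun=> True) 0 c) => // v _; right.
Qed.

Let s_super x : P s x <= s x.
Proof.
rewrite Ps lerD2l lerN2; apply: le_trans (r_sub x) _.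
by apply: trunc_gf_le_id => //; exact: ltW.
Qed.

Let s_nbr x y : y \in nbrs kappa x -> bstep kappa lam x y * s y <= s x.
Proof. by move=> xy; apply: le_trans (s_super x); exact: step_op_ge1. Qed.

Let s_child x i : (i < kappa x)%N -> (lam + (kappa x)%:R)^-1 * s (i :: x) <= s x.
Proof.
move=> ix; apply: le_trans (s_nbr (mem_nbrs_child ix)).
by apply: ler_wpM2r => //; exact: bstep_child.
Qed.

(** [s] is superharmonic, so positivity crosses each edge that the walk can cross. It goes from [o],
    where [s = 1], to the root along the tree, and from the root to every word, since a step to the
    parent always has positive probability. *)
Lemma survival_gt0 x : 0 < s x.
Proof.
have : 0 < s [::].
  move: o_tree; have : 0 < s o by rewrite /s r_o subr0.
  elim: (o) => // i y IH siy /= /andP[ty iy]; apply: IH => //.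
  apply: lt_le_trans (s_child iy); rewrite mulr_gt0// invr_gt0.
  exact: denom_gt0.
elim: x => // a x IH /IH sx.
apply: lt_le_trans (@s_nbr (a :: x) x _); last by rewrite mem_cat mem_head.
by rewrite bstep_parent mulr_gt0// divr_gt0// denom_gt0.
Qed.

(** The walk drifts to the root: [P f <= c * f] off the root with [c < 1]. Since [r <= P r],
    iteration gives [r <= r [::] + c ^ n * f], so [r] is bounded by its value at the root. *)
Lemma subsolution_zero_small_degree (K : R) : K < lam -> (forall x, (kappa x)%:R <= K) ->
  forall x, r x = 0.
Proof.
move=> Kl kK.
have K1 : 1 <= K by rewrite (le_trans _ (kK [::]))// ler1n.
pose b := (lam + K) / (2 * K).
have b1 : 1 < b by rewrite ltr_pdivlMr ?mul1r; lra.
have b0 : 0 < b by lra.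
have bK : K * b < lam.
  rewrite /b (_ : K * _ = (lam + K) / 2); first lra.
  by field; lra.
(* The value of [P f / f] at a vertex of degree exactly [K]; smaller degrees give a smaller
   quotient. *)
pose c := 1 - (b - 1) * (lam / b - K) / (lam + K).
have g0 : 0 < lam / b - K by rewrite subr_gt0 ltr_pdivlMr.
have lK : 0 < lam + K by lra.
have c1 : c < 1 by rewrite ltrBlDr ltrDl divr_gt0// mulr_gt0//; lra.
have c0 : 0 <= c.
  rewrite subr_ge0 ler_pdivrMr// mul1r.
  have -> : (b - 1) * (lam / b - K) = lam - lam / b - b * K + K by field; lra.
  have : 0 <= lam / b by rewrite divr_ge0 ?ltW.
  have : 0 <= b * K by rewrite mulr_ge0// ?ltW//; lra.
  lra.
pose f (x : seq nat) := b ^+ size x.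
have f0 x : 0 <= f x by rewrite exprn_ge0// ltW.
have Pf a x : P f (a :: x) <= c * f (a :: x).
  rewrite /P step_op_cons//; set k : R := (kappa (a :: x))%:R.
  have k0 : 0 <= k by rewrite ler0n.
  have kk : k <= K by exact: kK.
  rewrite (eq_bigr (fun=> f (a :: x) * b)); last by move=> i _; rewrite /f /= exprSr.
  rewrite big_const_seq count_predT size_iota iter_addr_0 -[_ *+ _]mulr_natr -/k.
  have -> : f x = f (a :: x) / b by rewrite /f /= exprSr mulfK// gt_eqF.
  have lk : 0 < lam + k by lra.
  rewrite ler_pdivrMr//.
  have -> : lam * (f (a :: x) / b) + f (a :: x) * b * k = f (a :: x) * (lam / b + b * k) by ring.
  rewrite (_ : c * f (a :: x) * (lam + k) = f (a :: x) * (c * (lam + k))); last by ring.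
  rewrite ler_wpM2l//.
  have -> : lam / b + b * k = (lam + k) - (b - 1) * (lam / b - k) by field; lra.
  have -> : c * (lam + k) =
      (lam + k) - (b - 1) * ((lam / b - K) * ((lam + k) / (lam + K))) by rewrite /c; field; lra.
  rewrite lerD2l lerN2 ler_pM2l; last lra.
  rewrite -[leRHS]mulr1; apply: ler_pM.
  - exact: ltW.
  - by rewrite divr_ge0 ?ltW.
  - by rewrite lerD2l lerN2.
  - by rewrite ler_pdivrMr// mul1r lerD2l.
have H n x : r x <= r [::] + c ^+ n * f x.
  elim: n x => [|n IH] x.
    rewrite expr0 mul1r; apply: le_trans (r_le1 x) _.
    have : 1 <= f x by rewrite exprn_ege1// ltW.
    have := r_ge0 [::]; lra.
  case: x => [|a x]; first by rewrite lerDl mulr_ge0// exprn_ge0.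
  have r1 : r (a :: x) <= P r (a :: x).
    by have := s_super (a :: x); rewrite Ps /s lerD2l lerN2.
  apply: le_trans r1 _; apply: (@le_trans _ _ (P (fun y => r [::] + c ^+ n * f y) (a :: x))).
    by apply: step_op_le.
  rewrite /P step_opD step_op_cst// step_opZ lerD2l exprSr -mulrA ler_wpM2l ?exprn_ge0//.
have A1 : r [::] < 1 by have := survival_gt0 [::]; rewrite /s; lra.
apply: (@subsolution_zero (r [::])) => // x.
apply/ler_addgt0Pr => e e0.
have fx : 0 < f x by rewrite exprn_gt0.
have [n cn] := expr_small (t := c) (e := e / f x) (introT andP (conj c0 c1)) (divr_gt0 e0 fx).
by apply: le_trans (H n x) _; rewrite lerD2l -ler_pdivlMr.
Qed.

(** The root has no parent, which [pv <= 0] accounts for, and its denominator [kappa] is below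
    [lam + kappa]; hence one bound serves all vertices. *)
Lemma step_op_lower x (pv cv : R) :
  (if x is _ :: x' then pv <= s x' else pv <= 0) -> 0 <= cv ->
  (forall i, (i < kappa x)%N -> cv <= s (i :: x)) ->
  (lam * pv + (kappa x)%:R * cv) / (lam + (kappa x)%:R) <= P s x.
Proof.
move=> Hp cv0 Hc.
have k0 : 0 < (kappa x)%:R :> R by rewrite ltr0n.
have Hsum : (kappa x)%:R * cv <= \sum_(i <- iota 0 (kappa x)) s (i :: x).
  rewrite -[X in X%:R](size_iota 0 (kappa x)) -sum1_size natr_sum mulr_suml.
  rewrite big_seq [leRHS]big_seq; apply: ler_sum => i; rewrite mem_iota => ix.
  by rewrite mul1r Hc.
have lk : 0 < lam + (kappa x)%:R by exact: denom_gt0.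
case: x Hp Hc k0 Hsum lk => [|a x] Hp Hc k0 Hsum lk; rewrite /P; last first.
  by rewrite step_op_cons// ler_pM2r ?invr_gt0// lerD// ler_pM2l.
rewrite step_op_nil ler_pdivrMr//.
apply: (@le_trans _ _ ((kappa [::])%:R * cv)).
  by rewrite gerDr pmulr_rle0.
apply: (le_trans Hsum); rewrite mulrAC ler_pdivlMr// ler_wpM2l//.
  by apply: sumr_ge0 => i _.
by rewrite lerDr ltW.
Qed.

(** As long as [t <= ts], the inequality [t * f <= s] on a copy improves to [q * t * f <= s] with a
    fixed [q > 1]. The initial [t] depends on the copy, but iteration always ends at [ts], which
    does not. *)
Lemma good_top_survival (deg : nat -> nat) (H : nat) (f : nat -> R) (M : R) :
  1 <= M < trunc_mean mu D ->
  (forall k, (k <= H)%N -> 0 < f k /\ (lam + (deg k)%:R) * f k <=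
     M * (lam * (if k is k'.+1 then f k' else 0) +
          (deg k)%:R * (if (k < H)%N then f k.+1 else 0))) ->
  exists2 e : R, 0 < e & forall z, good_top deg H kappa z -> e <= s z.
Proof.
move=> /andP[M1 MD] Hf.
have M0 : 0 < M by lra.
pose B := \sum_(0 <= k < H.+1) f k.
have fB k : (k <= H)%N -> f k <= B.
  move=> kH; rewrite /B (bigD1_seq k) ?iota_uniq ?mem_index_iota//= lerDl big_seq_cond.
  apply: sumr_ge0 => j; rewrite mem_index_iota => /andP[jH _]; apply: ltW.
  by apply: (Hf j _).1; lia.
have B0 : 0 < B by apply: lt_le_trans (fB 0%N _); rewrite ?(Hf 0%N _).1.
(* A slope strictly between [M] and the truncated mean: the margin above [M] gives [q > 1], the
   margin below the mean absorbs the quadratic error. *)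
pose m' := (M + trunc_mean mu D) / 2.
pose q := m' / M.
have q1 : 1 < q by rewrite /q ltr_pdivlMr// mul1r /m'; lra.
pose C : R := D%:R ^+ 2 + 1.
have C0 : 0 < C by rewrite ltr_wpDl ?sqr_ge0.
(* For [u] up to [dl] the error [D ^ 2 * u ^ 2] is at most [(trunc_mean - m') * u]. *)
pose dl := Num.min 1 ((trunc_mean mu D - m') / C).
have dl0 : 0 < dl by rewrite lt_min ltr01 divr_gt0// /m'; lra.
have lin (u : R) : 0 <= u <= dl -> m' * u <= 1 - G (1 - u).
  rewrite /dl le_min => /and3P[u0 u1]; rewrite ler_pdivlMr// => uC.
  apply: le_trans (trunc_gf_lower D mu_ge0 mu_sum _); last by rewrite u0.
  have h : u * (u * C) <= u * (trunc_mean mu D - m') by rewrite ler_wpM2l.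
  have h2 : 0 <= u ^+ 2 by rewrite sqr_ge0.
  move: h; rewrite /C (_ : u * (u * _) = D%:R ^+ 2 * u ^+ 2 + u ^+ 2); last by ring.
  rewrite mulrBr; lra.
pose ts := dl / B.
have ts0 : 0 < ts by rewrite divr_gt0.
exists (ts * f 0%N); first by rewrite mulr_gt0// (Hf 0%N _).1.
move=> z /allP gz.
have step t : 0 <= t <= ts -> (forall y, y \in pat_words deg H -> t * f (size y) <= s (y ++ z)) ->
    forall y, y \in pat_words deg H -> q * t * f (size y) <= s (y ++ z).
  move=> /andP[t0 tts] ht y yp; have /eqP ky := gz _ yp.
  have yH : (size y <= H)%N by move: yp; rewrite mem_pat_words => /andP[].
  have [fy Hy] := Hf _ yH; set k := size y in ky yH fy Hy *.
  (* The inequality on [f] gives [P s >= u] at this vertex, whence [s >= 1 - G (1 - u) >= m' * u],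
     and [m' * u] is [q * t * f k]. *)
  pose u := t * f k / M.
  have u0 : 0 <= u by rewrite divr_ge0 ?mulr_ge0// ltW.
  have udl : u <= dl.
    apply: (@le_trans _ _ (t * f k)).
      by rewrite ler_pdivrMr// ler_peMr// mulr_ge0// ltW.
    rewrite -(@ler_pM2r _ B^-1) ?invr_gt0// -/ts; apply: le_trans _ tts.
    by rewrite ler_pdivrMr// ler_wpM2l// fB.
  have u1 : u <= 1 by rewrite (le_trans udl)// /dl ge_min lexx.
  have uP : u <= P s (y ++ z).
    apply: le_trans (@step_op_lower (y ++ z)
      (t * (if k is k'.+1 then f k' else 0)) (t * (if (k < H)%N then f k.+1 else 0)) _ _ _).
    - have dk : 0 < lam + (deg k)%:R by rewrite -ky denom_gt0.
      rewrite ky /u ler_pdivrMr// mulrAC ler_pdivlMr//.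
      set fm := (if k is k'.+1 then f k' else 0) in Hy *.
      set fp := (if (k < H)%N then f k.+1 else 0) in Hy *.
      rewrite (_ : t * f k * _ = t * ((lam + (deg k)%:R) * f k)); last by ring.
      rewrite (_ : _ * M = t * (M * (lam * fm + (deg k)%:R * fp))); last by ring.
      by rewrite ler_wpM2l.
    - rewrite /k; case: (y) yp => [_|i y' yp] /=.
        by rewrite mulr0; case: (z).
      by apply: ht; move: yp; rewrite pat_words_cons => /and3P[].
    - case: ifP => kH; rewrite ?mulr0// mulr_ge0// ltW//; exact: (Hf k.+1 kH).1.
    - move=> i iy; case: ifP => kH; last by rewrite mulr0.
      by apply: (ht (i :: y)); rewrite pat_words_cons kH yp -ky.
  apply: (@le_trans _ _ (m' * u)).
    by rewrite /u /q (_ : m' / M * t * f k = m' * (t * f k / M)) ?lexx//; ring.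
  apply: (@le_trans _ _ (1 - G (1 - u))); first by apply: lin; rewrite u0.
  rewrite /s lerD2l lerN2; apply: le_trans (r_sub _) _; apply: le_trunc_gf => //.
  have /andP[-> _] := Pr_bounds (y ++ z); move: uP; rewrite Ps /=; lra.
(* A pattern has finitely many words and [s] is positive at each of them. *)
have [t0 t00 Ht0] : exists2 t, 0 < t & forall y, y \in pat_words deg H -> t * f (size y) <= s (y ++ z).
  suff [t t0 Ht] : exists2 t : R, 0 < t & forall y, y \in pat_words deg H -> t <= s (y ++ z).
    exists (t / B); first exact: divr_gt0.
    move=> y yp; apply: le_trans (Ht _ yp).
    rewrite mulrAC ler_pdivrMr// ler_pM2l// fB//.
    by move: yp; rewrite mem_pat_words => /andP[].
  elim: (pat_words deg H) => [|y l [t t0 Ht]]; first by exists 1.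
  exists (Num.min t (s (y ++ z))); first by rewrite lt_min t0 survival_gt0.
  by move=> v; rewrite inE ge_min => /predU1P[->|/Ht ->//]; rewrite lexx orbT.
have Hn n : forall y, y \in pat_words deg H ->
    Num.min (t0 * q ^+ n) ts * f (size y) <= s (y ++ z).
  elim: n => [|n IH] y yp.
    rewrite expr0 mulr1; apply: le_trans (Ht0 _ yp); rewrite ler_wpM2r ?ge_min ?lexx// ltW//.
    by apply: (Hf _ _).1; move: yp; rewrite mem_pat_words => /andP[].
  have fy : 0 < f (size y).
    by apply: (Hf _ _).1; move: yp; rewrite mem_pat_words => /andP[].
  apply: le_trans (step _ _ IH _ yp); last first.
    rewrite ge_min lexx orbT andbT le_min (ltW ts0) andbT mulr_ge0 ?exprn_ge0 ?ltW//; lra.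
  rewrite ler_pM2r// minr_pMr; last lra.
  rewrite le_min !ge_min exprS mulrCA lexx /=; apply/orP; right.
  by rewrite ler_peMl// ltW.
have q01 : 0 <= q^-1 < 1 by rewrite invr_ge0 (ltW (lt_trans ltr01 q1)) invf_lt1//; lra.
have [n qn] := expr_small q01 (e := t0 / ts) (divr_gt0 t00 ts0).
have := Hn n [::]; rewrite mem_pat_words mem_head => /(_ isT) /=.
suff -> : Num.min (t0 * q ^+ n) ts = ts by [].
apply/min_idPr; move: qn; rewrite exprVn ler_pdivlMr// mulrC.
by rewrite ler_pdivrMr// exprn_gt0//; lra.
Qed.

(** A vertex with a child that is not bad has [s >= e1]. At any other vertex all children are bad,
    so its neighbours stay in [bad_comp]. Finiteness of that component keeps [r] below some [c' < 1]
    on it, and [contract] turns this into [r <= max 0 (1 - e1)], a bound common to all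
    components. *)
Lemma subsolution_zero_bad_comp (deg : nat -> nat) (H L M : nat) (e : R) : 0 < e ->
  (forall z, good_top deg H kappa z -> e <= s z) ->
  (forall z, exists n, forall N, ~~ bad_path deg H L M kappa N n z) ->
  forall x, r x = 0.
Proof.
move=> e0 He Hb.
pose c := (lam + M%:R)^-1.
have [M0|M1] := posnP M.
  (* [M = 0] makes every step bad, so that bad paths of any length exist. *)
  exfalso; have [n /(_ 1%N)] := Hb [::]; apply/negP; rewrite negbK.
  elim: n [::] => //= n IH v; apply/hasP; exists 0%N; last by rewrite IH /bad_step M0 leqn0;
    case: (kappa v) (kappa_gt0 v) => // k _; rewrite andbF.
  by rewrite mem_iota leq_min kappa_gt0.
have lM : 1 < lam + M%:R by rewrite ltr_pwDl// ler1n.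
have c0 : 0 < c by rewrite invr_gt0; lra.
have c1 : c <= 1 by rewrite invf_le1; lra.
have sc x i : (i < kappa x)%N -> (kappa x <= M)%N -> c * s (i :: x) <= s x.
  move=> ix xM; apply: le_trans (s_child ix); rewrite ler_wpM2r//.
  by rewrite lef_pV2 ?posrE ?denom_gt0 ?lerD2l ?ler_nat//; lra.
(* The cost of carrying [e] from a good top to [v]: a factor [c] for each of fewer than [L] edges of
   the first-child line, and one for the edge from the sibling to [v]. *)
pose e1 := e * c ^+ L.+1.
have e10 : 0 < e1 by rewrite mulr_gt0// exprn_gt0.
have nb v i : ~~ bad_step deg H L M kappa v i -> e1 <= s v.
  rewrite negbK => /and3P[v1 vM /andP[/hasP[l]]].
  rewrite mem_iota => lL /He sl /allP Hl.
  set b := _ :: v in sl Hl.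
  have ch k : (k <= l)%N -> e * c ^+ (l - k) <= s (nseq k 0%N ++ b).
    move=> kl; rewrite -(subKn kl); move: (l - k)%N (leq_subr k l) => {kl}k kl.
    elim: k kl => [|k IH] kl; first by rewrite subn0 subnn expr0 mulr1.
    have := IH (ltnW kl); rewrite (_ : l - (l - k.+1) = (l - (l - k)).+1)%N; last by lia.
    rewrite (_ : l - k = (l - k.+1).+1)%N /= => [h|]; last by lia.
    apply: le_trans (@sc _ 0%N (kappa_gt0 _) _); last by apply: Hl; rewrite mem_iota; lia.
    by rewrite exprS mulrCA ler_pM2l//.
  apply: (@le_trans _ _ (c * s b)); last by apply: sc => //; case: (i == 0%N); lia.
  have := ch 0%N (leq0n _); rewrite subn0 /= => h.
  apply: le_trans _ (ler_wpM2l (ltW c0) h).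
  rewrite /e1 mulrCA ler_pM2l// -exprS; apply: ler_wiXn2l => //; [exact: ltW|lia].
(* Bad paths from [z] are shorter than [n] and degrees are finite, so [c'] is built from finitely
   many maxima, each below 1 by [survival_gt0]. *)
have bound n z : (forall N, ~~ bad_path deg H L M kappa N n z) ->
    exists2 c', c' < 1 & forall u, bad_reach deg H L M kappa z u -> r u <= c'.
  elim: n z => [|n IH] z Hz; first by have := Hz 0%N.
  have Hi i : (i < kappa z)%N -> exists2 c', c' < 1 & bad_step deg H L M kappa z i ->
      forall u, bad_reach deg H L M kappa (i :: z) u -> r u <= c'.
    move=> iz; case: (boolP (bad_step deg H L M kappa z i)) => [bi|]; last by exists 0.
    have [N|c' c'1 Hc'] := IH (i :: z); last by exists c'.
    apply: contra (Hz (maxn N i.+1)) => bp /=; apply/hasP; exists i.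
      by rewrite mem_iota; lia.
    by rewrite bi (leq_bad_path _ bp)// leq_maxl.
  have [c' c'1 Hc'] : exists2 c', c' < 1 & forall i, (i < kappa z)%N ->
      bad_step deg H L M kappa z i -> forall u, bad_reach deg H L M kappa (i :: z) u -> r u <= c'.
    elim: (kappa z) Hi => [|k IHk] Hi; first by exists 0.
    have [i ik|a a1 Ha] := IHk; first by apply: Hi; lia.
    have [b b1 Hb'] := Hi k (ltnSn k).
    exists (Num.max a b); first by rewrite gt_max a1.
    move=> i; rewrite ltnS leq_eqVlt => /predU1P[->|ik] bi u zu; rewrite le_max.
      by rewrite Hb' ?orbT.
    by rewrite (Ha _ ik bi).
  exists (Num.max c' (r z)).
    by rewrite gt_max c'1 /=; have := survival_gt0 z; rewrite /s; lra.
  move=> u zu; case: zu Hc' => {z u Hz Hi} [z _|z i u iz bi zu Hc']; rewrite le_max ?lexx ?orbT//.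
  by rewrite (Hc' i iz bi).
have cbound x : exists2 c', c' < 1 & forall u, bad_comp deg H L M kappa x u -> r u <= c'.
  elim: x => [|a x [c' c'1 IH]].
    have [n Hn] := Hb [::]; have [c' c'1 Hc'] := bound _ _ Hn.
    by exists c' => // u [] //; exact: Hc'.
  have [n Hn] := Hb (a :: x); have [c2 c21 Hc2] := bound _ _ Hn.
  exists (Num.max c' c2); first by rewrite gt_max c'1.
  by move=> u [/Hc2|/IH] h; rewrite le_max h ?orbT.
pose th := Num.max 0 (1 - e1).
have th0 : 0 <= th by rewrite le_max lexx.
have th1 : th < 1 by rewrite gt_max ltr01 ltrBlDr ltrDl.
apply: (subsolution_zero th1) => x; have [c' c'1 Hc'] := cbound x.
apply: (contract th0 c'1 Hc'); last exact: bad_comp_refl.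
move=> u xu; have [h|h] := leP (r u) (1 - e1); [left|right].
  by rewrite le_max h orbT.
move=> y /nbrsP[[a ua]|[i iu ->]]; first by apply: (@bad_comp_parent _ _ _ _ _ _ a); rewrite -ua.
apply: bad_comp_child => //; apply: contraT => /nb; rewrite /s; lra.
Qed.

End subsolution.

Lemma cvg_sum_seq {R : realType} (J : Type) (l : seq J) (u : J -> nat -> R) (v : J -> R) :
  (forall j, u j n @[n --> \oo] --> v j) ->
  \sum_(j <- l) u j n @[n --> \oo] --> \sum_(j <- l) v j.
Proof.
move=> uv; elim: l => [|j l IH].
  by rewrite big_nil; under eq_fun do rewrite big_nil; exact: cvg_cst.
rewrite big_cons; under eq_fun do rewrite big_cons.
by apply: cvgD.
Qed.

(** [avoid_prob] decreases with the number of generations. [P] is a finite sum and [G] a polynomial,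
    so the inequality [a n.+1 <= G (P (a n))] passes to the limit, which is therefore a subsolution
    vanishing at [o]. *)
Lemma avoid_prob_vanishes {R : realType} (kappa : seq nat -> nat) (lam : R)
    (mu : nat -> R) (D : nat) (o : seq nat) :
  0 < lam -> (forall x, (0 < kappa x)%N) -> (forall k, 0 <= mu k) ->
  (fun n => \sum_(0 <= k < n) mu k) @ \oo --> (1 : R) ->
  (forall r : seq nat -> R, r o = 0 -> (forall x, 0 <= r x) -> (forall x, r x <= 1) ->
    (forall x, r x <= trunc_gf mu D (step_op kappa lam r x)) -> forall x, r x = 0) ->
  forall z (e : R), 0 < e -> exists n, step_op kappa lam (avoid_prob kappa lam mu D o n) z <= e.
Proof.
move=> lam0 k0 mu0 mus Hr z e e0; set a := avoid_prob kappa lam mu D o.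
have a0 n x : 0 <= a n x by exact: avoid_prob_ge0.
have G1 : trunc_gf mu D 1 = 1.
  by rewrite -[RHS](trunc_law_sum mu D); apply: eq_bigr => j _; rewrite expr1n mulr1.
have aE n x : a n.+1 x = (x != o)%:R * trunc_gf mu D (step_op kappa lam (a n) x) by [].
have P0 n x : 0 <= step_op kappa lam (a n) x by apply: step_op_ge0.
have a1 n x : a n x <= 1.
  elim: n x => [|n IH] x; first by rewrite /a /= mulr1; case: eqP.
  rewrite aE.
  rewrite -[leRHS]mulr1; apply: ler_pM => //; first exact: trunc_gf_ge0.
    by case: eqP.
  by rewrite -[leRHS]G1; apply: le_trunc_gf => //; rewrite P0 step_op_le_cst.
have aS n x : a n.+1 x <= a n x.
  elim: n x => [|n IH] x.
    rewrite aE [leRHS]/a /= ler_wpM2l// -[leRHS]G1; apply: le_trunc_gf => //.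
    by rewrite (P0 0%N) step_op_le_cst// => y _; exact: (a1 0%N).
  rewrite !aE ler_wpM2l//; apply: le_trunc_gf => //.
  by rewrite (P0 n.+1) step_op_le.
have cva x : exists l : R, a n x @[n --> \oo] --> l.
  exists (inf (range (a ^~ x))); apply: nonincreasing_cvgn.
    by apply/nonincreasing_seqP => n.
  by exists 0 => _ [n _ <-].
have [r cvr] := choice cva.
have cvP x : step_op kappa lam (a n) x @[n --> \oo] --> step_op kappa lam r x.
  apply: (@cvg_sum_seq _ _ _ (fun y n => bstep kappa lam x y * a n y)
    (fun y => bstep kappa lam x y * r y)) => y.
  apply: cvgM; [exact: cvg_cst|exact: cvr].
have rz : forall x, r x = 0.
  apply: Hr.
  - have : a n o @[n --> \oo] --> (0 : R).
      rewrite (_ : (fun n => a n o) = fun=> 0); first exact: cvg_cst.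
      by apply/funext => -[|n]; rewrite /a /= eqxx mul0r.
    by move=> h; have := cvg_unique (@Rhausdorff R) (cvr o) h; exact.
  - by move=> x; apply: (ler_cvg_to (cvg_cst (0 : R)) (cvr x)); near=> n.
  - by move=> x; apply: (ler_cvg_to (cvr x) (cvg_cst (1 : R))); near=> n.
  - move=> x.
    have cvG : trunc_gf mu D (step_op kappa lam (a n) x) @[n --> \oo] -->
        trunc_gf mu D (step_op kappa lam r x).
      apply: (@cvg_sum_seq _ _ _ (fun j n => trunc_law mu D j * step_op kappa lam (a n) x ^+ j)
        (fun j => trunc_law mu D j * step_op kappa lam r x ^+ j)) => j.
      apply: cvgM; first exact: cvg_cst.
      exact: (cvg_comp _ _ (cvP x) (@exprn_continuous R j _)).
    have cvrS : a n.+1 x @[n --> \oo] --> r x by have := cvr x; rewrite -cvg_shiftS.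
    apply: (ler_cvg_to cvrS cvG); near=> n.
    by rewrite aE -[leRHS]mul1r ler_wpM2r ?trunc_gf_ge0//; case: eqP.
have : step_op kappa lam (a n) z @[n --> \oo] --> (0 : R).
  rewrite (_ : 0 = step_op kappa lam r z)//.
  by rewrite /step_op big1// => y _; rewrite rz mulr0.
move=> /cvgrPdist_le /(_ e e0)[n _ /(_ n (leqnn n))] /=.
by rewrite sub0r normrN ger0_norm// => ?; exists n.
Unshelve. all: by end_near. Qed.

(** * Finite spherically symmetric trees carrying a positive subsolution *)

Section pattern_existence.
Context {R : realType}.
Variables (lam M : R) (supp : nat -> Prop).
Hypothesis lam_gt0 : 0 < lam.
Hypothesis M_gt0 : 0 < M.

(* [f] solves [M P f >= f] on a spherically symmetric tree of depth [H], with the value [a]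
   at the parent of its root, [b] at its root and [0] below depth [H]. *)
Definition pattern_from (a b : R) : Prop :=
  exists (H : nat) (deg : nat -> nat) (f : nat -> R), f 0%N = b /\
  forall k, (k <= H)%N -> [/\ supp (deg k), 0 < f k &
    (lam + (deg k)%:R) * f k <=
     M * (lam * (if k is k'.+1 then f k' else a) +
          (deg k)%:R * (if (k < H)%N then f k.+1 else 0))].

(** [c] is the value at the next level that turns the inequality into an equality. If it is not
    positive, the tree stops here: the value 0 below already satisfies the inequality. *)
Lemma pattern_cons (k : nat) (a b : R) (c := ((lam + k%:R) * b / M - lam * a) / k%:R) :
  supp k -> (0 < k)%N -> 0 < b -> (0 < c -> pattern_from b c) -> pattern_from a b.
Proof.
move=> sk k0 b0 Hc; have k0' : 0 < k%:R :> R by rewrite ltr0n.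
have ce : k%:R * c = (lam + k%:R) * b / M - lam * a by rewrite /c mulrC divfK// gt_eqF.
have Mc : M * (lam * a + k%:R * c) = (lam + k%:R) * b.
  by rewrite ce; field; rewrite gt_eqF.
have [/Hc[H [deg [f [f0 Hf]]]]|c0] := ltP 0 c; last first.
  exists 0%N, (fun=> k), (fun=> b); split => // -[|//] _; split => //.
  rewrite -Mc /= mulr0 addr0 ler_pM2l// gerDl pmulr_rle0//.
exists H.+1, (fun n => if n is n'.+1 then deg n' else k), (fun n => if n is n'.+1 then f n' else b).
split => // -[_|n nH]; first by split => //=; rewrite -Mc f0.
by have [s1 s2 s3] := Hf n nH; split.
Qed.

(** Follows the ratio [t = b / a] of successive values through levels of degree [k]. The gap
    hypothesis says that one level lowers it by at least [g] while [t > lo], so [lo] is reached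
    after finitely many levels; [I], closed downwards, records where the gap is available. *)
Lemma pattern_phase (k : nat) (g lo : R) (I : R -> Prop) :
  supp k -> (0 < k)%N -> 0 < g -> 0 <= lo ->
  (forall t t', I t -> t' <= t -> I t') ->
  (forall t, lo < t -> I t -> (lam + k%:R) / M <= k%:R * t + lam / t - k%:R * g) ->
  (forall a b, 0 < a -> 0 < b -> b <= lo * a -> pattern_from a b) ->
  forall a b, 0 < a -> 0 < b -> I (b / a) -> pattern_from a b.
Proof.
move=> sk k0 g0 lo0 dI gap Hlo a b a0 b0 Iab.
have k0' : 0 < k%:R :> R by rewrite ltr0n.
have [n hn] : exists n : nat, b / a <= lo + n%:R * g.
  exists (Num.truncn (b / a / g)).+1.
  have := truncnS_gt (b / a / g); rewrite ltr_pdivrMr// => h; lra.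
elim: n a b a0 b0 Iab hn => [|n IH] a b a0 b0 Iab hn.
  by apply: Hlo => //; move: hn; rewrite mul0r addr0 ler_pdivrMr.
have [ab|ab] := leP (b / a) lo; first by apply: Hlo => //; rewrite -ler_pdivrMr.
apply: (@pattern_cons k) => // c0; set c := (X in 0 < X) in c0 *.
have cb : c / b <= b / a - g.
  have := gap _ ab Iab.
  have -> : lam / (b / a) = lam * a / b by rewrite invf_div mulrA.
  have -> : c / b = ((lam + k%:R) / M - lam * a / b) / k%:R.
    by rewrite /c; field; rewrite !gt_eqF.
  move=> h; rewrite ler_pdivrMr//; move: h; rewrite -subr_ge0 => h; rewrite -subr_ge0.
  by apply: le_trans h _; rewrite le_eqVlt; apply/orP; left; apply/eqP; ring.
apply: IH => //; first by apply: dI Iab (le_trans cb _); rewrite gerBl ltW.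
by apply: (le_trans cb); rewrite lerBlDr (le_trans hn)// -natr1 mulrDl mul1r addrA.
Qed.

Lemma pattern_start (k : nat) : supp k -> (0 < k)%N ->
  (forall b, 0 < b -> pattern_from 1 b) -> pattern_from 0 1.
Proof. by move=> sk k0 Hb; apply: (pattern_cons sk k0) => //; exact: Hb. Qed.

(** By the arithmetic-geometric inequality [k * t + lam / t >= 2 * q] for every [t > 0], so the
    ratio decreases by a fixed amount at each level and must become nonpositive. *)
Lemma pattern_spectral (k : nat) : supp k -> (0 < k)%N ->
  lam + k%:R < 2 * Num.sqrt (lam * k%:R) * M -> pattern_from 0 1.
Proof.
move=> sk k0 hM; have k0' : 0 < k%:R :> R by rewrite ltr0n.
set q := Num.sqrt _ in hM.
have q2 : q * q = lam * k%:R by rewrite -expr2 sqr_sqrtr// mulr_ge0// ltW.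
apply: (pattern_start sk k0) => b b0.
apply: (@pattern_phase k ((2 * q - (lam + k%:R) / M) / k%:R) 0 (fun=> True)) => //.
- by rewrite divr_gt0// subr_gt0 ltr_pdivrMr.
- move=> t t0 _; rewrite [k%:R * (_ / _)]mulrC divfK ?gt_eqF//.
  suff : 2 * q <= k%:R * t + lam / t by lra.
  rewrite -subr_ge0 (_ : _ - _ = (k%:R * t - q) ^+ 2 / (k%:R * t)).
    by rewrite divr_ge0 ?sqr_ge0// mulr_ge0// ltW.
  rewrite (_ : (k%:R * t - q) ^+ 2 = k%:R ^+ 2 * t ^+ 2 - 2 * q * k%:R * t + q * q); last by ring.
  by rewrite q2; field; rewrite !gt_eqF.
- move=> a' b' a'0 b'0; rewrite mul0r; lra.
Qed.

(** Degree [K >= lam] lowers ratios above 1, degree [k <= lam] lowers ratios below 1, and [M > 1]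
    makes the decrease uniform. Levels of degree [K] are used until the ratio is at most 1, then
    levels of degree [k]. *)
Lemma pattern_trap (k K : nat) : supp k -> (0 < k)%N -> supp K -> 1 < M ->
  k%:R <= lam <= K%:R -> pattern_from 0 1.
Proof.
move=> sk k0 sK M1 /andP[kl lK].
have k0' : 0 < k%:R :> R by rewrite ltr0n.
have K0' : 0 < K%:R :> R by exact: lt_le_trans lK.
have K0 : (0 < K)%N by rewrite -(@ltr0n R).
have hM : 0 < 1 - M^-1 by rewrite subr_gt0 invf_lt1.
have G (n : nat) : 0 < n%:R :> R -> 0 < (lam + n%:R) * (1 - M^-1) / n%:R.
  by move=> n0; rewrite divr_gt0// mulr_gt0// addr_gt0.
apply: (pattern_start sK K0) => b b0.
apply: (@pattern_phase K ((lam + K%:R) * (1 - M^-1) / K%:R) 1 (fun=> True)) => //.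
- exact: G.
- move=> t t1 _; rewrite [K%:R * (_ / _)]mulrC divfK ?gt_eqF//.
  have t0 : 0 < t by lra.
  suff : lam + K%:R <= K%:R * t + lam / t by rewrite mulrBr mulr1; lra.
  rewrite -subr_ge0 (_ : _ - _ = (t - 1) * (K%:R * t - lam) / t); last by field; rewrite gt_eqF.
  apply: divr_ge0; last exact: ltW.
  apply: mulr_ge0; first lra.
  by rewrite subr_ge0 (le_trans lK)// ler_peMr// ltW.
move=> a' b' a'0 b'0; rewrite mul1r => ba.
apply: (@pattern_phase k ((lam + k%:R) * (1 - M^-1) / k%:R) 0 (fun t => t <= 1)) => //.
- exact: G.
- by move=> t t' t1 tt'; exact: le_trans tt' t1.
- move=> t t0 t1; rewrite [k%:R * (_ / _)]mulrC divfK ?gt_eqF//.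
  suff : lam + k%:R <= k%:R * t + lam / t by rewrite mulrBr mulr1; lra.
  rewrite -subr_ge0 (_ : _ - _ = (1 - t) * (lam - k%:R * t) / t); last by field; rewrite gt_eqF.
  apply: divr_ge0; last exact: ltW.
  apply: mulr_ge0; first lra.
  by rewrite subr_ge0 (le_trans _ kl)// ler_piMr// ltW.
- by move=> x y x0 y0; rewrite mul0r; lra.
- by rewrite ler_pdivrMr// mul1r.
Qed.

End pattern_existence.

(** * Truncated means and their tails *)

Section truncated_means.
Context {R : realType}.
Variables (mu : nat -> R) (m : R).
Hypothesis mu_ge0 : forall k, 0 <= mu k.
Hypothesis mu_sum : (fun n => \sum_(0 <= k < n) mu k) @ \oo --> (1 : R).
Hypothesis mu_mean : (fun n => \sum_(0 <= k < n) k%:R * mu k) @ \oo --> m.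

(* The summand is [mu ]max(i, D), oo[]; exchange the sums. *)
Lemma tail_mean_le (D N : nat) :
  \sum_(0 <= i < N) (1 - \sum_(0 <= k < (maxn i D).+1) mu k)
  <= m - \sum_(0 <= k < D.+1) k%:R * mu k.
Proof.
pose lhs n := \sum_(0 <= i < N) (\sum_(0 <= k < n) mu k - \sum_(0 <= k < (maxn i D).+1) mu k).
pose rhs n := \sum_(0 <= k < n) k%:R * mu k - \sum_(0 <= k < D.+1) k%:R * mu k.
have cl : lhs n @[n --> \oo] --> \sum_(0 <= i < N) (1 - \sum_(0 <= k < (maxn i D).+1) mu k).
  by apply: cvg_sum_seq => i; apply: cvgB => //; exact: cvg_cst.
have cr : rhs n @[n --> \oo] --> m - \sum_(0 <= k < D.+1) k%:R * mu k.
  by apply: cvgB => //; exact: cvg_cst.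
apply: (ler_cvg_to cl cr); near=> n.
have nN : (maxn N D < n)%N by near: n; exact: nbhs_infty_gt.
rewrite /lhs /rhs.
have split_sum (g : nat -> R) j : (j <= n)%N ->
    \sum_(0 <= k < n) g k - \sum_(0 <= k < j) g k = \sum_(0 <= k < n) (if (j <= k)%N then g k else 0).
  move=> jn; rewrite (big_cat_nat (leq0n j) jn) /= addrAC subrr add0r.
  rewrite [RHS](big_cat_nat (leq0n j) jn) /=.
  have -> : \sum_(0 <= k < j) (if (j <= k)%N then g k else 0) = 0.
    by rewrite big_nat big1// => k /andP[_ kj]; rewrite leqNgt kj.
  by rewrite add0r; apply: eq_big_nat => k /andP[-> _].
rewrite (eq_big_nat _ _ (F2 := fun i => \sum_(0 <= k < n) (if (maxn i D < k)%N then mu k else 0))); last first.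
  by move=> i /andP[_ iN]; rewrite split_sum//; lia.
rewrite split_sum; last by lia.
rewrite exchange_big /=; apply: ler_sum => k _.
case: ltnP => Dk; last first.
  rewrite big1// => i _; case: ltnP => //; lia.
rewrite (eq_bigr (fun i => if (i < k)%N then mu k else 0)); last by move=> i _;
  congr (if _ then _ else _); lia.
rewrite -big_mkcond /= big_const_seq iter_addr_0 -[_ *+ _]mulr_natl ler_wpM2r// ler_nat.
have [Nk|kN] := leqP N k.
  by rewrite (leq_trans (count_size _ _))// size_iota; lia.
rewrite /index_iota subn0 (_ : N = k + (N - k))%N ?iotaD ?count_cat; last by lia.
rewrite (leq_trans (leq_add (count_size _ _) (leqnn _)))// size_iota.
rewrite (eq_in_count (a2 := pred0)) ?count_pred0 ?addn0// => i.
by rewrite mem_iota /= => h; lia.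
Unshelve. all: by end_near. Qed.

Lemma trunc_mean_tails (D : nat) :
  trunc_mean mu D = \sum_(0 <= i < D) (1 - \sum_(0 <= k < i.+1) mu k).
Proof.
elim: D => [|D IH]; first by rewrite /trunc_mean big_nat1 mulr0 big_nil.
rewrite big_nat_recr//= -IH /trunc_mean !big_nat_recr//= [trunc_law mu D.+1 D.+1]/trunc_law ltnn.
rewrite [trunc_law mu D.+1 D]/trunc_law ltnSn [trunc_law mu D D]/trunc_law ltnn.
rewrite (eq_big_nat _ _ (F2 := fun i => trunc_law mu D i * i%:R)); last first.
  by move=> i /andP[_ iD]; rewrite /trunc_law iD (leqW iD).
rewrite -natr1; rewrite big_nat_recr//=; ring.
Qed.

Lemma trunc_mean_le (D : nat) : trunc_mean mu D <= m.
Proof.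
rewrite trunc_mean_tails; apply: le_trans (le_trans (tail_mean_le 0 D) _).
  by apply: ler_sum => i _; rewrite maxn0.
by rewrite big_nat1 mul0r subr0.
Qed.

Lemma trunc_mean_gt (c : R) : c < m -> exists2 D, (1 < D)%N & c < trunc_mean mu D.
Proof.
move=> cm; have /cvgrPdist_lt /(_ (m - c)) := mu_mean; rewrite subr_gt0 => /(_ cm)[n _ Hn].
exists n.+2 => //; have /= := Hn n.+2 (leqW (leqW (leqnn n))).
rewrite ltr_distlC => /andP[h _]; rewrite opprB addrC subrK in h.
apply: (lt_le_trans h); rewrite /trunc_mean [leRHS]big_nat_recr//=.
rewrite -[leLHS]addr0 lerD ?mulr_ge0 ?trunc_law_ge0//.
rewrite big_nat [leRHS]big_nat; apply: ler_sum => j /andP[_ jn].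
by rewrite /trunc_law jn mulrC.
Qed.

(** The sums are bounded by the part of the mean carried by values above [D]; for the environment
    this bounds the mean number of children at vertices of degree above [D]. *)
Lemma tail_mean_small (e : R) : 0 < e -> exists2 D, (1 < D)%N &
  forall N, \sum_(0 <= i < N) (1 - \sum_(0 <= k < (maxn i D).+1) mu k) <= e.
Proof.
move=> e0; have /cvgrPdist_lt /(_ e e0)[n _ Hn] := mu_mean.
exists n.+2 => // N; apply: le_trans (tail_mean_le _ _) _.
have /= := Hn n.+3 (leqW (leqW (leqW (leqnn n)))).
by rewrite ltr_norml => /andP[_ /ltW].
Qed.

End truncated_means.

(** * The random environment *)

Lemma cat_suffix_inj (T : Type) (a b u v : seq T) : u ++ a = v ++ b -> size a = size b -> a = b.
Proof.
move=> e s; have := congr1 (drop (size u)) e; rewrite drop_size_cat// => ->.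
have -> : size u = size v by move/(congr1 size): e; rewrite !size_cat; lia.
by rewrite drop_size_cat.
Qed.

Section environment.
Context {R : realType} {d : measure_display} {T : measurableType d}.
Variables (P : probability T R) (kappa : T -> seq nat -> nat) (p : nat -> R).
Hypothesis p_ge0 : forall k, 0 <= p k.
Hypothesis p_sum : (fun n => \sum_(0 <= k < n) p k) @ \oo --> (1 : R).
Hypothesis iid : iid_family P kappa p.

Let mk : forall v k, measurable [set w | kappa w v = k] := iid.1.
Notation det := (determined kappa).
Notation tail i := (1 - \sum_(0 <= k < i.+1) p k).

Let mdet S E : det S E -> measurable E. Proof. exact: (measurable_determined mk). Qed.

Lemma prob_env (S : seq (seq nat)) (k : seq nat -> nat) : uniq S ->
  prob P [set w | forall v, v \in S -> kappa w v = k v] = \prod_(v <- S) p (k v).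
Proof. by move=> uS; rewrite /prob iid.2. Qed.

(** On each cylinder over [S] the event prescribes all values on [F ++ undup S], and the product
    formula applies to these. *)
Lemma prob_env_indep S E F (g : seq nat -> nat) : det S E -> uniq F ->
  (forall v, v \in F -> v \notin S) ->
  prob P (E `&` [set w | forall v, v \in F -> kappa w v = g v]) =
  \prod_(v <- F) p (g v) * prob P E.
Proof.
move=> dE uF FS; pose k w v := if v \in F then g v else kappa w v.
have dF : det F [set w | forall v, v \in F -> kappa w v = g v].
  by move=> w w' /= h cw v vF; rewrite cw// h.
apply: (prob_determinedI mk dE); first exact: (mdet dF).
  by apply: prodr_ge0.
move=> w Ew.
have -> : cylinder kappa S w = [set w' | forall v, v \in undup S -> kappa w' v = kappa w v].
  by apply/seteqP; split => w' /= h v vS; apply: h; rewrite ?mem_undup// -mem_undup.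
have -> : [set w' | forall v, v \in undup S -> kappa w' v = kappa w v] `&`
    [set w | forall v, v \in F -> kappa w v = g v] =
    [set w' | forall v, v \in F ++ undup S -> kappa w' v = k w v].
  apply/seteqP; split => w' /=.
    move=> [h1 h2] v; rewrite mem_cat /k; case: ifP => vF /=; first by rewrite h2.
    exact: h1.
  move=> h; split => v vS.
    have := h v; rewrite mem_cat vS orbT /k => /(_ isT).
    by case: ifP => // /FS; rewrite -mem_undup vS.
  by have := h v; rewrite mem_cat vS /k vS; exact.
have uFS : uniq (F ++ undup S).
  rewrite cat_uniq uF undup_uniq andbT /=; apply/hasPn => v; rewrite mem_undup.
  by apply: contraL => /FS.
rewrite !prob_env ?undup_uniq// big_cat /=; congr (_ * _).
  by apply: eq_big_seq => v vF; rewrite /k vF.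
apply: eq_big_seq => v; rewrite mem_undup /k => vS; case: ifP => // /FS.
by rewrite vS.
Qed.

Lemma prob_env_eq S E u k : det S E -> u \notin S ->
  prob P (E `&` [set w | kappa w u = k]) = p k * prob P E.
Proof.
move=> dE uS; have := @prob_env_indep S E [:: u] (fun=> k) dE isT.
rewrite big_seq1 => <-; last by move=> v; rewrite inE => /eqP ->.
congr prob; congr (_ `&` _); apply/seteqP; split => w /=.
  by move=> kw v; rewrite inE => /eqP ->.
by apply; rewrite mem_head.
Qed.

Lemma prob_env_lt S E u n : det S E -> u \notin S ->
  prob P (E `&` [set w | (kappa w u < n)%N]) = (\sum_(0 <= k < n) p k) * prob P E.
Proof.
move=> dE uS; have mE := mdet dE.
elim: n => [|n IH].
  by rewrite big_nil mul0r (_ : _ `&` _ = set0) ?prob_set0// -subset0 => w [].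
have dlt : det [:: u] [set w | (kappa w u < n)%N].
  by move=> w w' /= h cw; rewrite cw ?mem_head.
rewrite big_nat_recr//= mulrDl -IH -(prob_env_eq n dE uS) -prob_setU.
- rewrite -setIUr; congr prob; congr (_ `&` _); apply/seteqP; split => w /=.
    by rewrite ltnS leq_eqVlt => /predU1P[->|]; [right|left].
  by case=> [|->]; lia.
- by apply: measurableI => //; exact: (mdet dlt).
- by apply: measurableI => //; exact: mk.
- by rewrite -subset0 => w [[_ /= h] [_ /= e]]; rewrite e ltnn in h.
Qed.

Lemma prob_env_gt S E u n : det S E -> u \notin S ->
  prob P (E `&` [set w | (n < kappa w u)%N]) = tail n * prob P E.
Proof.
move=> dE uS; have mE := mdet dE.
have dlt : det [:: u] [set w | (kappa w u < n.+1)%N].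
  by move=> w w' /= h cw; rewrite cw ?mem_head.
rewrite (_ : [set w | (n < kappa w u)%N] = ~` [set w | (kappa w u < n.+1)%N]); last first.
  by apply/seteqP; split => w /=; lia.
by rewrite prob_setIDC ?(prob_env_lt n.+1 dE uS) ?mulrBl ?mul1r//; exact: (mdet dlt).
Qed.

Lemma tail_ge0 i : 0 <= tail i.
Proof. by rewrite subr_ge0 psum_le. Qed.

Lemma env_support : {ae P, forall w, forall v, 0 < p (kappa w v)}.
Proof.
pose A (v : seq nat * nat) : set T := if p v.2 == 0 then [set w | kappa w v.1 = v.2] else set0.
exists (\bigcup_n (if @unpickle (seq nat * nat)%type n is Some v then A v else set0)).
have mA n : measurable (if @unpickle (seq nat * nat)%type n is Some v then A v else set0).
  by case: (@unpickle (seq nat * nat)%type n) => // v; rewrite /A; case: ifP.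
split; first exact: bigcup_measurable.
  rewrite probE; last exact: bigcup_measurable.
  congr EFin; apply: (prob_bigcup_null (bigcup_measurable (fun n _ => mA n)) mA) => //.
  move=> n; case: (@unpickle (seq nat * nat)%type n) => [v|]; last exact: prob_set0.
  rewrite /A; case: eqP => [pv|_]; last exact: prob_set0.
  by rewrite -(setTI [set w | _]) (@prob_env_eq [::] setT v.1 v.2)// pv mul0r.
move=> w /= /existsNP[v /negP]; rewrite lt0r p_ge0 andbT negbK => pv.
by exists (pickle (v, kappa w v)) => //; rewrite pickleK /A /= pv.
Qed.

(** * Bad paths are almost surely finite *)

Section bad_paths.
Variables (deg : nat -> nat) (H J M : nat).
(** Room for [J] trials for a good top on a first-child line, one every [H.+1] levels, so that the
    candidate copies use disjoint words and are independent. *)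
Let L := (J * H.+1)%N.
Notation pat := (pat_words deg H).

Definition pat_prob : R := \prod_(y <- pat) p (deg (size y)).
Let dl := pat_prob.

Let good z := [set w | good_top deg H (kappa w) z].

Let good_words z := [seq y ++ z | y <- pat].

Let det_good z : det (good_words z) (good z).
Proof.
move=> w w' /allP gw cw; apply/allP => y yp; rewrite cw ?gw//.
by apply/mapP; exists y.
Qed.

Lemma prob_good S E z : det S E -> (forall v, v ++ z \notin S) ->
  prob P (E `&` good z) = dl * prob P E.
Proof.
move=> dE zS; rewrite /dl /pat_prob.
have -> : good z = [set w | forall v, v \in good_words z -> kappa w v = deg (size v - size z)].
  apply/seteqP; split => w /=.
    by move=> /allP gw _ /mapP[y yp ->]; rewrite size_cat addnK; apply/eqP/gw.
  by move=> h; apply/allP => y yp; rewrite h ?size_cat ?addnK//; apply/mapP; exists y.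
rewrite (prob_env_indep (fun v => deg (size v - size z)) dE).
- by rewrite big_map; congr (_ * _); apply: eq_bigr => y _; rewrite size_cat addnK.
- rewrite map_inj_in_uniq ?pat_words_uniq// => y y' _ _ /eqP.
  have [ss|ss] := eqVneq (size y) (size y'); first by rewrite eqseq_cat// => /andP[/eqP].
  by move=> /eqP/(congr1 size); rewrite !size_cat => /addIn /eqP; rewrite (negbTE ss).
- by move=> _ /mapP[y yp ->].
Qed.

(** Bounds the probability of not being aided: some degree above [M] among the [L] vertices of the
    line, or failure of all [J] trials. *)
Let theta : R := L%:R * tail M + (1 - dl) ^+ J.

Lemma pat_prob_le1 : dl <= 1.
Proof.
have := @prob_good [::] setT [::] (fun w w' _ _ => I) (fun=> isT).
by rewrite prob_setT mulr1 setTI => <-; apply: prob_le1; exact: (mdet (@det_good [::])).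
Qed.

(** After [n] trials only words fewer than [n * H.+1] levels below [b] have been added to [S], so
    the subtree at the next candidate top is still unexplored. *)
Lemma prob_no_good S E b n : det S E -> (forall v, v ++ b \notin S) ->
  exists2 S', forall v, v \in S' -> v \in S \/ exists2 y, v = y ++ b & (size y < n * H.+1)%N &
  det S' (E `&` [set w | forall j, (j < n)%N -> ~ good (nseq (j * H.+1) 0%N ++ b) w]) /\
  prob P (E `&` [set w | forall j, (j < n)%N -> ~ good (nseq (j * H.+1) 0%N ++ b) w])
  <= (1 - dl) ^+ n * prob P E.
Proof.
move=> dE bS; elim: n => [|n [S' hS' [dS' pS']]].
  exists S; first by left.
  rewrite (_ : [set w | _] = setT) ?setIT ?expr0 ?mul1r; first by split.
  by apply/seteqP; split.
set A := [set w | _] in dS' pS'; set z := nseq (n * H.+1) 0%N ++ b.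
have -> : [set w | forall j, (j < n.+1)%N -> ~ good (nseq (j * H.+1) 0%N ++ b) w] = A `&` ~` good z.
  apply/seteqP; split => w /=.
    by move=> h; split=> [j jn|]; apply: h => //; lia.
  by move=> [h1 h2] j; rewrite ltnS leq_eqVlt => /predU1P[->//|/h1].
rewrite setIA.
have zS' v : v ++ z \notin S'.
  apply/negP => /hS'[|[y]]; first by rewrite /z catA (negbTE (bS _)).
  by move=> /(congr1 size); rewrite !size_cat size_nseq; lia.
exists (good_words z ++ S').
  move=> v; rewrite mem_cat => /orP[/mapP[y yp ->]|/hS'[vS|[y -> ys]]].
  - right; exists (y ++ nseq (n * H.+1) 0%N); first by rewrite catA.
    rewrite size_cat size_nseq; move: yp; rewrite mem_pat_words => /andP[yH _].
    by rewrite mulSn; lia.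
  - by left.
  - by right; exists y => //; rewrite mulSn; lia.
have mg : measurable (good z) by exact: (mdet (@det_good z)).
split.
  apply: determinedI; first by apply: sub_determined dS' => v vS; rewrite mem_cat vS orbT.
  apply: determinedC; apply: (sub_determined _ (@det_good z)) => v vS.
  by rewrite mem_cat vS.
rewrite prob_setIDC//; last exact: (mdet dS').
rewrite (prob_good dS' zS') exprS -mulrA -{1}[prob P (E `&` A)]mul1r -mulrBl.
by rewrite ler_wpM2l// subr_ge0 pat_prob_le1.
Qed.

Let aid b := [set w | aided deg H L M (kappa w) b].

Let aid_words b := [seq nseq l 0%N ++ b | l <- iota 0 L] ++
  flatten [seq good_words (nseq l 0%N ++ b) | l <- iota 0 L].

Let aid_wordsP b v : v \in aid_words b -> exists y, v = y ++ b.
Proof.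
rewrite mem_cat => /orP[/mapP[l _ ->]|/flattenP[s /mapP[l _ ->] /mapP[y _ ->]]].
  by exists (nseq l 0%N).
by exists (y ++ nseq l 0%N); rewrite catA.
Qed.

Let det_aid b : det (aid_words b) (aid b).
Proof.
move=> w w' /andP[/hasP[l lL gl] /allP h] cw; apply/andP; split.
  apply/hasP; exists l => //; apply: (det_good gl) => v vl; apply: cw.
  rewrite mem_cat; apply/orP; right; apply/flattenP; exists (good_words (nseq l 0%N ++ b)) => //.
  by apply/mapP; exists l.
apply/allP => k kL; rewrite cw; first exact: h.
by rewrite mem_cat; apply/orP; left; apply/mapP; exists k.
Qed.

Lemma prob_not_aided S E b : det S E -> (forall v, v ++ b \notin S) ->
  prob P (E `&` ~` aid b) <= theta * prob P E.
Proof.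
move=> dE bS; have mE := mdet dE.
have [S' hS' [dS' pS']] := @prob_no_good S E b J dE bS.
set A := E `&` [set w | forall j, _] in dS' pS'.
pose B l := E `&` [set w | (M < kappa w (nseq l 0%N ++ b))%N].
have dB l : det ((nseq l 0%N ++ b) :: S) (B l).
  apply: determinedI; first by apply: sub_determined dE => v vS; rewrite inE vS orbT.
  by move=> w w' /= h cw; rewrite cw ?mem_head.
have mB l : measurable (B l) by exact: (mdet (dB l)).
have mU : measurable (E `&` [set w | exists2 l, l \in iota 0 L & B l w]).
  rewrite (_ : _ `&` _ = \bigcup_(l in [set l | l \in iota 0 L]) B l).
    by apply: bigcup_measurable.
  by apply/seteqP; split => w; [move=> [Ew [l lL Bl]]; exists l|move=> [l lL Bl]; split; [case: Bl|exists l]].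
have mA : measurable A by exact: (mdet dS').
apply: (@le_trans _ _ (prob P ((E `&` [set w | exists2 l, l \in iota 0 L & B l w]) `|` A))).
  apply: prob_mono.
  - by apply: measurableI => //; apply: measurableC; exact: (mdet (@det_aid b)).
  - exact: measurableU.
  - move=> w [Ew naid].
    have [h|h] := pselect (exists2 l, l \in iota 0 L & B l w); [left|right] => //.
    split => // j jJ /= gj; apply: naid; apply/andP; split.
      apply/hasP; exists (j * H.+1)%N => //; rewrite mem_iota /L; nia.
    apply/allP => l lL; rewrite leqNgt; apply/negP => Ml; apply: h; exists l => //.
apply: le_trans (prob_setU_le _ mU mA) _; rewrite /theta mulrDl; apply: lerD => //.
apply: (@le_trans _ _ (\sum_(l <- iota 0 L) prob P (B l))).
  by apply: prob_has_le => // w [].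
rewrite (eq_bigr (fun=> tail M * prob P E)); last first.
  by move=> l _; rewrite /B (prob_env_gt M dE).
by rewrite big_const_seq count_predT size_iota iter_addr_0 -[_ *+ _]mulr_natl mulrA.
Qed.

(** The ways for child [i] to exist and be bad: it is an only child, hence without sibling; its
    parent has degree above [M]; its examined sibling is not aided. Summed over [i], these give
    [p 1], a tail of the mean, and at most the mean times [theta]. *)
Let step_cost i : R := (i == 0%N)%:R * p 1%N + tail (maxn i M) + tail i * theta.

Let step i z := [set w | (i < kappa w z)%N && bad_step deg H L M (kappa w) z i].

Let step_words i z := z :: aid_words (nat_of_bool (i == 0%N) :: z).

Let det_step i z : det (step_words i z) (step i z).
Proof.
move=> w w' /= /andP[iz bi] cw; have kz := cw z (mem_head _ _).
rewrite /step /= /bad_step !kz iz /=; move: bi; rewrite /bad_step.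
apply: contra => /and3P[-> -> ai] /=; apply: (det_aid ai) => v vS.
by rewrite cw// inE vS orbT.
Qed.

Lemma prob_bad_step S E z i : p 0%N = 0 -> det S E -> (forall v, v ++ z \notin S) ->
  prob P (E `&` step i z) <= step_cost i * prob P E.
Proof.
move=> p0 dE zS; have mE := mdet dE; set b := nat_of_bool (i == 0%N) :: z.
have zS0 : z \notin S by exact: (zS [::]).
have mst : measurable (step i z) by exact: (mdet (@det_step i z)).
pose A0 := E `&` [set w | kappa w z = 0%N].
pose A1 := if i == 0%N then E `&` [set w | kappa w z = 1%N] else set0.
pose A2 := E `&` [set w | (maxn i M < kappa w z)%N].
pose Ei := E `&` [set w | (i < kappa w z)%N].
pose A3 := Ei `&` ~` aid b.
have dEi : det (z :: S) Ei.
  apply: determinedI; first by apply: sub_determined dE => v vS; rewrite inE vS orbT.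
  by move=> w w' /= h cw; rewrite cw ?mem_head.
have dA2 : det (z :: S) A2.
  apply: determinedI; first by apply: sub_determined dE => v vS; rewrite inE vS orbT.
  by move=> w w' /= h cw; rewrite cw ?mem_head.
have mA0 : measurable A0 by exact: measurableI.
have mA1 : measurable A1 by rewrite /A1; case: ifP => // _; exact: measurableI.
have mA2 : measurable A2 by exact: (mdet dA2).
have mA3 : measurable A3.
  by apply: measurableI; [exact: (mdet dEi)|apply: measurableC; exact: (mdet (@det_aid b))].
have bS v : v ++ b \notin z :: S.
  rewrite inE negb_or; apply/andP; split.
    by apply/eqP => /(congr1 size); rewrite size_cat /=; lia.
  by rewrite /b -cat_rcons.
have P0 : prob P A0 = 0 by rewrite /A0 (prob_env_eq 0%N dE)// p0 mul0r.
have P1 : prob P A1 <= (i == 0%N)%:R * p 1%N * prob P E.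
  rewrite /A1; case: ifP => _; last by rewrite prob_set0 !mul0r.
  by rewrite mul1r (prob_env_eq 1%N dE).
have P2 : prob P A2 = tail (maxn i M) * prob P E by rewrite /A2 (prob_env_gt _ dE).
have P3 : prob P A3 <= tail i * theta * prob P E.
  apply: le_trans (prob_not_aided dEi bS) _.
  by rewrite /Ei (prob_env_gt _ dE)// mulrA [theta * _]mulrC.
apply: (@le_trans _ _ (prob P (A0 `|` (A1 `|` (A2 `|` A3))))).
  apply: prob_mono => //; first exact: measurableI.
    by do 3 (apply: measurableU => //).
  move=> w [Ew /andP[iz]]; rewrite /bad_step 2!negb_and => /or3P[k1|k2|na].
  - have [k0|k0] := posnP (kappa w z); first by left.
    have i0 : i = 0%N by lia.
    by right; left; rewrite /A1 i0 eqxx; split => //=; lia.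
  - by right; right; left; split => //=; lia.
  - by right; right; right; split; [exact: conj Ew iz|exact: (elimN idP na)].
have mA23 := measurableU _ _ mA2 mA3; have mA123 := measurableU _ _ mA1 mA23.
apply: le_trans (prob_setU_le _ mA0 mA123) _; rewrite P0 add0r.
apply: le_trans (prob_setU_le _ mA1 mA23) _.
rewrite (_ : step_cost i * _ = (i == 0%N)%:R * p 1%N * prob P E +
  (tail (maxn i M) * prob P E + tail i * theta * prob P E)); last by rewrite /step_cost; ring.
apply: lerD => //.
apply: le_trans (prob_setU_le _ mA2 mA3) _.
by rewrite P2; apply: lerD.
Qed.

Let path N n z := [set w | bad_path deg H L M (kappa w) N n z].

Let pathS N n z : path N n.+1 z =
  \bigcup_(i in [set i | i \in iota 0 N]) (step i z `&` path N n (i :: z)).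
Proof.
apply/seteqP; split => w.
  move=> /= /hasP[i]; rewrite mem_iota => iN /andP[bi bp]; exists i => /=; last first.
    by split; rewrite /step//= bi andbT; lia.
  by rewrite mem_iota; lia.
move=> [i /=]; rewrite mem_iota => iN [/andP[iz bi] bp]; apply/hasP; exists i.
  by rewrite mem_iota; lia.
by rewrite bi.
Qed.

Lemma measurable_bad_path N n z : measurable (path N n z).
Proof.
elim: n z => [|n IH] z.
  by rewrite (_ : path N 0 z = setT)//; apply/seteqP; split.
rewrite pathS; apply: bigcup_measurable => i _; apply: measurableI => //.
exact: (mdet (@det_step i z)).
Qed.

(** First-moment bound as for a subcritical branching process: a step looks at [z] and at words
    below a sibling of [i :: z], never below [i :: z] itself, so successive steps multiply. *)
Lemma prob_bad_path (c : R) N n S E z : p 0%N = 0 -> 0 <= c ->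
  \sum_(0 <= i < N) step_cost i <= c ->
  det S E -> (forall v, v ++ z \notin S) ->
  prob P (E `&` path N n z) <= c ^+ n * prob P E.
Proof.
move=> p0 c0 Hc; elim: n S E z => [|n IH] S E z dE zS; have mE := mdet dE.
  rewrite expr0 mul1r; apply: prob_mono => //.
  by apply: measurableI => //; exact: measurable_bad_path.
have mst i : measurable (step i z) by exact: (mdet (@det_step i z)).
apply: (@le_trans _ _ (\sum_(i <- index_iota 0 N) prob P (E `&` step i z `&` path N n (i :: z)))).
  apply: prob_has_le.
  - by apply: measurableI => //; exact: measurable_bad_path.
  - by move=> i; apply: measurableI; [exact: measurableI|exact: measurable_bad_path].
  - rewrite pathS => w [Ew [i /= iN [si pi]]]; exists i => //.
    by rewrite /index_iota subn0.
apply: (@le_trans _ _ (\sum_(0 <= i < N) c ^+ n * (step_cost i * prob P E))); last first.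
  rewrite -mulr_sumr -mulr_suml exprSr -mulrA ler_wpM2l ?exprn_ge0//.
  by rewrite ler_wpM2r ?prob_ge0.
apply: ler_sum => i _.
apply: (@le_trans _ _ (c ^+ n * prob P (E `&` step i z))); last first.
  by rewrite ler_wpM2l ?exprn_ge0// (prob_bad_step _ p0 dE).
apply: (IH (step_words i z ++ S)).
  apply: determinedI; first by apply: sub_determined dE => v vS; rewrite mem_cat vS orbT.
  by apply: (sub_determined _ (@det_step i z)) => v vS; rewrite mem_cat vS.
move=> v; rewrite mem_cat negb_or -cat_rcons zS andbT inE negb_or; apply/andP; split.
  by apply/eqP => /(congr1 size); rewrite size_cat size_rcons; lia.
(* A common word would identify [i :: z] with the examined sibling, that is [i = (i == 0)], which
   holds for no [i]. *)
rewrite cat_rcons; apply/negP => /aid_wordsP[y e].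
by have [] := cat_suffix_inj e erefl; case: (i) => [|[|]].
Qed.

Lemma ae_bad_path_finite (c : R) : p 0%N = 0 -> 0 <= c < 1 ->
  (forall N, \sum_(0 <= i < N) step_cost i <= c) ->
  {ae P, forall w, forall z, exists n, forall N, ~~ bad_path deg H L M (kappa w) N n z}.
Proof.
move=> p0 /andP[c0 c1] Hc.
pose B z := \bigcap_n \bigcup_N path N n z.
have mU n z : measurable (\bigcup_N path N n z).
  by apply: bigcup_measurable => N _; exact: measurable_bad_path.
have mB z : measurable (B z) by apply: bigcap_measurable => [|n _]; [exists 0%N|exact: mU].
have PB z : prob P (B z) = 0.
  apply/eqP; rewrite eq_le prob_ge0 andbT; apply/ler_addgt0Pr => e e0; rewrite add0r.
  have [n cn] := expr_small (t := c) (introT andP (conj c0 c1)) e0.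
  apply: le_trans cn; apply: (@le_trans _ _ (prob P (\bigcup_N path N n z))).
    by apply: prob_mono => // w; exact.
  apply: prob_bigcup_ndecr_le.
  - by move=> N; exact: measurable_bad_path.
  - by move=> N N' NN' w /=; exact: leq_bad_path.
  - move=> N; have := @prob_bad_path c N n [::] setT z p0 c0 (Hc N) (fun w w' _ _ => I) (fun=> isT).
    by rewrite setTI prob_setT mulr1.
pose BU := \bigcup_k (if @unpickle (seq nat) k is Some z then B z else set0).
have mBk k : measurable (if @unpickle (seq nat) k is Some z then B z else set0).
  by move: (@unpickle (seq nat) k) => [z|].
exists BU; split; first exact: bigcup_measurable.
  rewrite probE; last exact: bigcup_measurable.
  have PBk k : prob P (if @unpickle (seq nat) k is Some z then B z else set0) = 0.
    by move: (@unpickle (seq nat) k) => [z|]; [exact: PB|exact: prob_set0].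
  congr EFin; apply: (prob_bigcup_null (bigcup_measurable (fun n _ => mBk n)) mBk PBk).
  exact: subset_refl.
move=> w /= /existsNP[z hz]; exists (pickle z) => //; rewrite pickleK => n _.
move/forallNP : hz => /(_ n) /existsNP[N /negP]; rewrite negbK => bN.
by exists N.
Qed.

End bad_paths.

(* The mean number of bad children of a vertex tends to [p 1] when the number [J] of trials for
   a good top along the first-child line and then the degree bound [M] tend to infinity. *)
Lemma exists_bad_path_finite (deg : nat -> nat) (H : nat) (mB : R) :
  p 0%N = 0 -> p 1%N < 1 -> (fun n => \sum_(0 <= k < n) k%:R * p k) @ \oo --> mB ->
  (forall k, (k <= H)%N -> 0 < p (deg k)) ->
  exists L M, {ae P, forall w, forall z, exists n, forall N,
    ~~ bad_path deg H L M (kappa w) N n z}.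
Proof.
move=> p0 p1 pm pdeg.
pose dl := pat_prob deg H.
have dl0 : 0 < dl.
  rewrite /dl /pat_prob big_seq; apply: prodr_gt0 => y; rewrite mem_pat_words => /andP[yH _].
  exact: pdeg.
have dl1 : dl <= 1 by exact: pat_prob_le1.
have mB0 : 0 <= mB.
  by have := psum_le (fun k => mulr_ge0 (ler0n _ k) (p_ge0 k)) pm 0; rewrite big_nil.
(* The three costs will sum to at most [p 1 + eta + 2 * eta < 1]. *)
pose eta := (1 - p 1%N) / 4.
have eta0 : 0 < eta by rewrite /eta; lra.
have q0 : 0 < eta / (mB + 1) by rewrite divr_gt0//; lra.
have [J HJ] := expr_small (t := 1 - dl) (e := eta / (mB + 1)) ltac:(apply/andP; split; lra) q0.
pose L := (J * H.+1)%N.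
(* Two demands on [M]: the tail of the mean is at most [eta], and [L * tail M] is at most
   [eta / (mB + 1)]. The second involves [L], so [M] is chosen after [J]. *)
pose e := Num.min eta (eta / (mB + 1) / L.+1%:R).
have e0 : 0 < e by rewrite lt_min eta0 divr_gt0.
have [M M1 HM] := tail_mean_small p_ge0 p_sum pm e0.
exists L, M.
pose theta : R := L%:R * tail M + (1 - dl) ^+ J.
have tM : tail M <= e by have := HM 1%N; rewrite big_nat1 max0n.
have th0 : 0 <= theta.
  by rewrite addr_ge0 ?mulr_ge0 ?tail_ge0// exprn_ge0//; lra.
have th : theta <= 2 * (eta / (mB + 1)).
  have : L%:R * tail M <= eta / (mB + 1).
    apply: (@le_trans _ _ (L.+1%:R * e)).
      by apply: ler_pM => //; [exact: tail_ge0|rewrite ler_nat].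
    by rewrite mulrC -ler_pdivlMr// ge_min lexx orbT.
  rewrite /theta; lra.
apply: (@ae_bad_path_finite deg H J M (p 1%N + 3 * eta)) => //.
  by have := p_ge0 1%N; move: eta0 p1; rewrite /eta => *; apply/andP; split; lra.
move=> N; rewrite big_split big_split /=.
have S1 : \sum_(0 <= i < N) (i == 0%N)%:R * p 1%N <= p 1%N.
  case: N => [|N]; first by rewrite big_nil.
  by rewrite big_nat_recl//= mul1r big1 ?addr0// => i _; rewrite mul0r.
have S2 : \sum_(0 <= i < N) tail (maxn i M) <= eta.
  by apply: le_trans (HM N) _; rewrite ge_min lexx.
have S3 : (\sum_(0 <= i < N) tail i) * theta <= 2 * eta.
  apply: (@le_trans _ _ (mB * (2 * (eta / (mB + 1))))).
    apply: ler_pM => //; first by apply: sumr_ge0 => i _; exact: tail_ge0.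
    have := tail_mean_le p_ge0 p_sum pm 0 N; rewrite big_nat1 mul0r subr0.
    by under eq_bigr do rewrite maxn0.
  rewrite mulrCA ler_pM2l// mulrA ler_pdivrMr; last lra.
  by rewrite mulrC ler_pM2l//; lra.
rewrite mulr_suml in S3; apply: le_trans (lerD (lerD S1 S2) S3) _; lra.
Qed.

End environment.

(** * Existence of the branching random walk *)

Lemma uniform_prob_itv {R : realType} (a b : R) : 0 <= a -> a <= b -> b <= 1 ->
  uniform_prob (@ltr01 R) `[a, b[%classic = (b - a)%:E.
Proof.
move=> a0 ab b1; rewrite /uniform_prob (eq_integral (fun=> 1%E)); last first.
  move=> x; rewrite inE /= in_itv /= /uniform_pdf => /andP[ax xb].
  by rewrite (le_trans a0 ax) (le_trans (ltW xb) b1) subr0 invr1.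
rewrite integral_cst//= mul1e lebesgue_measure_itv /= lte_fin.
case: ltP => [_|ba]; first by rewrite EFinB.
by have -> : a = b by [apply/eqP; rewrite eq_le ab ba]; rewrite subrr.
Qed.

(** * Independent discrete variables on the unit interval *)

Section discrete_sequence.
Context {R : realType}.
Variable q : nat -> nat -> R.
Hypothesis q_ge0 : forall n k, 0 <= q n k.
Hypothesis q_sum : forall n, (fun N => \sum_(0 <= k < N) q n k) @ \oo --> (1 : R).

Let cum n k : R := \sum_(0 <= j < k) q n j.
(** Cut [[0, 1[] into pieces of lengths [q n k]: the variable is the index of the piece containing
    [t], and [next] rescales that piece to [[0, 1[] for the following variable. *)
Let cell n (t : R) := [set k : nat | cum n k <= t < cum n k.+1].
Let pick n (t : R) : nat := get (cell n t).
Let next n (t : R) : R := (t - cum n (pick n t)) / q n (pick n t).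
Let pos (t : R) : nat -> R := fix pos n := if n is n'.+1 then next n' (pos n') else t.

Let cum_ge0 n k : 0 <= cum n k. Proof. exact: sumr_ge0. Qed.

Let cum_le1 n k : cum n k <= 1. Proof. exact: psum_le. Qed.

Let cumS n k : cum n k.+1 = cum n k + q n k. Proof. by rewrite /cum big_nat_recr. Qed.

Let le_cum n k k' : (k <= k')%N -> cum n k <= cum n k'.
Proof.
by move=> kk'; rewrite /cum [leRHS](big_cat_nat (leq0n k) kk')/= lerDl sumr_ge0.
Qed.

Let cell_uniq n (t : R) k k' : cell n t k -> cell n t k' -> k = k'.
Proof.
move=> /andP[h1 h2] /andP[h3 h4]; have [kk'|kk'|//] := ltngtP k k'.
  by exfalso; have := le_cum n kk'; lra.
by exfalso; have := le_cum n kk'; lra.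
Qed.

Let pick_cell n (t : R) : 0 <= t < 1 -> cell n t (pick n t).
Proof.
move=> /andP[t0 t1].
have ex : exists k, t < cum n k.
  have /cvgrPdist_lt /(_ (1 - t)) := q_sum n; rewrite subr_gt0 => /(_ t1)[k _ /(_ k (leqnn k))] /=.
  by rewrite ltr_norml => /andP[_ h]; exists k; rewrite /cum; lra.
have [k kt kmin] := ex_minnP ex.
suff : cell n t k.-1 by move=> h; exact: (@getI _ _ k.-1).
case: k kt kmin => [|k] kt kmin; first by move: kt; rewrite /cum big_nil; lra.
apply/andP; split => //=; rewrite leNgt; apply/negP => /kmin; lia.
Qed.

Let pickE n (t : R) k : 0 <= t < 1 -> pick n t = k <-> cell n t k.
Proof.
move=> t01; split=> [<-|]; first exact: pick_cell.
by apply: cell_uniq; exact: pick_cell.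
Qed.

Let q_pick n (t : R) : 0 <= t < 1 -> 0 < q n (pick n t).
Proof. by move=> /(pick_cell n)/andP[]; rewrite cumS; lra. Qed.

Let pos01 (t : R) n : 0 <= t < 1 -> 0 <= pos t n < 1.
Proof.
move=> t01; elim: n => [//|n IH] /=; have q0 := q_pick n IH.
have /andP[h1 h2] := pick_cell n IH; rewrite cumS in h2.
by rewrite /next divr_ge0 ?subr_ge0 ?(ltW q0)//= ltr_pdivrMr// mul1r; lra.
Qed.

Let width (k : nat -> nat) N := \prod_(0 <= n < N) q n (k n).

Let left_end (k : nat -> nat) := fix lo N :=
  if N is n.+1 then lo n + width k n * cum n (k n) else 0.

Let width_ge0 k N : 0 <= width k N. Proof. exact: prodr_ge0. Qed.

Let widthS k N : width k N.+1 = width k N * q N (k N).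
Proof. by rewrite /width big_nat_recr. Qed.

Let left_end_bounds k N : 0 <= left_end k N /\ left_end k N + width k N <= 1.
Proof.
elim: N => [|N [h1 h2]] /=; first by rewrite /width big_nil add0r.
split; first by rewrite addr_ge0// mulr_ge0.
rewrite widthS -addrA -mulrDr -cumS (le_trans _ h2)// lerD2l.
by rewrite ler_piMr.
Qed.

(** Prescribing the first [N] indices leaves an interval whose length is the product of the weights.
    The induction must also carry that [pos t N] is the affine rescaling of [t] on it. *)
Let prefixE k N (t : R) : 0 <= t < 1 ->
  (forall n, (n < N)%N -> pick n (pos t n) = k n) <->
  (left_end k N <= t < left_end k N + width k N).
Proof.
move=> t01.
suff : ((forall n, (n < N)%N -> pick n (pos t n) = k n) <->
  (left_end k N <= t < left_end k N + width k N)) /\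
  ((forall n, (n < N)%N -> pick n (pos t n) = k n) -> pos t N = (t - left_end k N) / width k N).
  by case.
elim: N => [|N [IH1 IH2]].
  by rewrite /width big_nil /= add0r subr0 divr1; split => //; split.
have pN : (forall n, (n < N.+1)%N -> pick n (pos t n) = k n) ->
  (forall n, (n < N)%N -> pick n (pos t n) = k n) /\ pick N (pos t N) = k N.
  by move=> h; split=> [n nN|]; apply: h => //; exact: leqW.
have t2 : left_end k N.+1 <= t < left_end k N.+1 + width k N.+1 ->
  left_end k N <= t < left_end k N + width k N.
  rewrite /= widthS -addrA -mulrDr -cumS => /andP[h1 h2].
  have a1 : 0 <= width k N * cum N (k N) by rewrite mulr_ge0.
  have a2 : width k N * cum N (k N).+1 <= width k N by rewrite ler_piMr.
  by apply/andP; split; lra.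
have cellE : 0 < width k N -> pos t N = (t - left_end k N) / width k N ->
  cell N (pos t N) (k N) <-> left_end k N.+1 <= t < left_end k N.+1 + width k N.+1.
  move=> w0 ->; rewrite /cell /= ler_pdivlMr// ltr_pdivrMr// lerBrDl ltrBlDl.
  by rewrite widthS -addrA -mulrDr -cumS !(mulrC (width k N)).
split; last first.
  move=> /pN[h1 h2]; have e := IH2 h1; have /IH1 /andP[l1 l2] := h1.
  have w0 : 0 < width k N by lra.
  have qk : 0 < q N (k N) by rewrite -h2; apply: q_pick; exact: pos01.
  rewrite /= /next h2 e widthS; field.
  by rewrite !gt_eqF.
split.
  move=> /pN[h1 h2]; have e := IH2 h1; have /IH1 /andP[l1 l2] := h1.
  have w0 : 0 < width k N by lra.
  by apply/cellE => //; apply/pickE => //; exact: pos01.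
move=> h; have h0 := t2 h; have /IH1 h1 := h0; have e := IH2 h1.
have w0 : 0 < width k N by case/andP: h0; lra.
move=> n; rewrite ltnS leq_eqVlt => /predU1P[->|/h1//].
by apply/pickE; [exact: pos01|apply/cellE].
Qed.

(** Sends points outside [[0, 1[] to 0, so that a value of weight 0 is never taken, and not merely
    almost never. *)
Let clip (w : R) := if 0 <= w < 1 then w else 0.
Let xi (w : R) n := pick n (pos (clip w) n).

Let clip01 w : 0 <= clip w < 1.
Proof. by rewrite /clip; case: ifP => // _; rewrite lexx ltr01. Qed.

Let Q : probability _ R := uniform_prob (@ltr01 R).

Let prefix k N := [set w | forall n, (n < N)%N -> xi w n = k n].

Let prefixI k N : prefix k N `&` `[0, 1[ =
  `[left_end k N, (left_end k N + width k N)[%classic.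
Proof.
have [l0 l1] := left_end_bounds k N.
apply/seteqP; split => w /=; rewrite !in_itv /=.
  move=> [h w01]; apply/(prefixE _ _ w01) => n nN; have := h n nN.
  by rewrite /xi (_ : clip w = w)// /clip w01.
move=> /andP[h1 h2]; have w01 : 0 <= w < 1 by apply/andP; split; lra.
have cw : clip w = w by rewrite /clip w01.
split => // n nN; rewrite /xi cw; move: n nN.
by apply/(prefixE _ _ w01); rewrite h1 h2.
Qed.

Let measurable_prefix k N : measurable (prefix k N).
Proof.
have m01 : measurable (`[0, 1[%classic : set R) by exact: measurable_itv.
rewrite -(setIT (prefix k N)) -(setUv (`[0, 1[%classic : set R)) setIUr prefixI.
apply: measurableU; first exact: measurable_itv.
have [h|h] := pselect (prefix k N 0).
  rewrite (_ : _ `&` _ = ~` `[0, 1[%classic); first exact: measurableC.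
  apply/seteqP; split => w; first by case.
  move=> nw; split => //= n nN; have := h n nN; rewrite /xi.
  suff -> : clip w = clip 0 by [].
  rewrite /clip lexx ltr01; by case: ifP => // w01; exfalso; apply: nw.
rewrite (_ : _ `&` _ = set0)// -subset0 => w [hw nw]; apply: h => n nN.
have := hw n nN; rewrite /xi; suff -> : clip w = clip 0 by [].
rewrite /clip lexx ltr01; by case: ifP => // w01; exfalso; apply: nw.
Qed.

Let prob_itv (a b : R) : 0 <= a -> a <= b -> b <= 1 -> prob Q `[a, b[%classic = b - a.
Proof.
move=> a0 ab b1; rewrite /prob -[RHS]/(fine (b - a)%:E); congr fine.
exact: uniform_prob_itv.
Qed.

Let prob_prefix k N : prob Q (prefix k N) = \prod_(0 <= n < N) q n (k n).
Proof.
have m01 : measurable (`[0, 1[%classic : set R) by exact: measurable_itv.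
have [l0 l1] := left_end_bounds k N.
have Q01 : prob Q (~` `[0, 1[%classic) = 0.
  have := prob_setIDC Q measurableT m01; rewrite !setTI prob_setT => ->.
  by rewrite prob_itv//= subr0 subrr.
have mC := measurableC m01.
have mp := measurable_prefix k N.
rewrite -(setIT (prefix k N)) -(setUv (`[0, 1[%classic : set R)) setIUr prob_setU.
- rewrite prefixI [X in _ + X](_ : _ = 0) ?addr0.
    by rewrite prob_itv//= ?lerDl// addrAC subrr add0r.
  apply/eqP; rewrite eq_le prob_ge0 andbT -[leRHS]Q01.
  by apply: prob_mono; [exact: (measurableI _ _ mp mC)|exact: mC|move=> w []].
- exact: (measurableI _ _ mp m01).
- exact: (measurableI _ _ mp mC).
- by rewrite setIACA setICr setI0.
Qed.

Let measurable_xi n k : measurable [set w | xi w n = k].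
Proof.
pose F (l : option (seq nat)) := if l is Some l' then
  if nth 0%N l' n == k then prefix (nth 0%N l') n.+1 else set0 else set0.
have mF l : measurable (F l).
  by rewrite /F; case: l => // l; case: (nth 0%N l n == k).
have -> : [set w | xi w n = k] = \bigcup_j F (unpickle j); last first.
  by apply: bigcup_measurable => j _; exact: mF.
apply/seteqP; split => w.
  move=> wk; pose l := [seq xi w i | i <- iota 0 n.+1].
  exists (pickle l) => //; suff : F (Some l) w by rewrite -(pickleK l).
  rewrite /F /l (nth_map 0%N) ?size_iota// nth_iota// add0n wk eqxx.
  by move=> i ni; rewrite (nth_map 0%N) ?size_iota// nth_iota.
move=> [j _]; move: (unpickle j) => [l|//]; rewrite /F; case: eqP => // <- h.
exact: h.
Qed.

Lemma exists_independent_sequence :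
  exists (d : measure_display) (T : measurableType d) (Q : probability T R)
    (xi : T -> nat -> nat),
  [/\ forall n k, measurable [set w | xi w n = k],
      forall w n, 0 < q n (xi w n) &
      forall k N, prob Q [set w | forall n, (n < N)%N -> xi w n = k n] =
        \prod_(0 <= n < N) q n (k n)].
Proof.
exists _, _, Q, xi; split.
- exact: measurable_xi.
- by move=> w n; apply: q_pick; exact: pos01.
- exact: prob_prefix.
Qed.

End discrete_sequence.

(** From initial segments to arbitrary finite sets, one coordinate at a time: fixing all coordinates
    below [N], including those outside [S], leaves a full initial segment, and summing over
    cylinders removes the extra ones. *)
Lemma prob_independent_sequence {R : realType} (q : nat -> nat -> R)
    {d : measure_display} {T : measurableType d} (Q : probability T R) (xi : T -> nat -> nat) :
  (forall n k, measurable [set w | xi w n = k]) -> (forall n k, 0 <= q n k) ->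
  (forall k N, prob Q [set w | forall n, (n < N)%N -> xi w n = k n] =
     \prod_(0 <= n < N) q n (k n)) ->
  forall (S : seq nat) k, uniq S ->
    prob Q [set w | forall n, n \in S -> xi w n = k n] = \prod_(n <- S) q n (k n).
Proof.
move=> mxi q0 Hq S k uS.
pose A N := [set w | forall n, (n < N)%N -> n \in S -> xi w n = k n].
have HA N : prob Q (A N) = \prod_(0 <= n < N | n \in S) q n (k n).
  elim: N => [|N IH].
    rewrite big_nil (_ : A 0%N = setT) ?prob_setT//.
    by apply/seteqP; split.
  rewrite big_mkcond big_nat_recr//= -big_mkcond /= -IH.
  case: ifPn => NS; last first.
    rewrite mulr1; congr prob; apply/seteqP; split => w h n nN nS; apply: h => //;
      first exact: leqW.
    by move: nN; rewrite ltnS leq_eqVlt => /predU1P[e|//]; rewrite e (negbTE NS) in nS.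
  have dA : determined xi (iota 0 N) (A N).
    by move=> w w' h cw n nN nS; rewrite cw ?h// mem_iota.
  have -> : A N.+1 = A N `&` [set w | xi w N = k N].
    apply/seteqP; split => w.
      by move=> h; split=> [n nN nS|]; apply: h => //; exact: leqW.
    by move=> [h /= e] n; rewrite ltnS leq_eqVlt => /predU1P[->//|nN nS]; exact: h.
  rewrite mulrC; apply: (prob_determinedI mxi dA) => // w _.
  have -> : cylinder xi (iota 0 N) w = [set w' | forall n, (n < N)%N -> xi w' n = xi w n].
    by apply/seteqP; split => w' h n; rewrite ?mem_iota => nN; apply: h; rewrite ?mem_iota.
  pose k' n := if (n < N)%N then xi w n else k n.
  have -> : [set w' | forall n, (n < N)%N -> xi w' n = xi w n] `&` [set w' | xi w' N = k N] =
    [set w' | forall n, (n < N.+1)%N -> xi w' n = k' n].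
    apply/seteqP; split => w'.
      move=> [h /= e] n; rewrite ltnS leq_eqVlt /k' => /predU1P[->|nN]; first by rewrite ltnn.
      by rewrite nN h.
    by move=> h; split=> [n nN|/=]; [have := h n (leqW nN)|have := h N (leqnn _)];
      rewrite /k' ?nN ?ltnn.
  rewrite !Hq big_nat_recr//= mulrC /k' ltnn; congr (_ * _).
  by apply: eq_big_nat => n /andP[_ nN]; rewrite nN.
pose N := (\max_(n <- S) n).+1.
have SN n : n \in S -> (n < N)%N by move=> nS; rewrite ltnS; apply: leq_bigmax_seq.
have -> : [set w | forall n, n \in S -> xi w n = k n] = A N.
  apply/seteqP; split => w h n; first by move=> _; exact: h.
  by move=> nS; apply: h => //; exact: SN.
rewrite HA -big_filter; apply: perm_big; apply: uniq_perm => //.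
  by rewrite filter_uniq// iota_uniq.
by move=> n; rewrite mem_filter mem_index_iota /=; case: (boolP (n \in S)) => // /SN ->.
Qed.

Section brw_existence.
Context {R : realType}.
Variables (kappa : seq nat -> nat) (lam : R) (mu : nat -> R).
Hypothesis lam_gt0 : 0 < lam.
Hypothesis kappa_gt0 : forall x, (0 < kappa x)%N.
Hypothesis mu_ge0 : forall k, 0 <= mu k.
Hypothesis mu_sum : (fun n => \sum_(0 <= k < n) mu k) @ \oo --> (1 : R).

(* [inl u] indexes the offspring number of [u], and [inr (u, z)] the position of [u] when
   its parent sits at [z]. *)
Let index := (seq nat + seq nat * seq nat)%type.

Let law_of (c : index) (k : nat) : R :=
  match c with
  | inl _ => mu k
  | inr (_, z) => if @pickle_inv (seq nat) k is Some y then bstep kappa lam z y else 0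
  end.

(** Numbers that encode no index receive [mu] as an idle law. *)
Let q n : nat -> R := if @unpickle index n is Some c then law_of c else mu.

Let law_of_ge0 c k : 0 <= law_of c k.
Proof.
case: c => [u|[u z]] //=; move: (@pickle_inv (seq nat) k) => [y|//]; exact: bstep_ge0.
Qed.

Let law_of_sum c : (fun N => \sum_(0 <= k < N) law_of c k) @ \oo --> (1 : R).
Proof.
case: c => [u|[u z]] //=.
pose s := [seq pickle y | y <- nbrs kappa z].
have us : uniq s.
  rewrite map_inj_in_uniq; first exact: nbrs_uniq.
  by move=> y y' _ _; exact: (pcan_inj (@pickleK (seq nat))).
pose M := (\max_(n <- s) n).+1.
have sM n : n \in s -> (n < M)%N by move=> nS; rewrite ltnS; apply: leq_bigmax_seq.
have e N : (M <= N)%N -> \sum_(0 <= k < N) law_of (inr (u, z)) k = 1.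
  move=> MN; rewrite (bigID (fun k => k \in s)) /= [X in _ + X]big1 ?addr0; last first.
    move=> k ks; case E : (pickle_inv k) => [y|//]; apply: bstep_out.
    apply: contra ks => yz; apply/mapP; exists y => //.
    by have := pickle_invK (T := seq nat) k; rewrite E.
  rewrite -big_filter (perm_big s); last first.
    apply: uniq_perm => //; first by rewrite filter_uniq// iota_uniq.
    move=> n; rewrite mem_filter mem_index_iota /=; case: (boolP (n \in s)) => // /sM nM.
    by rewrite (leq_trans nM).
  rewrite big_map -[RHS](step_op_cst lam_gt0 1 (kappa_gt0 z)).
  by apply: eq_bigr => y _; rewrite pickleK_inv mulr1.
apply: cvg_near_cst; near=> N; apply: e; near: N; exact: nbhs_infty_ge.
Unshelve. all: by end_near. Qed.

Lemma exists_brw (x : seq nat) :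
  exists (d : measure_display) (T : measurableType d) (Q : probability T R)
    (nu : T -> seq nat -> nat) (X : T -> seq nat -> seq nat),
  brw_law kappa lam mu x Q nu X.
Proof.
have q0 n k : 0 <= q n k.
  by rewrite /q; move: (@unpickle index n) => [c|//]; exact: law_of_ge0.
have q1 n : (fun N => \sum_(0 <= k < N) q n k) @ \oo --> (1 : R).
  by rewrite /q; move: (@unpickle index n) => [c|//]; exact: law_of_sum.
have [d [T [Q [xi [mxi qxi Hxi]]]]] := exists_independent_sequence q0 q1.
have Hfdd := prob_independent_sequence mxi q0 Hxi.
pose code (c : index) := pickle c.
have qc c k : q (code c) k = law_of c k by rewrite /q /code pickleK.
pose nu w u := xi w (code (inl u)).
pose move w u z := odflt [::] (@pickle_inv (seq nat) (xi w (code (inr (u, z))))).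
pose X := fun w => fix X u := if u is i :: b then move w (i :: b) (X b) else x.
(* The default [[::]] in [move] never matters: a number that encodes no word has weight 0, and [xi]
   takes no such value. *)
have moveE w u z y : move w u z = y <-> xi w (code (inr (u, z))) = pickle y.
  rewrite /move; split=> [<-|->]; last by rewrite pickleK_inv.
  have := qxi w (code (inr (u, z))); rewrite qc /=.
  have := pickle_invK (T := seq nat) (xi w (code (inr (u, z)))).
  by case: pickle_inv => [y' /= <-|]//=; rewrite ltxx.
exists d, T, Q, nu, X.
have mnu u k : measurable [set w | nu w u = k] by exact: mxi.
split => //; split.
  elim=> [|i b IH] y /=.
    by rewrite (_ : [set w | _] = (if x == y then setT else set0));
      [case: (x == y)|case: eqP => xy; apply/seteqP; split].
  pose F (oz : option (seq nat)) := if oz is Some z then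
    [set w | X w b = z] `&` [set w | move w (i :: b) z = y] else set0.
  have mF oz : measurable (F oz).
    rewrite /F; case: oz => // z; apply: measurableI => //.
    rewrite (_ : [set w | _] = [set w | xi w (code (inr (i :: b, z))) = pickle y]);
      first exact: mxi.
    by apply/seteqP; split => w /=; move/moveE.
  rewrite (_ : [set w | _] = \bigcup_j F (unpickle j)).
    by apply: bigcup_measurable => j _; exact: mF.
  apply/seteqP; split => w.
    move=> /= h; exists (pickle (X w b)) => //.
    by suff : F (Some (X w b)) w by rewrite -(pickleK (X w b)).
  by move=> [j _]; move: (unpickle j) => [z|//] [/= -> ->].
move=> S k y uS S0 Sb.
have [y0|y0] := eqVneq (y [::]) x; last first.
  rewrite !mul0r (_ : [set w | _] = set0) ?measure0// -subset0 => w /(_ _ S0)[_ /= e].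
  by rewrite -e eqxx in y0.
rewrite mul1r.
(* Once the positions are prescribed by [y], the only moves that matter are those from
   [y (behead u)]. The event thus fixes finitely many distinct coordinates, to which independence
   applies. *)
pose I1 := [seq code (inl u) | u <- S].
pose I2 := [seq code (inr (u, y (behead u))) | u <- [seq u <- S | u != [::]]].
pose val n := if @unpickle index n is Some c then
  match c with inl u => k u | inr (u, _) => pickle (y u) end else 0%N.
have cinj : injective code by exact: (pcan_inj pickleK).
have -> : [set w | forall u, u \in S -> nu w u = k u /\ X w u = y u] =
          [set w | forall n, n \in I1 ++ I2 -> xi w n = val n].
  apply/seteqP; split => w /=.
    move=> h n; rewrite mem_cat => /orP[] /mapP[u uS' ->]; rewrite /val /code pickleK.
      by have [] := h u uS'.
    move: uS'; rewrite mem_filter; case: u => // i b /= uS'.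
    by have [_ /= e] := h _ uS'; have [_ <-] := h _ (Sb _ uS'); exact/moveE.
  move=> h.
  have hn u : u \in S -> nu w u = k u.
    move=> uS'; have := h (code (inl u)); rewrite /val /code pickleK; apply.
    by rewrite mem_cat; apply/orP; left; apply/mapP; exists u.
  have hX u : u \in S -> X w u = y u.
    elim: u => [|i b IH] uS'; first by rewrite y0.
    rewrite /= (IH (Sb _ uS')); apply/moveE.
    have := h (code (inr (i :: b, y b))); rewrite /val /code pickleK; apply.
    rewrite mem_cat; apply/orP; right; apply/mapP; exists (i :: b) => //.
    by rewrite mem_filter.
  by move=> u uS'; split; [exact: hn|exact: hX].
have uI : uniq (I1 ++ I2).
  rewrite cat_uniq map_inj_uniq ?uS; last by move=> u v /cinj[].
  rewrite map_inj_uniq ?filter_uniq ?andbT//=; last by move=> u v /cinj[].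
  by apply/hasPn => n /mapP[u _ ->]; apply/mapP => -[v _ /cinj].
rewrite probE.
  congr EFin; rewrite Hfdd// big_cat /= !big_map big_filter; congr (_ * _).
    by apply: eq_bigr => u _; rewrite qc /val /code pickleK.
  by apply: eq_bigr => u _; rewrite qc /val /code pickleK /= pickleK_inv.
apply: (@measurable_determined _ _ _ _ xi mxi (I1 ++ I2)).
by move=> w w' h cw n nI; rewrite cw// h.
Qed.

End brw_existence.

(** * The dichotomy *)

Lemma strongly_recurrent_of_zero {R : realType} (kappa : seq nat -> nat) (lam : R)
    (mu : nat -> R) (D : nat) :
  0 < lam -> (forall x, (0 < kappa x)%N) -> (forall k, 0 <= mu k) ->
  (fun n => \sum_(0 <= k < n) mu k) @ \oo --> (1 : R) -> mu 0%N = 0 -> (1 < D)%N ->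
  (forall o (r : seq nat -> R), in_tree kappa o -> r o = 0 ->
    (forall x, 0 <= r x) -> (forall x, r x <= 1) ->
    (forall x, r x <= trunc_gf mu D (step_op kappa lam r x)) -> forall x, r x = 0) ->
  brw_strongly_recurrent kappa lam mu.
Proof.
move=> lam0 k0 mu_ge0 mu_sum mu0 D1 Hz o to d T Q nu X law.
apply: (visits_io_as1 (D := D) lam0 mu_ge0 mu_sum law) => //; first exact: ltnW.
apply: avoid_prob_vanishes => // r; exact: Hz.
Qed.

(** Degrees are integers, so if all of them are below [lam] they share a bound strictly below [lam],
    as the Lyapunov function requires. *)
Lemma nat_below {R : realType} (lam : R) : 0 < lam ->
  exists2 n : nat, n%:R < lam & forall k : nat, k%:R < lam -> (k <= n)%N.
Proof.
move=> lam0; have ex : exists k : nat, lam <= k.+1%:R.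
  by exists (Num.truncn lam); apply: ltW; exact: truncnS_gt.
have [n ln nmin] := ex_minnP ex; exists n.
  case: n ln nmin => // n ln nmin; rewrite ltNge; apply/negP => /nmin; lia.
by move=> k kl; rewrite -ltnS -(ltr_nat R); exact: lt_le_trans ln.
Qed.

Theorem theorem1p2 (R : realType) (p : nat -> R) (mBGW : R) (dmin : nat)
    (mu : nat -> R) (m lam : R)
    (d : measure_display) (T : measurableType d) (P : probability T R)
    (kappa : T -> seq nat -> nat) :
  (forall k, 0 <= p k) ->
  (fun n => \sum_(0 <= k < n) p k) @ \oo --> (1 : R) ->
  p 0%N = 0 -> p 1%N < 1 ->
  (fun n => \sum_(0 <= k < n) k%:R * p k) @ \oo --> mBGW ->
  0 < p dmin -> (forall k, (k < dmin)%N -> p k = 0) ->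
  0 < lam ->
  (forall k, 0 <= mu k) ->
  (fun n => \sum_(0 <= k < n) mu k) @ \oo --> (1 : R) ->
  mu 0%N = 0 -> mu 1%N < 1 ->
  (fun n => \sum_(0 <= k < n) k%:R * mu k) @ \oo --> m ->
  1 < m ->
  iid_family P kappa p ->
  {ae P, forall w,
    (brw_transient (kappa w) lam mu <->
       (lam < dmin%:R /\
        m <= (dmin%:R + lam) / (2 * Num.sqrt (lam * dmin%:R)))) /\
    (~ (lam < dmin%:R /\
        m <= (dmin%:R + lam) / (2 * Num.sqrt (lam * dmin%:R))) ->
       brw_strongly_recurrent (kappa w) lam mu)}.
Proof.
move=> p_ge0 p_sum p0 p1 p_mean pdmin dmin_min lam0 mu_ge0 mu_sum mu0 mu1 mu_mean m1 iid.
set cond := (_ /\ _).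
have supp := env_support p_ge0 iid.
have dmin0 : (0 < dmin)%N by rewrite lt0n; apply: contraTneq pdmin => ->; rewrite p0 ltxx.
have kge w : (forall v, 0 < p (kappa w v)) -> forall v, (dmin <= kappa w v)%N.
  move=> Hw v; rewrite leqNgt; apply/negP => /dmin_min e.
  by have := Hw v; rewrite e ltxx.
have kgt0 w : (forall v, 0 < p (kappa w v)) -> forall v, (0 < kappa w v)%N.
  by move=> /kge h v; exact: leq_trans (h v).
have [c|nc] := pselect cond.
  apply: filterS supp => w Hw; split => //; split => // _ x tx d' T' Q nu X law.
  have [C HC] := geometric_green_bound lam0 (lt_trans ltr01 m1) (kge w Hw) c.1 c.2 x x.
  exact: (visits_io_as0 lam0 mu_ge0 mu_sum law (trunc_mean_le mu_ge0 mu_sum mu_mean) HC).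
suff rec : {ae P, forall w, brw_strongly_recurrent (kappa w) lam mu}.
  have : {ae P, forall w, brw_strongly_recurrent (kappa w) lam mu /\ forall v, 0 < p (kappa w v)}.
    by apply: filterS2 rec supp => w.
  apply: filterS => w [rw Hw]; split => //; split => // tr.
  have [d' [T' [Q [nu [X law]]]]] := exists_brw lam0 (kgt0 w Hw) mu_ge0 mu_sum [::].
  have := tr [::] isT d' T' Q nu X law.
  by rewrite (rw [::] isT d' T' Q nu X law) => -[] /eqP; rewrite oner_eq0.
suff pat : (exists2 M, 1 <= M < m & pattern_from lam M (fun k => 0 < p k) 0 1) \/
    (forall k, 0 < p k -> k%:R < lam).
  case: pat => [[M /andP[M1 Mm] [H [deg [f [f0 Hf]]]]]|small].
    have [D D1 MD] := trunc_mean_gt mu_ge0 mu_sum mu_mean Mm.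
    have pdeg k : (k <= H)%N -> 0 < p (deg k) by move=> /Hf[].
    have [L [N fin]] := exists_bad_path_finite p_ge0 p_sum iid p0 p1 p_mean pdeg.
    apply: filterS2 fin supp => w fin Hw.
    apply: (strongly_recurrent_of_zero (D := D)) => //; first exact: kgt0.
    move=> o r to ro r0 r1 rs.
    have [|k kH|e e0 He] := good_top_survival lam0 (kgt0 w Hw) mu_ge0 mu_sum mu0 mu1 D1 to ro r0 r1 rs
      (deg := deg) (H := H) (f := f) (M := M).
    - by rewrite M1.
    - by have [_ h1 h2] := Hf k kH.
    - exact: (subsolution_zero_bad_comp lam0 (kgt0 w Hw) mu_ge0 mu_sum mu0 mu1 D1 to ro r0 r1 rs e0 He fin).
  have [n nl nmax] := nat_below lam0.
  apply: filterS supp => w Hw.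
  (* The case of small degrees uses only the contraction of [G], for which any [D >= 2] will do. *)
  apply: (strongly_recurrent_of_zero (D := 2)) => //; first exact: kgt0.
  move=> o r to ro r0 r1 rs.
  apply: (subsolution_zero_small_degree lam0 (kgt0 w Hw) mu_ge0 mu_sum mu0 mu1 _ to ro r0 r1 rs nl) => //.
  by move=> x; rewrite ler_nat nmax// small.
have [small|/existsNP[K /not_implyP[pK /negP]]] := pselect (forall k, 0 < p k -> k%:R < lam).
  by right.
rewrite -leNgt => lK; left.
have [hm|hm] := leP m ((dmin%:R + lam) / (2 * Num.sqrt (lam * dmin%:R))).
  (* The bound on [m] holds here, so [cond] can fail only through [lam >= dmin]. With a degree
     [K >= lam] in the support, any [M] strictly between 1 and [m] then admits a trapping
     pattern. *)
  have dl : dmin%:R <= lam.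
    by rewrite leNgt; apply/negP => h; apply: nc.
  exists ((1 + m) / 2); first by apply/andP; split; lra.
  by apply: (pattern_trap lam0 _ pdmin dmin0 pK); rewrite ?dl//; lra.
set t := _ / _ in hm.
have s0 : 0 < Num.sqrt (lam * dmin%:R) by rewrite sqrtr_gt0 mulr_gt0 ?ltr0n.
(* [M > t] is the spectral inequality at degree [dmin], while [1 <= M < m] is what the comparison on
   copies needs. *)
pose M := (Num.max 1 t + m) / 2.
have mx : Num.max 1 t < m by rewrite gt_max m1.
have M1 : 1 <= Num.max 1 t by rewrite le_max lexx.
have Mt : t <= Num.max 1 t by rewrite le_max lexx orbT.
exists M; first by apply/andP; split; rewrite /M; lra.
apply: (pattern_spectral lam0 _ pdmin dmin0); first by rewrite /M; lra.
have : t < M by rewrite /M; lra.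
by rewrite /t ltr_pdivrMr ?mulr_gt0// addrC [M * _]mulrC.
Qed.
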